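(* Let $A$ be an unbounded normal operator on an infinite-dimensional Hilbert space $\mathcal{H}$ and let $\alpha\in\rho(A)\cap\mathbb{R}$. Let $(\mathcal{L}_n)\in\Lambda(A)$, let $z\in\sigma_{\mathrm{dis}}(A)$ with $(z-\alpha)^{-1}\notin\mathcal{Q}(\sigma_{\mathrm{ess}}((A-\alpha)^{-1}))$, put $\varepsilon_n=\delta_A(\mathcal{L}(\{z,\overline{z}\}),\mathcal{L}_n)$, and fix an admissible radius $r$ with circle $\Gamma$ (as defined in the context). Then $\hat\delta\big(\hat{\mathcal{M}}_n(\{(z-\alpha)^{-1}\},r),\mathcal{M}_\alpha(\{z\})\big)=\mathcal{O}(\varepsilon_n)$, $\mathrm{dist}[z,\sigma(S_n)]=\mathcal{O}(\varepsilon_n)$, and $z$ is isolated in $\lim_{n\to\infty}\sigma(S_n)$.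
   Context: $\rho,\sigma,\sigma_{\mathrm{dis}},\sigma_{\mathrm{ess}}$ denote resolvent set, spectrum, discrete spectrum, essential spectrum. $\mathrm{Dom}(A)$ carries the norm $\|\phi\|_A=\sqrt{\|A\phi\|^2+\|\phi\|^2}$; $\mathrm{dist}_A$ is the corresponding distance, and for subspaces of $\mathrm{Dom}(A)$, $\delta_A(\mathcal{L},\mathcal{M})=\sup_{\psi\in\mathcal{L},\|\psi\|_A=1}\mathrm{dist}_A[\psi,\mathcal{M}]$. $(\mathcal{L}_n)\in\Lambda(A)$ means: the $\mathcal{L}_n\subset\mathrm{Dom}(A)$ are finite-dimensional subspaces and $\mathrm{dist}_A[\psi,\mathcal{L}_n]\to0$ for every $\psi\in\mathrm{Dom}(A)$. For subspaces of $\mathcal{H}\oplus\mathcal{H}$, $\delta(\mathcal{L},\mathcal{M})=\sup_{\psi\in\mathcal{L},\|\psi\|=1}\mathrm{dist}[\psi,\mathcal{M}]$ and $\hat\delta(\mathcal{L},\mathcal{M})=\max\{\delta(\mathcal{L},\mathcal{M}),\delta(\mathcal{M},\mathcal{L})\}$. For compact $\Sigma\subset\mathbb{C}$: $\Sigma_w=\{(\lambda-w)(\overline\lambda-w):\lambda\in\Sigma\}$ and $\mathcal{Q}(\Sigma)=\{w\in\mathbb{C}:0\in\mathrm{conv}(\Sigma_w)\}$, where $\mathrm{conv}$ is the closed convex hull. For a basis $\{\psi_1,\dots,\psi_m\}$ of $\mathcal{L}_n$, let $B_{i,j}=\langle A\psi_j,A\psi_i\rangle$, $L_{i,j}=\langle(A+A^*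 )\psi_j,\psi_i\rangle$, $M_{i,j}=\langle\psi_j,\psi_i\rangle$ and $S_n=\begin{pmatrix}M^{-1}&0\\ 0&M^{-1}\end{pmatrix}\begin{pmatrix}L&-B\\ M&0\end{pmatrix}$. (Thus $\sigma(S_n)$ is the set of $w\in\mathbb{C}$ for which there is $\phi\in\mathcal{L}_n\backslash\{0\}$ with $\langle(A-w)\phi,(A-\overline{w})\psi\rangle=0$ for all $\psi\in\mathcal{L}_n$.) $\lim_{n\to\infty}\sigma(S_n)=\{w\in\mathbb{C}:\text{there exist }w_n\in\sigma(S_n)\text{ with }w_n\to w\}$. Let $\hat{\mathcal{L}}_n=(A-\alpha)\mathcal{L}_n$, let $\hat P_n$ be the orthogonal projection onto $\hat{\mathcal{L}}_n$, and $$\hat S_n(\alpha)=\begin{pmatrix}\hat P_n[(A-\alpha)^{-1}+(A^*-\alpha)^{-1}]&-\hat P_n(A-\alpha)^{-1}(A^*-\alpha)^{-1}\\ I&0\end{pmatrix}:\hat{\mathcal{L}}_n\oplus\hat{\mathcal{L}}_n\to\hat{\mathcal{L}}_n\oplus\hat{\mathcal{L}}_n.$$ Admissible $r,\Gamma$: $\Gamma$ is the circle with center $(z-\alpha)^{-1}$ and radius $r>0$, where $r$ is smaller than the distance from $(z-\alpha)^{-1}$ to $\big(\mathcal{Q}(\sigma_{\mathrm{ess}}((A-\alpha)^{-1}))\cup\sigma((A-\alpha)^{-1})\cup\sigma((A^*-\alpha)^{-1})\big)\backslash\{(z-\alpha)^{-1}\}$, $\Gamma\cap\mathbb{R}=\varnothing$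 if $z\notin\mathbb{R}$, and $\Gamma$ does not pass through $0$ if $z\in\mathbb{R}$. $\hat{\mathcal{M}}_n(\{(z-\alpha)^{-1}\},r)$ is the spectral subspace of $\hat S_n(\alpha)$ associated with its eigenvalues enclosed by $\Gamma$. $\mathcal{L}(\{z\})$ and $\mathcal{L}(\{\overline z\})$ are the eigenspaces of $A$ for $z$ and $\overline z$ (the latter is $\{0\}$ if $\overline z\notin\sigma_{\mathrm{dis}}(A)$) and $\mathcal{L}(\{z,\overline z\})$ is the linear span of both. Let $\mathcal{L}(\{z\})=\mathrm{span}\{\phi_1,\dots,\phi_k\}$, $\mathcal{L}(\{\overline z\})=\mathrm{span}\{\phi_{k+1},\dots,\phi_{k+m}\}$ with orthonormal $\phi_j$. Then $\mathcal{M}_\alpha(\{z\})$ is the span of the vectors $\begin{pmatrix}(z-\alpha)^{-1}\phi_j\\ \phi_j\end{pmatrix}$, $1\le j\le k+m$, if $z\notin\mathbb{R}$, and the span of the vectors $\begin{pmatrix}0\\ \phi_j\end{pmatrix},\begin{pmatrix}\phi_j\\ 0\end{pmatrix}$ over all these $j$ if $z\in\mathbb{R}$. *)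

(* Defs.v *)
From HB Require Import structures.
From mathcomp Require Import all_boot all_order all_algebra.
From mathcomp Require Import complex.
From mathcomp Require Import all_classical all_reals all_analysis.

Set Implicit Arguments.
Unset Strict Implicit.
Unset Printing Implicit Defensive.

Import Order.TTheory GRing.Theory Num.Theory.
Import numFieldNormedType.Exports.

Local Open Scope classical_set_scope.
Local Open Scope ring_scope.

(* The complex field is R[i] with R : realType; the library puts its topology
   on the alias R[i]^o, whence the casts below.  A Hilbert space is a
   completeNormedModType R[i] together with dot : {dot H for Num.conj} (linear
   on the left, conjugate-linear on the right) whose square is `|x| ^+ 2. *)

(* Norms over R[i] take values in R[i]; rnorm is the same number seen in R. *)
Definition rnorm (R : realType) (V : normedZmodType R[i]) (v : V) : R :=
  complex.Re `|v|.

Section Subspaces.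
Context {R : realType} {V : lmodType R[i]}.
Implicit Types U X : set V.

Definition subspace U :=
  U 0 /\ forall (a : R[i]) (u v : V), U u -> U v -> U (a *: u + v).

Definition lspan X : set V :=
  [set v | exists (n : nat) (c : 'I_n -> R[i]) (x : 'I_n -> V),
     (forall i, X (x i)) /\ v = \sum_(i < n) c i *: x i].

Definition finite_dim U := exists s : seq V, U = lspan [set` s].

Definition is_basis U n (x : 'I_n -> V) :=
  (forall c : 'I_n -> R[i],
     \sum_(i < n) c i *: x i = 0 -> forall i, c i = 0) /\
  U = lspan (range x).

End Subspaces.

Section Gaps.
Context {R : realType} {V : zmodType}.
Variable N : V -> R.

(* For M a subspace the infimum is over a nonempty set bounded below by 0. *)
Definition dist (v : V) (M : set V) : R := inf [set N (v - u) | u in M].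

(* The set is bounded by 1 when 0 is in M; delta [set 0] M = 0, since the
   supremum of the empty set of reals is 0 in the library. *)
Definition delta (L M : set V) : R :=
  sup [set dist v M | v in [set v | L v /\ N v = 1]].

Definition gap (L M : set V) : R := Num.max (delta L M) (delta M L).

End Gaps.

(* Possibly unbounded operators: the values of act outside of dom are
   irrelevant. *)
Record operator (V : Type) := Operator { dom : set V; act :> V -> V }.

Section Operators.
Context {R : realType} {H : completeNormedModType R[i]}.
Implicit Types A B : operator H.

Definition linear_op A :=
  subspace (dom A) /\
  forall (a : R[i]) (u v : H), dom A u -> dom A v ->
    A (a *: u + v) = a *: A u + A v.

Definition graph A : set (H * H) := [set p | dom A p.1 /\ p.2 = A p.1].

Definition bounded_op A :=
  exists K : R, forall x, dom A x -> rnorm (A x) <= K * rnorm x.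

Definition shift A (w : R[i]) : operator H :=
  Operator (dom A) (fun x => A x - w *: x).

Definition comp_op A B : operator H :=
  Operator [set x | dom B x /\ dom A (B x)] (fun x => A (B x)).

Definition inv_op A : operator H :=
  Operator (A @` dom A) (fun y => xget 0 [set x | dom A x /\ A x = y]).

Definition eq_op A B := dom A = dom B /\ forall x, dom A x -> A x = B x.

Definition resolvent A (w : R[i]) : operator H := inv_op (shift A w).

Definition resolvent_set A : set R[i] :=
  [set w | set_bij (dom A) setT (shift A w) /\ bounded_op (resolvent A w)].

Definition spectrum A : set R[i] := ~` resolvent_set A.

Definition eigspace A (w : R[i]) : set H :=
  [set x | dom A x /\ A x = w *: x].

(* Isolated eigenvalues of finite multiplicity; for the normal operators
   considered here, algebraic and geometric multiplicities agree. *)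
Definition discrete_spectrum A : set R[i] :=
  [set w | [/\ isolated (spectrum A : set R[i]^o) w,
               eigspace A w <> [set 0] & finite_dim (eigspace A w)]].

Definition essential_spectrum A : set R[i] :=
  spectrum A `\` discrete_spectrum A.

Definition graph_norm A (x : H) : R :=
  Num.sqrt (rnorm (A x) ^+ 2 + rnorm x ^+ 2).

Definition Lambda A (Ln : nat -> set H) :=
  (forall n, finite_dim (Ln n) /\ Ln n `<=` dom A) /\
  forall x, dom A x -> dist (graph_norm A) x (Ln n) @[n --> \oo] --> (0 : R).

Definition disc_eigspace A (w : R[i]) : set H :=
  if `[< discrete_spectrum A w >] then eigspace A w else [set 0].

Definition disc_eigspace2 A (z : R[i]) : set H :=
  lspan (disc_eigspace A z `|` disc_eigspace A (z^*)%R).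

(* The Hilbert norm of the direct sum (the library norm on H * H is a max). *)
Definition pair_norm (p : H * H) : R :=
  Num.sqrt (rnorm p.1 ^+ 2 + rnorm p.2 ^+ 2).

(* s lists the vectors phi_1, ..., phi_(k+m). *)
Definition M_space (alpha z : R[i]) (s : seq H) : set (H * H) :=
  if z \is Num.real then
    lspan ([set (0, x) | x in [set` s]] `|` [set (x, 0) | x in [set` s]])
  else lspan [set ((z - alpha)^-1 *: x, x) | x in [set` s]].

End Operators.

Section Adjoint.
Context {R : realType} {H : completeNormedModType R[i]}.
Variable dot : {dot H for Num.conj}.
Implicit Type A : operator H.

(* The value is unique when A is densely defined. *)
Definition adjoint A : operator H :=
  let is_adj y y' := forall x, dom A x -> dot (A x) y = dot x y' in
  Operator [set y | exists y', is_adj y y']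
           (fun y => xget 0 [set y' | is_adj y y']).

Definition normal_op A :=
  [/\ linear_op A, dense (dom A), closed (graph A) &
      eq_op (comp_op (adjoint A) A) (comp_op A (adjoint A))].

Definition S_mx A m (psi : 'I_m -> H) : 'M[R[i]]_(m + m) :=
  let B := \matrix_(i, j) dot (A (psi j)) (A (psi i)) in
  let L := \matrix_(i, j) dot (A (psi j) + adjoint A (psi j)) (psi i) in
  let M := \matrix_(i, j) dot (psi j) (psi i) in
  block_mx (invmx M) 0 0 (invmx M) *m block_mx L (- B) M 0.

Definition sigma_S A m (psi : 'I_m -> H) : set R[i] :=
  [set w | eigenvalue (S_mx A psi) w].

Definition orth_proj (M : set H) (x : H) : H :=
  xget 0 [set p | M p /\ forall q, M q -> dot (x - p) q = 0].

Definition Lhat A (alpha : R[i]) (L : set H) : set H := shift A alpha @` L.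

Definition S_hat A (alpha : R[i]) (L : set H) (v : H * H) : H * H :=
  let P := orth_proj (Lhat A alpha L) in
  let T := resolvent A alpha in
  let T' := resolvent (adjoint A) alpha in
  (P (T v.1 + T' v.1) - P (T (T' v.2)), v.1).

(* The sum of the generalized eigenspaces of S_hat, as an operator on
   Lhat (+) Lhat, for the eigenvalues inside the circle of center c and
   radius r. *)
Definition M_hat A (alpha : R[i]) (L : set H) (c : R[i]) (r : R) :
    set (H * H) :=
  lspan (\bigcup_(mu in [set mu | rnorm (mu - c) < r])
    [set v | [/\ Lhat A alpha L v.1, Lhat A alpha L v.2 &
       exists k, iter k (fun u => S_hat A alpha L u - mu *: u) v = 0]]).

End Adjoint.

Section ComplexPlane.
Context {R : realType}.
Implicit Types (X : set R[i]) (w z : R[i]).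

(* Extended-real valued: the distance to the empty set is +oo. *)
Definition distC w X : \bar R := ereal_inf [set (rnorm (w - u))%:E | u in X].

(* Convex combinations over R[i] only involve coefficients t with 0 <= t <= 1
   in the partial order of R[i]; these are real. *)
Definition closed_conv X : set R[i] :=
  smallest (fun Y : set R[i]^o => convex_set Y /\ closed Y) X.

Definition quad_set X : set R[i] :=
  [set w | closed_conv [set (l - w) * ((l^* )%R - w) | l in X] 0].

(* Finitely many terms w_ n are unconstrained, so that the limit does not
   depend on the first terms of the sequence of sets. *)
Definition lim_set (sigma : nat -> set R[i]) : set R[i] :=
  [set w | exists w_ : nat -> R[i]^o,
     (\forall n \near \oo, sigma n (w_ n)) /\ w_ @ \oo --> (w : R[i]^o)].

End ComplexPlane.

Definition admissible (R : realType) (H : completeNormedModType R[i])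
    (dot : {dot H for Num.conj}) (A : operator H) (alpha z : R[i]) (r : R) :=
  let c := (z - alpha)^-1 in
  let T := resolvent A alpha in
  let T' := resolvent (adjoint dot A) alpha in
  [/\ 0 < r,
      (r%:E < distC c ((quad_set (essential_spectrum T) `|`
                 spectrum T `|` spectrum T') `\ c))%E,
      z \isn't Num.real -> forall w, rnorm (w - c) = r -> w \isn't Num.real &
      z \is Num.real -> rnorm (0 - c) <> r].

(* Main.v *)
(** Put [T = (A - alpha)^-1], a bounded normal operator, [c = (z - alpha)^-1] and
    [G(l) = (T - l)(T^* - l)].  A point [w] belongs to the spectrum of [S_n] iff
    [P_n G(mu) u = 0] for [mu = (w - alpha)^-1] and some nonzero [u] in the n-th
    trial space of [T].  When [l] is outside [Q(sigma_ess T)], a line separates 0 from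
    the values of the symbol [(lambda - l)(conj lambda - l)] on [sigma_ess T], so a
    multiple of [G(l)] is coercive off finitely many eigenvectors; with a test
    vector corrected on these, this gives Galerkin estimates uniform in [n]:
    the resolvent of the compressed operator [S] is bounded on each annulus
    [s <= |l - c| <= r], and at [l = c] the component of [v] orthogonal to [ker G(c)]
    is at most [C (that of (S - c) v) + O(eps_n) |v|].

    Averages over roots of unity, in place of contour integrals of the resolvent,
    show that [|(S - c)^i v| <= C s^i |v|] on the spectral subspace; iterating the
    estimate at [c] for [s] small makes its elements [O(eps_n)]-close to [ker G(c)].
    The same averages bound the distance of [y] to the spectral subspace by
    [|(S - c)^2 y|], which is [O(eps_n)] for [y] close to the limit subspace.
    Finally, pairing [G(mu) u] with the projection of an eigenvector [u] onto
    [ker G(c)] gives [(mu - c)(mu - conj c) = O(eps_n^2)], which is needed when [c] is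
    a double zero. *)

From HB Require Import structures.
Require Import Defs.
From mathcomp Require Import all_boot all_order all_algebra.
From mathcomp Require Import complex.
From mathcomp Require Import ring lra zify.
From mathcomp Require Import all_classical all_reals all_analysis.
Import Order.TTheory GRing.Theory Num.Theory.
Import numFieldNormedType.Exports.
Local Open Scope classical_set_scope.
Local Open Scope ring_scope.

Set Implicit Arguments.
Unset Strict Implicit.
Unset Printing Implicit Defensive.

(** * Real inner products *)

(** No spectral measure enters. The one fact needed from functional calculus is that the infimum of
    the form of a bounded self-adjoint operator commuting with [T] and [Ts] is approached along
    approximate eigenvectors of [T]. For the self-adjoint part of [p G(l)] it turns bounds on the
    symbol at spectral points into coercivity; for [B = T - l] and the operator
    [(Bs B)^2 - rho^2 Bs B] it shows that isolated spectral points are eigenvalues.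

    The compressed operator [S] is not normal, although [T] is. For real [c] its limit on pairs from
    [ker G(c)] is a Jordan block. Near [c] one therefore only controls the part of a vector off the
    kernel, a uniform resolvent bound is available only away from [c], and for real [c] the
    eigenvalue error is first bounded in the square.

    All constants are fixed before the approximation error [eta] of [ker G(c)]. The estimates can
    then be used with [eta] proportional to [eps_n], for the rates, and with a small fixed [eta],
    for the existence and localisation of eigenvalues. *)

Section Rnorm.
Context {R : realType}.

Lemma rnormE (V : normedZmodType R[i]) (v : V) : `|v| = (rnorm v)%:C%C.
Proof. by rewrite /rnorm RRe_real // ger0_real. Qed.

Lemma rnorm_ge0 (V : normedZmodType R[i]) (v : V) : 0 <= rnorm v.
Proof. by rewrite -ler0c -rnormE. Qed.

Lemma rnorm0 (V : normedZmodType R[i]) : rnorm (0 : V) = 0.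
Proof. by rewrite /rnorm normr0. Qed.

Lemma rnorm_eq0 (V : normedZmodType R[i]) (v : V) : rnorm v = 0 -> v = 0.
Proof. by move=> h; apply: normr0_eq0; rewrite rnormE h. Qed.

Lemma rnormM (a b : R[i]) : rnorm (a * b) = rnorm a * rnorm b.
Proof. by apply: complexI; rewrite -rnormE rmorphM /= -!rnormE normrM. Qed.

Lemma rnormX (a : R[i]) n : rnorm (a ^+ n) = rnorm a ^+ n.
Proof. by apply: complexI; rewrite -rnormE rmorphXn /= -!rnormE normrX. Qed.

Lemma rnormV (a : R[i]) : rnorm a^-1 = (rnorm a)^-1.
Proof. by apply: complexI; rewrite -rnormE fmorphV /= -!rnormE normfV. Qed.

Lemma rnormC (t : R) : rnorm (t%:C%C : R[i]) = `|t|.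
Proof.
by apply: complexI; rewrite -rnormE normc_def /= expr0n addr0 sqrtr_sqr.
Qed.

Lemma rnorm1 : rnorm (1 : R[i]) = 1.
Proof. by rewrite -[1]/(1%:C%C) rnormC normr1. Qed.

Lemma rnormJ (a : R[i]) : rnorm (a^* : R[i]) = rnorm a.
Proof. by apply: complexI; rewrite -!rnormE norm_conjC. Qed.

Lemma rnorm_gt0 (a : R[i]) : a != 0 -> 0 < rnorm a.
Proof.
by move=> a0; rewrite lt_def rnorm_ge0 andbT; apply: contra_neq a0 => /rnorm_eq0.
Qed.

Lemma sqr_rnorm (a : R[i]) :
  rnorm a ^+ 2 = complex.Re a ^+ 2 + complex.Im a ^+ 2.
Proof.
apply: complexI; rewrite rmorphXn /= -rnormE -add_Re2_Im2.
by rewrite rmorphD.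
Qed.

Lemma mulJr (a : R[i]) : a^* * a = (rnorm a ^+ 2)%:C%C.
Proof. by rewrite rmorphXn /= -rnormE mulrC -normCK. Qed.

Lemma Re_le_rnorm (a : R[i]) : `|complex.Re a| <= rnorm a.
Proof. by rewrite -lecR -rnormE normc_ge_Re. Qed.

Lemma realCN1 : (-1)%:C%C = -1 :> R[i].
Proof. by apply/eqP; rewrite eq_complex /= oppr0 !eqxx. Qed.

Lemma sqr_normr (x : R) : `|x| ^+ 2 = x ^+ 2.
Proof. by rewrite real_normK // num_real. Qed.

Lemma invn_small (e : R) : 0 < e ->
  exists k : nat, forall n : nat, (k <= n)%N -> n.+1%:R^-1 < e.
Proof.
move=> e0; have [k _ hk] := near_infty_natSinv_lt (PosNum e0).
by exists k => n kn; exact: hk.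
Qed.

Lemma le0_of_small (x C : R) : (forall e, 0 < e -> x <= C * e) -> x <= 0.
Proof.
move=> h; rewrite leNgt; apply/negP => x0.
have C0 : 0 < `|C| + 1 by rewrite ltr_wpDl.
have := h (x / (`|C| + 1) / 2) (divr_gt0 (divr_gt0 x0 C0) (ltr0n _ 2)).
apply/negP; rewrite -ltNge.
apply: (@le_lt_trans _ _ (x / 2)); last by lra.
rewrite mulrA ler_pM2r ?invr_gt0 // mulrA ler_pdivrMr //.
rewrite mulrC ler_pM2l //; have := ler_norm C; lra.
Qed.

End Rnorm.

Section Inner.
Context {R : realType} {V : lmodType R[i]}.

(* Only the real part of the complex inner product is recorded; sesquilinearity
   survives as the rule [inZ] for moving complex scalars. *)
Record inner (ip : V -> V -> R) (N : V -> R) := Inner {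
  inC : forall x y, ip x y = ip y x;
  inD : forall x y z, ip (x + y) z = ip x z + ip y z;
  inR : forall (t : R) x y, ip (t%:C%C *: x) y = t * ip x y;
  inZ : forall (a : R[i]) x y, ip (a *: x) y = ip x (a^* *: y);
  inN : forall x, ip x x = N x ^+ 2;
  inge0 : forall x, 0 <= N x;
  ineq0 : forall x, N x = 0 -> x = 0 }.

Definition cauchyN (N : V -> R) (u : nat -> V) := forall e : R, 0 < e ->
  exists k, forall m n, (k <= m)%N -> (k <= n)%N -> N (u m - u n) < e.
Definition cvgN (N : V -> R) (u : nat -> V) (x : V) := forall e : R, 0 < e ->
  exists k, forall n, (k <= n)%N -> N (u n - x) < e.
Definition completeN N (W : set V) := forall u : nat -> V,
  (forall n, W (u n)) -> cauchyN N u -> exists2 x, W x & cvgN N u x.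

Variables (ip : V -> V -> R) (N : V -> R).
Hypothesis I : inner ip N.

Lemma inDr x y z : ip z (x + y) = ip z x + ip z y.
Proof. by rewrite !(inC I z) (inD I). Qed.

Lemma inRr (t : R) x y : ip x (t%:C%C *: y) = t * ip x y.
Proof. by rewrite !(inC I x) (inR I). Qed.

Lemma inNl x y : ip (- x) y = - ip x y.
Proof. by have := inR I (-1) x y; rewrite realCN1 scaleN1r mulN1r. Qed.

Lemma inNr x y : ip x (- y) = - ip x y.
Proof. by rewrite !(inC I x) inNl. Qed.

Lemma inBl x y z : ip (x - y) z = ip x z - ip y z.
Proof. by rewrite (inD I) inNl. Qed.

Lemma inBr x y z : ip z (x - y) = ip z x - ip z y.
Proof. by rewrite inDr inNr. Qed.

Lemma in0l x : ip 0 x = 0.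
Proof. by rewrite -(subrr x) inBl subrr. Qed.

Lemma in0r x : ip x 0 = 0.
Proof. by rewrite (inC I) in0l. Qed.

Lemma inN0 : N 0 = 0.
Proof. by apply/eqP; rewrite -sqrf_eq0 -(inN I) in0l. Qed.

Lemma inNZ (a : R[i]) x : N (a *: x) = rnorm a * N x.
Proof.
apply/eqP; rewrite -(@eqrXn2 _ 2) ?mulr_ge0 ?(inge0 I) ?rnorm_ge0 //.
by rewrite exprMn -!(inN I) (inZ I) scalerA mulJr inRr.
Qed.

Lemma inNN x : N (- x) = N x.
Proof. by rewrite -scaleN1r inNZ -realCN1 rnormC normrN1 mul1r. Qed.

Lemma inNB x y : N (x - y) = N (y - x).
Proof. by rewrite -inNN opprB. Qed.

Lemma sqrD_in x y : N (x + y) ^+ 2 = N x ^+ 2 + 2 * ip x y + N y ^+ 2.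
Proof. rewrite -!(inN I) (inD I) !inDr (inC I y x); ring. Qed.

Lemma sqrB_in x y : N (x - y) ^+ 2 = N x ^+ 2 - 2 * ip x y + N y ^+ 2.
Proof. by rewrite sqrD_in inNr inNN; ring. Qed.

Lemma in_CS x y : `|ip x y| <= N x * N y.
Proof.
have [y0|y0] := eqVneq (N y) 0.
  by rewrite (ineq0 I y0) in0r normr0 mulr_ge0 ?(inge0 I).
have yp : 0 < N y by rewrite lt_def y0 (inge0 I).
rewrite -(@ler_pXn2r _ 2) ?nnegrE ?mulr_ge0 ?(inge0 I) // sqr_normr exprMn.
have := sqr_ge0 (N (x - (ip x y / N y ^+ 2)%:C%C *: y)).
rewrite sqrB_in inRr inNZ rnormC exprMn sqr_normr => h.
have y2 : 0 < N y ^+ 2 by rewrite exprn_gt0.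
have : 0 <= (N x ^+ 2 - ip x y ^+ 2 / N y ^+ 2).
  by apply: le_trans h _; rewrite le_eqVlt; apply/orP; left; apply/eqP; field.
by rewrite subr_ge0 ler_pdivrMr.
Qed.

Lemma in_le x y : ip x y <= N x * N y.
Proof. exact: le_trans (ler_norm _) (in_CS x y). Qed.

Lemma inND x y : N (x + y) <= N x + N y.
Proof.
rewrite -(@ler_pXn2r _ 2) ?nnegrE ?addr_ge0 ?(inge0 I) // sqrD_in.
have := in_le x y; rewrite sqrrD; lra.
Qed.

Lemma inND3 x y z : N (x - z) <= N (x - y) + N (y - z).
Proof. by have := inND (x - y) (y - z); rewrite addrA subrK. Qed.

Lemma inNB_le x y : N (x - y) <= N x + N y.
Proof. by rewrite -[N y]inNN; exact: inND. Qed.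

Lemma in_sum_l (J : Type) (r : seq J) (P : pred J) (F : J -> V) y :
  ip (\sum_(i <- r | P i) F i) y = \sum_(i <- r | P i) ip (F i) y.
Proof. exact: (big_morph (ip^~ y) (fun a b => inD I a b y) (in0l y)). Qed.

Lemma in_sumN (J : Type) (r : seq J) (P : pred J) (F : J -> V) :
  N (\sum_(i <- r | P i) F i) <= \sum_(i <- r | P i) N (F i).
Proof.
elim/big_rec2 : _ => [|i y1 y2 _ h]; first by rewrite inN0.
by apply: le_trans (inND _ _) _; rewrite lerD2l.
Qed.

(** A minimising sequence of the functional [J u = N u ^+ 2 - 2 * f u] is Cauchy by the
    parallelogram law, and the first variation at its limit is the equation. As [ip] is real, [f]
    need only be linear over the reals, and a one-sided bound on [f] already bounds [J] below by
    [- C ^+ 2]. *)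
Lemma riesz (W : set V) (f : V -> R) (C : R) :
  Defs.subspace W -> completeN N W ->
  (forall (t : R) u v, W u -> W v -> f (t%:C%C *: u + v) = t * f u + f v) ->
  (forall u, W u -> f u <= C * N u) ->
  exists2 x, W x & forall u, W u -> ip u x = f u.
Proof.
move=> [W0 WL] Wc fL fC.
pose J u := N u ^+ 2 - 2 * f u.
have WR (t : R) u v : W u -> W v -> W (t%:C%C *: u + v) by exact: WL.
have f0 : f 0 = 0.
  by have := fL 1 _ _ W0 W0; rewrite scaler0 addr0; lra.
have fR (t : R) u : W u -> f (t%:C%C *: u) = t * f u.
  by move=> Wu; have := fL t _ _ Wu W0; rewrite addr0 f0 addr0.
have WRR (t : R) u : W u -> W (t%:C%C *: u).
  by move=> Wu; have := WR t _ _ Wu W0; rewrite addr0.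
have JC u : W u -> - C ^+ 2 <= J u.
  move=> Wu; rewrite /J; have := fC _ Wu; have := sqr_ge0 (N u - C); rewrite !expr2.
  nra.
pose S := [set J u | u in W].
have hS : has_inf S.
  split; first by exists (J 0), 0.
  by exists (- C ^+ 2) => _ [u Wu <-]; exact: JC.
pose m := inf S.
have Jm u : W u -> m <= J u.
  by move=> Wu; apply: ge_inf; [case: hS|exists u].
have ex n : exists u, W u /\ J u < m + n.+1%:R^-1.
  have e0 : 0 < n.+1%:R^-1 :> R by rewrite invr_gt0.
  have [_ [u Wu <-] h] := inf_adherent e0 hS.
  by exists u.
have [u hu] := choice ex.
have Wu n : W (u n) by case: (hu n).
have cu : cauchyN N u.
  (* [N (u a - u b) ^+ 2] is twice [J (u a) + J (u b)] minus four times the value of [J] at the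
     midpoint, so excesses over [m] below [e ^+ 2 / 4] suffice. *)
  move=> e e0; have [k hk] := invn_small (divr_gt0 (exprn_gt0 2 e0) (ltr0n R 4)).
  exists k => a b ka kb.
  rewrite -(@ltr_pXn2r _ 2) ?nnegrE ?(inge0 I) ?(ltW e0) //.
  have Wab : W (u a + u b) by have := WR 1 _ _ (Wu a) (Wu b); rewrite scale1r.
  have hm := Jm _ (WRR (1/2) _ Wab).
  have [_ ha] := hu a; have [_ hb] := hu b.
  have := hk _ ka; have := hk _ kb.
  have := fL 1 _ _ (Wu a) (Wu b); rewrite scale1r mul1r => e1.
  move: hm ha hb; rewrite /J fR // e1.
  rewrite inNZ rnormC exprMn sqr_normr sqrB_in sqrD_in.
  set p1 := a.+1%:R^-1; set p2 := b.+1%:R^-1.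
  lra.
have [x Wx cx] := Wc _ Wu cu; exists x => // v Wv.
pose a := ip v x - f v.
(* The right side is [J (x + t v) - J x]. It is estimated through [u n + t v] and [u n], because
   near-minimality is known along [u]. *)
have key t : 0 <= t ^+ 2 * N v ^+ 2 + 2 * t * a.
  rewrite -oppr_le0; apply: (@le0_of_small _ _ (1 + 2 * `|t| * N v)) => e e0.
  have [k1 h1] := cx _ e0; have [k2 h2] := invn_small e0.
  pose n := maxn k1 k2.
  have {}h1 := h1 n (leq_maxl _ _); have {}h2 := h2 n (leq_maxr _ _).
  have := Jm _ (WR t _ _ Wv (Wu n)); have [_] := hu n.
  rewrite /J fL // sqrD_in (inR I) inNZ rnormC exprMn sqr_normr => h3 h4.
  have : `|t * ip v (u n - x)| <= `|t| * N v * e.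
    rewrite normrM -mulrA ler_wpM2l // (le_trans (in_CS _ _)) //.
    by rewrite ler_wpM2l ?(inge0 I) // ltW.
  move=> /(le_trans (ler_norm _)); rewrite /a inBr.
  move: h2 h3; set p := n.+1%:R^-1; lra.
have B0 := sqr_ge0 (N v); set B := N v ^+ 2 in key B0.
(* Taking [t = - a / (B + 1)] instead of [- a / B] covers [v = 0] as well. *)
have B1 : B + 1 != 0 by rewrite gt_eqF // ltr_wpDl.
have := key (- a / (B + 1)).
have -> : (- a / (B + 1)) ^+ 2 * B + 2 * (- a / (B + 1)) * a =
   - (a ^+ 2 * ((B + 2) / (B + 1) ^+ 2)) by field.
rewrite oppr_ge0 pmulr_lle0; last by rewrite divr_gt0 ?exprn_gt0 ?ltr_wpDl.
rewrite le_eqVlt ltNge sqr_ge0 orbF sqrf_eq0 => /eqP h.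
by apply/eqP; rewrite -subr_eq0; apply/eqP.
Qed.

Lemma projection (W : set V) (h : V) : Defs.subspace W -> completeN N W ->
  exists2 x, W x & forall u, W u -> ip u (h - x) = 0.
Proof.
move=> sW cW; have [|u Wu|x Wx hx] := @riesz W (ip^~ h) (N h) sW cW.
- by move=> t u v _ _; rewrite (inD I) (inR I).
- by rewrite mulrC; exact: in_le.
by exists x => // u Wu; rewrite inBr hx ?subrr.
Qed.

End Inner.

Section InnerClosed.
Context {R : realType} {V : lmodType R[i]}.
Variables (ip : V -> V -> R) (N : V -> R).
Hypothesis I : inner ip N.

Definition adherent (W : set V) (x : V) :=
  forall e : R, 0 < e -> exists2 w, W w & N (w - x) < e.

Definition closedN (W : set V) := forall x, adherent W x -> W x.

Lemma closed_completeN (W : set V) :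
  completeN N setT -> closedN W -> completeN N W.
Proof.
move=> cT cW u Wu /(cT _ (fun=> Logic.I))[x _ cx]; exists x => //.
apply: cW => e /cx[k hk]; exists (u k) => //; exact: hk.
Qed.

Lemma adherent_closedN (W : set V) : closedN (adherent W).
Proof.
move=> x h e e0; have [y Wy hy] := h _ (divr_gt0 e0 (ltr0n R 2)).
have [w Ww hw] := Wy _ (divr_gt0 e0 (ltr0n R 2)).
exists w => //; apply: le_lt_trans (inND3 I _ y _) _; lra.
Qed.

Lemma adherent_sub (W : set V) x : W x -> adherent W x.
Proof. by move=> Wx e e0; exists x => //; rewrite subrr (inN0 I). Qed.

Lemma adherent_subspace (W : set V) : Defs.subspace W -> Defs.subspace (adherent W).
Proof.
move=> [W0 WL]; split; first exact: adherent_sub.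
move=> a u v Wu Wv e e0.
have a0 : 0 < rnorm a + 1 by rewrite ltr_wpDl // rnorm_ge0.
have [u' Wu' hu] := Wu _ (divr_gt0 (divr_gt0 e0 (ltr0n R 2)) a0).
have [v' Wv' hv] := Wv _ (divr_gt0 e0 (ltr0n R 2)).
exists (a *: u' + v'); first exact: WL.
have -> : a *: u' + v' - (a *: u + v) = a *: (u' - u) + (v' - v).
  by rewrite scalerBr opprD addrACA.
apply: le_lt_trans (inND I _ _) _; rewrite (inNZ I).
rewrite ltr_pdivlMr // in hu; have := inge0 I (u' - u); nra.
Qed.

Lemma adherent_cvgN (W : set V) x : adherent W x ->
  exists2 u : nat -> V, (forall n, W (u n)) & cvgN N u x.
Proof.
move=> h; have ex (n : nat) : exists w, W w /\ N (w - x) < n.+1%:R^-1.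
  have e0 : 0 < n.+1%:R^-1 :> R by rewrite invr_gt0.
  by have [w Ww hw] := h _ e0; exists w.
have [u hu] := choice ex; exists u => [n|e e0]; first by case: (hu n).
have [k hk] := invn_small e0; exists k => n kn.
exact: lt_trans (proj2 (hu n)) (hk n kn).
Qed.

Lemma cvgN_cauchy (u : nat -> V) x : cvgN N u x -> cauchyN N u.
Proof.
move=> cx e e0; have [k hk] := cx _ (divr_gt0 e0 (ltr0n R 2)).
exists k => m n km kn; apply: le_lt_trans (inND3 I _ x _) _.
by have := hk _ km; have := hk _ kn; rewrite (inNB I x); lra.
Qed.

Lemma cvgN_ip (u : nat -> V) x y (l : R) : cvgN N u x ->
  (forall e, 0 < e -> exists k, forall n, (k <= n)%N -> `|ip (u n) y - l| < e) ->
  ip x y = l.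
Proof.
move=> cx hl; apply/eqP; rewrite -subr_eq0 -normr_le0.
apply: (@le0_of_small _ _ (1 + N y)) => e e0.
have [k1 h1] := cx _ e0; have [k2 h2] := hl _ e0.
have {}h1 := h1 _ (leq_maxl k1 k2); have {}h2 := h2 _ (leq_maxr k1 k2).
set n := maxn k1 k2 in h1 h2.
have -> : ip x y - l = (ip (u n) y - l) - ip (u n - x) y by rewrite (inBl I); ring.
apply: le_trans (ler_normB _ _) _; have := in_CS I (u n - x) y.
have := inge0 I y; nra.
Qed.

End InnerClosed.

(** * The Hilbert space and its square as real inner product spaces *)

Section Hilbert.
Context {R : realType} {H : completeNormedModType R[i]}.
Variable dot : {dot H for Num.conj}.
Hypothesis dotE : forall x : H, dot x x = `|x| ^+ 2.

Definition ip (x y : H) : R := complex.Re (dot x y).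

Lemma dotC x y : dot x y = (dot y x)^*.
Proof. by rewrite hermC expr0 mul1r. Qed.

Lemma dotZl a x y : dot (a *: x) y = a * dot x y.
Proof. exact: linearZl_LR. Qed.

Lemma dotZr a x y : dot x (a *: y) = a^* * dot x y.
Proof. exact: linearZr_LR. Qed.

Lemma ReJ (a : R[i]) : complex.Re (a^*) = complex.Re a.
Proof. by case: a. Qed.

Lemma inner_ip : inner ip (@rnorm R H).
Proof.
split.
- by move=> x y; rewrite /ip dotC ReJ.
- by move=> x y z; rewrite /ip linearDl raddfD.
- by move=> t x y; rewrite /ip dotZl; case: (dot x y) => a b /=; rewrite mul0r subr0.
- by move=> a x y; rewrite /ip dotZl dotZr conjCK.
- by move=> x; rewrite /ip dotE rnormE -rmorphXn.
- by move=> x; exact: rnorm_ge0.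
- by move=> x; exact: rnorm_eq0.
Qed.

Lemma Im_dot x y : complex.Im (dot x y) = ip x ('i%C *: y).
Proof.
rewrite /ip dotZr; case: (dot x y) => a b /=; rewrite mul0r; lra.
Qed.

(** Testing against all complex multiples of [y], in particular ['i y], recovers the imaginary part
    that [ip] forgets. *)
Lemma ip_dot_eq x y x' y' :
  (forall a : R[i], ip x (a *: y) = ip x' (a *: y')) -> dot x y = dot x' y'.
Proof.
move=> h; apply/eqP; rewrite eq_complex /= !Im_dot h eqxx andbT.
by have := h 1; rewrite !scale1r /ip => ->.
Qed.

Lemma ipr_eq0 x : (forall y, ip y x = 0) -> x = 0.
Proof.
by move=> h; apply: rnorm_eq0; apply/eqP; rewrite -sqrf_eq0 -(inN inner_ip) h.
Qed.

Lemma dot_CS x y : rnorm (dot x y) <= rnorm x * rnorm y.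
Proof.
have [->|a0] := eqVneq (dot x y) 0.
  by rewrite rnorm0 mulr_ge0 ?rnorm_ge0.
rewrite -(ler_pM2l (rnorm_gt0 a0)) mulrA.
have := in_le inner_ip ((dot x y)^* *: x) y.
by rewrite (inNZ inner_ip) rnormJ /ip dotZl mulJr /= expr2.
Qed.

Lemma dotr_eq x y : (forall v, dot v x = dot v y) -> x = y.
Proof.
move=> h; apply/eqP; rewrite -subr_eq0; apply/eqP; apply: ipr_eq0 => v.
by rewrite (inBr inner_ip) /ip h subrr.
Qed.

Definition ip2 (p q : H * H) : R := ip p.1 q.1 + ip p.2 q.2.

Lemma sqr_pair_norm (p : H * H) : pair_norm p ^+ 2 = rnorm p.1 ^+ 2 + rnorm p.2 ^+ 2.
Proof. by rewrite /pair_norm sqr_sqrtr // addr_ge0 // sqr_ge0. Qed.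

Lemma inner_ip2 : inner ip2 (@pair_norm R H).
Proof.
have J := inner_ip; split; rewrite /ip2.
- by move=> x y; rewrite (inC J) [X in _ + X](inC J).
- by move=> x y z; rewrite !(inD J) addrACA.
- by move=> t x y; rewrite !(inR J) mulrDr.
- by move=> a x y; rewrite !(inZ J).
- by move=> x; rewrite !(inN J) sqr_pair_norm.
- by move=> x; exact: sqrtr_ge0.
- move=> [x y] /(congr1 (fun t => t ^+ 2)); rewrite sqr_pair_norm expr0n /= => /eqP.
  rewrite paddr_eq0 ?sqr_ge0 // !sqrf_eq0 => /andP[/eqP/rnorm_eq0-> /eqP/rnorm_eq0->].
  by [].
Qed.

Lemma le_pair1 (p : H * H) : rnorm p.1 <= pair_norm p.
Proof.
rewrite -(@ler_pXn2r _ 2) ?nnegrE ?rnorm_ge0 ?sqrtr_ge0 // sqr_pair_norm.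
by rewrite lerDl sqr_ge0.
Qed.

Lemma le_pair2 (p : H * H) : rnorm p.2 <= pair_norm p.
Proof.
rewrite -(@ler_pXn2r _ 2) ?nnegrE ?rnorm_ge0 ?sqrtr_ge0 // sqr_pair_norm.
by rewrite lerDr sqr_ge0.
Qed.

Lemma pair_le (p : H * H) : pair_norm p <= rnorm p.1 + rnorm p.2.
Proof.
rewrite -(@ler_pXn2r _ 2) ?nnegrE ?addr_ge0 ?rnorm_ge0 ?sqrtr_ge0 //.
by rewrite sqr_pair_norm sqrrD; have := rnorm_ge0 p.1; have := rnorm_ge0 p.2; nra.
Qed.

Lemma completeH : completeN (@rnorm R H) setT.
Proof.
move=> u _ cu.
have /cauchy_cvgP/cvg_ex[x cx] : cauchy (u @ \oo).
  apply: cauchy_exP => e e0.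
  have eR : e = (complex.Re e)%:C%C by rewrite RRe_real // gtr0_real.
  have /cu[k hk] : 0 < complex.Re e by rewrite -ltcR -eR.
  exists (u k); exists k => // n kn.
  by rewrite /= -ball_normE /= rnormE eR ltcR; apply: hk.
exists x => // e e0.
have eC : 0 < (e%:C%C : R[i]) by rewrite ltcR.
have /cvgrPdist_lt/(_ _ eC)[k _ hk] := cx; exists k => n kn.
by rewrite -ltcR -rnormE distrC; exact: hk.
Qed.

Lemma complete_pair : completeN (@pair_norm R H) setT.
Proof.
move=> u _ cu.
have [x1 _ c1] : exists2 x, setT x & cvgN (@rnorm R H) (fun n => (u n).1) x.
  apply: completeH => // e /cu[k hk]; exists k => m n km kn.
  exact: le_lt_trans (le_pair1 _) (hk m n km kn).
have [x2 _ c2] : exists2 x, setT x & cvgN (@rnorm R H) (fun n => (u n).2) x.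
  apply: completeH => // e /cu[k hk]; exists k => m n km kn.
  exact: le_lt_trans (le_pair2 _) (hk m n km kn).
exists (x1, x2) => // e e0; have e2 : 0 < e / 2 by rewrite divr_gt0.
have [k1 h1] := c1 _ e2; have [k2 h2] := c2 _ e2.
exists (maxn k1 k2) => n; rewrite geq_max => /andP[/h1 n1 /h2 n2].
by apply: le_lt_trans (pair_le _) _ => /=; lra.
Qed.

(** The real representation theorem applied to [Re f]; testing its vector against [- 'i u] as well
    gives the imaginary part of [f u]. *)
Lemma Riesz (f : H -> R[i]) (C : R) :
  (forall a u v, f (a *: u + v) = a * f u + f v) ->
  (forall u, rnorm (f u) <= C * rnorm u) ->
  exists x, forall u, f u = dot u x.
Proof.
move=> fL fC.
have [|||u _|x _ hx] := @riesz _ _ _ _ inner_ip setT (fun u => complex.Re (f u)) C.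
- by [].
- exact: completeH.
- by move=> t u v _ _ /=; rewrite fL raddfD /=; case: (f u) => a b /=; rewrite mul0r subr0.
- by apply: le_trans (fC u); exact: le_trans (ler_norm _) (Re_le_rnorm _).
exists x => u; have fZ a : f (a *: u) = a * f u.
  have := fL (-1) 0 0; rewrite scaler0 addr0 mulN1r addNr => f0.
  by have := fL a u 0; rewrite !addr0 f0 addr0.
have := hx u Logic.I; have := hx (- 'i%C *: u) Logic.I.
rewrite /ip dotZl fZ; case: (dot u x) => a b; case: (f u) => c d /= h1 h2.
by apply/eqP; rewrite eq_complex /= h2 eqxx; apply/eqP; lra.
Qed.

End Hilbert.

(** * Normal operators and their resolvents *)

Section Unbounded.
Context {R : realType} {H : completeNormedModType R[i]}.
Variable dot : {dot H for Num.conj}.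
Hypothesis dotE : forall x : H, dot x x = `|x| ^+ 2.
Variable A : operator H.
Hypothesis normalA : normal_op dot A.

Local Notation ip := (ip dot).
Local Notation ip2 := (ip2 dot).
Local Notation nH := (@rnorm R H).
Local Notation nHH := (@pair_norm R H).
Local Notation As := (adjoint dot A).
Let J := inner_ip dotE.
Let J2 := inner_ip2 dotE.

Lemma inZr (a : R[i]) x y : ip x (a *: y) = ip (a^* *: x) y.
Proof. by rewrite (inZ J) conjCK. Qed.

Let domS : Defs.subspace (dom A). Proof. by have [[]] := normalA. Qed.
Let dom0 : dom A 0 := proj1 domS.
Let domL (a : R[i]) u v : dom A u -> dom A v -> dom A (a *: u + v).
Proof. exact: (proj2 domS). Qed.
Let linA : forall (a : R[i]) (u v : H), dom A u -> dom A v ->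
  A (a *: u + v) = a *: A u + A v.
Proof. by have [[]] := normalA. Qed.

Lemma domZ (a : R[i]) u : dom A u -> dom A (a *: u).
Proof. by move=> du; have := domL a du dom0; rewrite addr0. Qed.

Lemma opA0 : A 0 = 0.
Proof.
by have := linA (-1) (proj1 domS) (proj1 domS); rewrite scaler0 addr0 scaleN1r addNr.
Qed.

Lemma opAZ (a : R[i]) u : dom A u -> A (a *: u) = a *: A u.
Proof. by move=> du; have := linA a du (proj1 domS); rewrite !addr0 opA0 addr0. Qed.

Lemma domB u v : dom A u -> dom A v -> dom A (u - v).
Proof. by move=> du dv; have := domL (-1) dv du; rewrite scaleN1r addrC. Qed.

Lemma opAB u v : dom A u -> dom A v -> A (u - v) = A u - A v.
Proof. by move=> du dv; have := linA (-1) dv du; rewrite !scaleN1r addrC [RHS]addrC. Qed.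

Lemma adjointP x y : dom A x -> dom As y -> dot (A x) y = dot x (As y).
Proof. move=> dx dy.
exact: (@xgetPex _ 0 [set y' | forall x, dom A x -> dot (A x) y = dot x y'] dy x dx). Qed.

Lemma dense_orth y : (forall x, dom A x -> ip x y = 0) -> y = 0.
Proof.
move=> h; apply: rnorm_eq0; apply/eqP; rewrite -sqrf_eq0.
rewrite eq_le sqr_ge0 andbT; apply: (@le0_of_small _ _ (rnorm y)) => e e0.
have [_ dA _ _] := normalA.
have eC : 0 < (e%:C%C : R[i]) by rewrite ltcR.
have [||x [bx dx]] := dA (interior (ball y (e%:C%C))).
- by exists y; apply: nbhsx_ballx.
- exact: open_interior.
have /= := interior_subset bx; rewrite -ball_normE /= rnormE ltcR => xe.
rewrite -(inN J) -[X in ip X _](subrK x) (inD J) (h x dx) addr0.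
by apply: le_trans (in_le J _ _) _; rewrite mulrC ler_wpM2l ?rnorm_ge0 // ltW.
Qed.

Lemma adjoint_eq y y' : (forall x, dom A x -> dot (A x) y = dot x y') ->
  dom As y /\ As y = y'.
Proof.
move=> h; have dy : dom As y by exists y'.
split=> //; apply/eqP; rewrite -subr_eq0; apply/eqP; apply: dense_orth => x dx.
by rewrite (inBr J) /ip -adjointP // h // subrr.
Qed.

Lemma adjoint_eq_ip y y' : (forall x, dom A x -> ip (A x) y = ip x y') ->
  dom As y /\ As y = y'.
Proof.
move=> h; apply: adjoint_eq => x dx; apply: ip_dot_eq => a.
by rewrite !inZr -opAZ // h //; exact: domZ.
Qed.

(** Closedness in the max norm of the product is transferred to the Hilbert norm of the direct sum,
    so that the graph becomes a Hilbert space. *)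
Lemma graph_closedN : closedN nHH (graph A).
Proof.
move=> p hp; have [_ _ cA _] := normalA; apply: cA => B /nbhs_ballP[e /= e0 eB].
have eR : e = (complex.Re e)%:C%C by rewrite RRe_real // gtr0_real.
have /hp[q gq hq] : 0 < complex.Re e by rewrite -ltcR -eR.
exists q; split=> //; apply: eB; split.
- rewrite /= -ball_normE /= rnormE eR ltcR (inNB J).
  exact: le_lt_trans (le_pair1 (q - p)) hq.
- rewrite /= -ball_normE /= rnormE eR ltcR (inNB J).
  exact: le_lt_trans (le_pair2 (q - p)) hq.
Qed.

Lemma graph_subspace : Defs.subspace (graph A).
Proof.
split; first by split; [exact: dom0|rewrite /= opA0].
move=> a u v [du hu] [dv hv]; split; first exact: domL.
by rewrite /= linA // hu hv.
Qed.

Lemma graph_complete : completeN nHH (graph A).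
Proof. exact: closed_completeN (@complete_pair R H) graph_closedN. Qed.

(** Von Neumann's argument: the functional sending [(u, A u)] to [<u, h>] on the graph is
    represented by some [(x, A x)], so [<A u, A x> = <u, h - x>] for all [u] in the domain, which
    says [As (A x) = h - x]. *)
Lemma oneAA_onto h : exists x, [/\ dom A x, dom As (A x) & As (A x) = h - x].
Proof.
have [||[x y] [/= dx ->] hx] :=
  @riesz _ _ _ _ J2 (graph A) (fun p => ip p.1 h) (rnorm h) graph_subspace graph_complete.
- by move=> t u v _ _ /=; rewrite (inD J) (inR J).
- move=> u _; apply: le_trans (in_le J _ _) _.
  by rewrite mulrC ler_wpM2l ?rnorm_ge0 // le_pair1.
exists x; have [] := @adjoint_eq_ip (A x) (h - x); last by split.
move=> u du; have := hx (u, A u) (conj du erefl); rewrite /ip2 /= (inBr J).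
lra.
Qed.

(** The domain of [As A]. Normality speaks only of these vectors; the rest of [dom A] is reached by
    approximation in the graph norm. *)
Let DD := [set x | dom A x /\ dom As (A x)].

Lemma DD_normal x : DD x ->
  [/\ dom A x, dom As x, dom As (A x), dom A (As x) & As (A x) = A (As x)].
Proof.
move=> dx; have [_ _ _ [e1 e2]] := normalA.
have : dom (comp_op As A) x by exact: dx.
rewrite e1 => -[d1 d2]; split=> //; [exact: proj1 dx|exact: proj2 dx|].
exact: (e2 x dx).
Qed.

Lemma DD_adj_norm x : DD x -> rnorm (As x) = rnorm (A x).
Proof.
move=> /DD_normal[d1 d2 d3 d4 e].
apply/eqP; rewrite -(@eqrXn2 _ 2) ?rnorm_ge0 // -!(inN J).
have -> : ip (As x) (As x) = ip (A (As x)) x by rewrite /ip adjointP.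
by rewrite /ip (adjointP d1 d3) -e (dotC dot (As _)) ReJ.
Qed.

Lemma DD_subspace : Defs.subspace DD.
Proof.
split; first by split; [exact: dom0|rewrite opA0; exists 0 => x _; rewrite !linear0r].
move=> a u v [du [u' hu]] [dv [v' hv]]; split; first exact: domL.
rewrite linA //; exists (a *: u' + v') => x dx.
by rewrite !linearDr /= !dotZr hu // hv.
Qed.

(* [DD] is a core of [A]: a vector of the graph orthogonal to the graph over
   [DD] is orthogonal to the range of [1 + A^* A]. *)
Lemma DD_core x : dom A x -> adherent nHH [set (u, A u) | u in DD] (x, A x).
Proof.
move=> dx; set W := [set _ | _ in _].
have sW : Defs.subspace W.
  split; first by exists 0; [exact: (proj1 DD_subspace)|rewrite opA0].
  move=> a _ _ [u Du <-] [v Dv <-]; exists (a *: u + v).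
    exact: (proj2 DD_subspace).
  by rewrite linA //; [case: Du|case: Dv].
have cW := @closed_completeN _ _ nHH _ (@complete_pair R H) (adherent_closedN J2 (W := W)).
have [y Wy hy] := projection J2 (x, A x) (adherent_subspace J2 sW) cW.
suff -> : (x, A x) = y by [].
have [dy y2] : graph A y.
  apply: graph_closedN => e /Wy[w [u [du _] <-] hw]; exists (u, A u) => //.
case: y Wy hy dy y2 => y1 y2 /= Wy hy dy ?; subst y2.
have w0 : x - y1 = 0; last by move/eqP: w0; rewrite subr_eq0 => /eqP->.
apply: (ipr_eq0 dotE) => h; have [u [du du' hu]] := oneAA_onto h.
have /hy : adherent nHH W (u, A u) by apply: (adherent_sub J2); exists u.
rewrite /ip2 /= -opAB //; have -> : ip (A u) (A (x - y1)) = ip (As (A u)) (x - y1).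
  by rewrite (inC J) /ip adjointP ?(dotC dot _ (As _)) ?ReJ //; exact: domB.
by rewrite hu (inBl J) addrC subrK.
Qed.

(** The definition of normality only compares [As A] with [A As], so this inclusion of domains has
    to be deduced. Approximate [x] in the graph norm by [u n] in [DD]: since [As] and [A] have equal
    norms on [DD], the [As (u n)] form a Cauchy sequence, and its limit is the value of the adjoint
    at [x]. *)
Lemma dom_adj x : dom A x -> dom As x.
Proof.
move=> dx; have [p Wp cp] := adherent_cvgN (DD_core dx).
have ex n : exists u, DD u /\ (u, A u) = p n by have [u] := Wp n; exists u.
have [u hu] := choice ex.
have Du n : DD (u n) by case: (hu n).
have cu : cvgN nH u x.
  move=> e /cp[k hk]; exists k => n /hk; case: (hu n) => _ <- /=.
  exact: le_lt_trans (le_pair1 (u n - x, A (u n) - A x)).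
have cAu : cauchyN nH (fun n => As (u n)).
  move=> e /(cvgN_cauchy J2 cp)[k hk]; exists k => m n km kn.
  have D1 : DD (u m - u n).
    by have := proj2 DD_subspace (-1) _ _ (Du n) (Du m); rewrite scaleN1r addrC.
  have dm k := DD_normal (Du k).
  have -> : As (u m) - As (u n) = As (u m - u n).
    apply/esym; apply: (proj2 (adjoint_eq _)) => y dy.
    by case: (dm m) (dm n) => [_ ? _ _ _] [_ ? _ _ _]; rewrite !linearBr /= !adjointP.
  rewrite DD_adj_norm // opAB; [|by case: (Du m)|by case: (Du n)].
  move: (hk m n km kn); case: (hu m) (hu n) => _ <- [_ <-].
  exact: le_lt_trans (le_pair2 (u m - u n, A (u m) - A (u n))).
have [y _ cy] := completeH (fun=> Logic.I) cAu.
apply: (proj1 (adjoint_eq_ip (y' := y) _)) => v dv.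
rewrite (inC J) [RHS](inC J); apply: (cvgN_ip J cu) => e e0.
have nv : 0 < rnorm v + 1 by rewrite ltr_wpDl ?rnorm_ge0.
have [k hk] := cy _ (divr_gt0 e0 nv); exists k => n kn.
have -> : ip (u n) (A v) = ip (As (u n)) v.
  by rewrite (inC J) /ip adjointP ?(dotC dot v) ?ReJ //; case: (DD_normal (Du n)).
rewrite -(inBl J); apply: le_lt_trans (in_CS J _ _) _.
have := hk n kn; rewrite ltr_pdivlMr //; apply: le_lt_trans.
by rewrite ler_wpM2l ?rnorm_ge0 // lerDl.
Qed.

End Unbounded.

Lemma linear_exists (K : pzRingType) (U V : lmodType K) (f : U -> V) :
  (forall a u v, f (a *: u + v) = a *: f u + f v) ->
  exists g : {linear U -> V}, forall x, g x = f x.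
Proof.
move=> lf; pose m := GRing.isLinear.Build _ _ _ _ f lf.
pose g : {linear U -> V} := HB.pack f m.
by exists g.
Qed.

Section BoundedNormal.
Context {R : realType} {H : completeNormedModType R[i]}.
Variable dot : {dot H for Num.conj}.

Record bounded_normal (T Ts : {linear H -> H}) (K : R) := BoundedNormal {
  bn_adj : forall x y, dot (T x) y = dot x (Ts y);
  bn_com : forall x, T (Ts x) = Ts (T x);
  bn_ge0 : 0 <= K;
  bn_bound : forall x, rnorm (T x) <= K * rnorm x }.

End BoundedNormal.

Section Resolvent.
Context {R : realType} {H : completeNormedModType R[i]}.
Variable dot : {dot H for Num.conj}.
Hypothesis dotE : forall x : H, dot x x = `|x| ^+ 2.
Variable A : operator H.
Hypothesis normalA : normal_op dot A.
Variable alpha : R.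
Let al : R[i] := alpha%:C%C.
Hypothesis alphaP : resolvent_set A al.

Local Notation As := (adjoint dot A).
Local Notation ip := (ip dot).
Let J := inner_ip dotE.
Let Tf : H -> H := resolvent A al.

Let domT y : dom (resolvent A al) y.
Proof. by have [[_ _ /(_ y Logic.I)]] := alphaP. Qed.

Let TfP y : dom A (Tf y) /\ A (Tf y) - al *: Tf y = y.
Proof.
have [x dx hx] := domT y.
exact: (@xgetPex _ 0 [set x | dom (Defs.shift A al) x /\ Defs.shift A al x = y]
  (ex_intro _ x (conj dx hx))).
Qed.

Let TfK x : dom A x -> Tf (A x - al *: x) = x.
Proof.
move=> dx; have [_ hi _] := proj1 alphaP.
have [d1 h1] := TfP (A x - al *: x).
by apply: hi; rewrite ?inE //.
Qed.

Let Tf_lin a u v : Tf (a *: u + v) = a *: Tf u + Tf v.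
Proof.
have [d1 h1] := TfP u; have [d2 h2] := TfP v.
have [[[_ dL] lA] _ _ _] := normalA.
have <- := TfK (dL a _ _ d1 d2); rewrite lA //; congr Tf.
by rewrite -{1}h1 -{1}h2 !scalerDr !scalerN opprD addrACA !scalerA (mulrC al).
Qed.

Let al_conj : al^* = al.
Proof. by apply/eqP; rewrite eq_complex /= oppr0 !eqxx. Qed.

(** [Ts] is constructed as the adjoint of [T] and then identified with the resolvent of [As];
    [alpha] being real, both resolvents are taken at the same point. *)
Lemma resolvent_bounded_normal : exists (T Ts : {linear H -> H}) (K : R),
  [/\ bounded_normal dot T Ts K,
      resolvent A al = T :> (H -> H) /\ dom (resolvent A al) = setT,
      resolvent As al = Ts :> (H -> H) /\ dom (resolvent As al) = setT,
      forall y, dom A (T y) /\ A (T y) = y + al *: T y &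
      forall x, dom A x -> T (A x - al *: x) = x].
Proof.
have [T hT] := linear_exists Tf_lin.
have [K hK] := proj2 alphaP.
have TP y : dom A (T y) /\ A (T y) = y + al *: T y.
  by have [d h] := TfP y; rewrite hT; split=> //; rewrite -{2}h subrK.
have TK x : dom A x -> T (A x - al *: x) = x by rewrite hT; exact: TfK.
have TB x : rnorm (T x) <= `|K| * rnorm x.
  rewrite hT; apply: le_trans (hK x (domT x)) _.
  by rewrite ler_wpM2r ?rnorm_ge0 ?ler_norm.
have [Tsg adjg] : exists Ts : H -> H, forall x y, dot (T x) y = dot x (Ts y).
  suff /choice[g hg] : forall y, exists y', forall x, dot (T x) y = dot x y'.
    by exists g.
  move=> y; apply: (Riesz dotE (f := fun x => dot (T x) y) (C := `|K| * rnorm y)).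
    by move=> a u v; rewrite linearP linearDl /= dotZl.
  move=> u; apply: le_trans (dot_CS dotE _ _) _.
  by rewrite mulrAC ler_wpM2r ?rnorm_ge0.
have [Ts hTs] : exists g : {linear H -> H}, forall x, g x = Tsg x.
  apply: linear_exists => a u v; apply: (dotr_eq dotE) => x.
  by rewrite -adjg !linearDr /= !dotZr -!adjg.
have adj x y : dot (T x) y = dot x (Ts y) by rewrite hTs.
have AsTs y : dom As (Ts y) /\ As (Ts y) = y + al *: Ts y.
  apply: (adjoint_eq dotE normalA) => x dx.
  rewrite linearDr /= dotZr al_conj -{2}(TK _ dx) adj.
  by rewrite linearBl /= dotZl subrK.
have hTsf y : resolvent As al y = Ts y.
  have [d1 h1] := AsTs y.
  have [d2 h2] := @xgetPex _ 0 [set x | dom (Defs.shift As al) x /\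
    Defs.shift As al x = y] (ex_intro _ (Ts y) (conj d1 (canLR (addrK _) h1))).
  apply: (dotr_eq dotE) => v; have [dt ht] := TP v.
  have h3 : As (resolvent As al y) - al *: resolvent As al y = y := h2.
  rewrite -adj -[X in _ = dot _ X]h3 linearBr /= dotZr al_conj.
  by rewrite -(adjointP dt d2) ht linearDl /= dotZl addrK.
exists T, Ts, `|K|; split=> //.
(* The vector [x = T (Ts y)] lies in the domain of [As A], so [A] and [As] may be interchanged on
   it. This yields [T y = (As - al) x], and hence [Ts (T y) = x]. *)
- split=> // y; have [dx hx] := TP (Ts y); set x := T (Ts y) in dx hx *.
  have dsx := dom_adj dotE normalA dx.
  have [d1 h1] := AsTs y.
  have [dAx hAx] : dom As (A x) /\ As (A x) = y + al *: Ts y + al *: As x.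
    apply: (adjoint_eq dotE normalA) => v dv; rewrite hx !linearDr /= !dotZr.
    by rewrite (adjointP dv dsx) (adjointP dv d1) h1 linearDr /= dotZr.
  have [_ _ _ ds hs] := DD_normal normalA (conj dx dAx).
  have dax := domZ normalA al dx.
  have -> : T y = As x - al *: x.
    rewrite -(TK _ (domB normalA ds dax)) (opAB normalA) // (opAZ normalA) // -hs hAx hx; congr (T _).
    rewrite scalerDr scalerBr -[RHS]addrA -opprD [X in _ - (_ + X)]addrC addrA.
    by rewrite addrK -[y + _ + _]addrA addrK.
  apply: (dotr_eq dotE) => v; have [dt ht] := TP v.
  by rewrite -adj linearBr /= dotZr al_conj -(adjointP dt dsx) ht linearDl /= dotZl addrK.
- by split; [apply/funext => y; rewrite hT|apply/seteqP; split].
- split; first exact/funext.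
  apply/seteqP; split=> // y _; have [d1 h1] := AsTs y.
  exact: (ex_intro2 _ _ (Ts y) d1 (canLR (addrK _) h1)).
Qed.
End Resolvent.

(** * Spectrum of a bounded normal operator *)

Section SymmetricForms.
Context {R : realType} {V : lmodType R[i]}.

Record symform (b : V -> V -> R) := Symform {
  sfC : forall u v, b u v = b v u;
  sfD : forall u v w, b (u + v) w = b u w + b v w;
  sfR : forall (t : R) u v, b (t%:C%C *: u) v = t * b u v }.

Lemma symformD (b c : V -> V -> R) : symform b -> symform c ->
  symform (fun u v => b u v + c u v).
Proof.
move=> [bC bD bR] [cC cD cR]; split.
- by move=> u v; rewrite bC cC.
- by move=> u v w; rewrite bD cD addrACA.
- by move=> t u v; rewrite bR cR mulrDr.
Qed.

Lemma symformZ (s : R) (b : V -> V -> R) : symform b ->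
  symform (fun u v => s * b u v).
Proof.
move=> [bC bD bR]; split.
- by move=> u v; rewrite bC.
- by move=> u v w; rewrite bD mulrDr.
- by move=> t u v; rewrite bR mulrCA.
Qed.

Lemma sfDr (b : V -> V -> R) u v w : symform b -> b u (v + w) = b u v + b u w.
Proof. by move=> [bC bD bR]; rewrite ![b u _]bC bD. Qed.

Lemma sfRr (b : V -> V -> R) (t : R) u v : symform b -> b u (t%:C%C *: v) = t * b u v.
Proof. by move=> [bC bD bR]; rewrite ![b u _]bC bR. Qed.

Lemma psd_CS (W : set V) (b : V -> V -> R) : symform b -> Defs.subspace W ->
  (forall v, W v -> 0 <= b v v) ->
  forall u v, W u -> W v -> b u v ^+ 2 <= b u u * b v v.
Proof.
move=> sb [_ WL] pb u v Wu Wv; have bC := sfC sb.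
have q t : 0 <= b u u + 2 * t * b u v + t ^+ 2 * b v v.
  have := pb _ (WL t%:C%C v u Wv Wu).
  rewrite (sfD sb) !sfDr // !(sfR sb) !sfRr // (bC v u); congr (_ <= _); ring.
have [v0|v0] := eqVneq (b v v) 0.
  (* If [b v v = 0] the polynomial [q] is linear in [t], and the chosen [t] would give it the value
     [-1]. *)
  rewrite v0 mulr0; have [->|uv0] := eqVneq (b u v) 0; first by rewrite expr0n.
  have := q (- (b u u + 1) / (2 * b u v)).
  have -> : b u u + 2 * (- (b u u + 1) / (2 * b u v)) * b u v +
    (- (b u u + 1) / (2 * b u v)) ^+ 2 * b v v = -1 by rewrite v0; field.
  by rewrite ler0N1.
have vp : 0 < b v v by rewrite lt_def v0 pb.
have := q (- b u v / b v v).
have -> : b u u + 2 * (- b u v / b v v) * b u v + (- b u v / b v v) ^+ 2 * b v v =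
  b u u - b u v ^+ 2 / b v v by field.
by rewrite subr_ge0 ler_pdivrMr.
Qed.

End SymmetricForms.

(** * Joint approximate eigenvectors of commuting self-adjoint operators *)

Section JointSpectrum.
Context {R : realType} {H : completeNormedModType R[i]}.
Variable dot : {dot H for Num.conj}.
Hypothesis dotE : forall x : H, dot x x = `|x| ^+ 2.
Local Notation ip := (ip dot).
Let J := inner_ip dotE.
Variable V : set H.
Hypothesis sV : Defs.subspace V.
Implicit Types X Y D : {linear H -> H}.

(** The operators act on all of [H], but infima are taken over the invariant subspace [V], later the
    orthogonal complement of finitely many eigenvectors. *)
Definition selfadj X (K : R) :=
  [/\ forall u v, ip (X u) v = ip u (X v), 0 <= K,
      forall u, rnorm (X u) <= K * rnorm u & forall u, V u -> V (X u)].

Lemma symform_ip : symform ip.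
Proof. by split; [exact: inC J|exact: inD J|exact: inR J]. Qed.

Lemma symform_selfadj X K : selfadj X K -> symform (fun u v => ip (X u) v).
Proof.
move=> [sX _ _ _]; split.
- by move=> u v; rewrite sX (inC J).
- by move=> u v w; rewrite linearD (inD J).
- by move=> t u v; rewrite linearZ /= (inR J).
Qed.

Lemma selfadj_quad X K u : selfadj X K -> rnorm u = 1 -> `|ip (X u) u| <= K.
Proof.
move=> [_ _ bX _] u1; apply: le_trans (in_CS J _ _) _.
by rewrite u1 mulr1 (le_trans (bX _)) // u1 mulr1.
Qed.

Lemma unit_scale (u : H) : u != 0 ->
  exists (t : R) v, [/\ 0 < t, rnorm v = 1, u = t%:C%C *: v & v = (t^-1)%:C%C *: u].
Proof.
move=> u0; have t0 : 0 < rnorm u.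
  by rewrite lt_def rnorm_ge0 andbT; apply: contra_neq u0; exact: rnorm_eq0.
exists (rnorm u), ((rnorm u)^-1%:C%C *: u); split=> //.
  by rewrite (inNZ J) rnormC ger0_norm ?invr_ge0 ?rnorm_ge0 // mulVf // gt_eqF.
by rewrite scalerA -rmorphM /= mulfV ?gt_eqF // scale1r.
Qed.

Lemma subspace_scale (a : R[i]) u : V u -> V (a *: u).
Proof. by move=> Vu; have := proj2 sV a u 0 Vu (proj1 sV); rewrite addr0. Qed.

Lemma subspaceB u v : V u -> V v -> V (u - v).
Proof. by move=> Vu Vv; have := proj2 sV (-1) v u Vv Vu; rewrite scaleN1r addrC. Qed.

Lemma psd_of_unit (b : H -> H -> R) (m : R) : symform b ->
  (forall v, V v -> rnorm v = 1 -> m <= b v v) ->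
  forall v, V v -> 0 <= b v v - m * ip v v.
Proof.
move=> sb hb v Vv; have [->|v0] := eqVneq v 0.
  have -> : b 0 0 = 0 by have := sfR sb 0 0 0; rewrite scaler0 mul0r.
  by rewrite (in0l J) mulr0 subr0.
have [t [w [t0 w1 ev ew]]] := unit_scale v0.
have Vw : V w by rewrite ew; exact: subspace_scale.
rewrite ev (sfR sb) (sfRr _ _ _ sb) (inR J) (inRr J) (inN J) w1 expr1n mulr1.
have := hb w Vw w1; nra.
Qed.

Section Step.
Variables (b : H -> H -> R) (Cb CX K : R) (X : {linear H -> H}).
Hypothesis sb : symform b.
Hypothesis b_ge0 : forall v, 0 <= b v v.
Hypothesis b_le : forall v, b v v <= Cb * rnorm v ^+ 2.
Hypothesis bX : forall v, `|b v (X v)| <= CX * b v v.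
Hypothesis sX : selfadj X K.
Hypothesis b_inf : forall e : R, 0 < e ->
  exists v, [/\ V v, rnorm v = 1 & b v v < e].

(** A penalty method: [nu s] is the infimum, over unit vectors of [V], of the form of [X] with the
    penalty [s b] added. It increases with [s] and stays below [K], because [b] is arbitrarily small
    on some unit vectors; its supremum [x] is the candidate for the approximate eigenvalue. *)
Let f (s : R) v := s * b v v + ip (X v) v.
Let F s := [set f s v | v in [set v | V v /\ rnorm v = 1]].
Let nu s := inf (F s).

Let fX v : rnorm v = 1 -> - K <= ip (X v) v <= K.
Proof. by move=> v1; have := selfadj_quad sX v1; rewrite ler_norml. Qed.

Let hasF s : 0 <= s -> has_inf (F s).
Proof.
move=> s0; split.
  by have [v [Vv v1 _]] := b_inf ltr01; exists (f s v), v.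
exists (- K) => _ [v [Vv v1] <-]; have /andP[h _] := fX v1.
by rewrite /f; have := mulr_ge0 s0 (b_ge0 v); lra.
Qed.

Let nu_le s v : 0 <= s -> V v -> rnorm v = 1 -> nu s <= f s v.
Proof. by move=> s0 Vv v1; apply: ge_inf; [case: (hasF s0)|exists v]. Qed.

Let nu_ub s : 0 <= s -> nu s <= K.
Proof.
move=> s0; rewrite -subr_le0; apply: (@le0_of_small _ _ s) => e e0.
have [v [Vv v1 bv]] := b_inf e0; have := nu_le s0 Vv v1; rewrite /f.
have /andP[_ h] := fX v1; nra.
Qed.

Let nu_lb s : 0 <= s -> - K <= nu s.
Proof.
move=> s0; apply: lb_le_inf; first by case: (hasF s0).
move=> _ [v [Vv v1] <-]; have /andP[h _] := fX v1.
by rewrite /f; have := mulr_ge0 s0 (b_ge0 v); lra.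
Qed.

Let nu_mono s t : 0 <= s -> s <= t -> nu s <= nu t.
Proof.
move=> s0 st; apply: lb_le_inf; first by case: (hasF (le_trans s0 st)).
move=> _ [v [Vv v1] <-]; apply: le_trans (nu_le s0 Vv v1) _.
by rewrite /f lerD2r ler_wpM2r.
Qed.

Let S := [set nu s | s in [set s | 0 <= s]].
Let x := sup S.

Let hasS : has_sup S.
Proof.
split; first by exists (nu 0), 0 => /=.
by exists K => _ [s s0 <-]; exact: nu_ub.
Qed.

(* With [a u v = s b(u,v) + <(X - nu s) u, v> >= 0], Cauchy-Schwarz applied to
   [v] and [w = (X - nu s) v] bounds [|w|^2] because [b v w] is controlled by
   [b v v], and [s b v v] is small since [nu] is almost constant beyond [s / 2]. *)
Lemma joint_step : exists x M : R, forall e, 0 < e <= 1 ->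
  exists v, [/\ V v, rnorm v = 1 &
    b v v + rnorm (X v - x%:C%C *: v) ^+ 2 <= M * e].
Proof.
have K0 : 0 <= K by case: sX.
have C0 : 0 <= Cb.
  have [v [Vv v1 _]] := b_inf ltr01; have := b_le v; have := b_ge0 v.
  by rewrite v1 expr1n mulr1; lra.
(* The three summands account for [b v v], [2 |w|^2] and [2 e^2], in this order. *)
exists x, (2 + 2 * (4 * (`|CX| + K) + 1) + 2) => e /andP[e0 e1].
have [_ [s0 /= s00 <-] hs0] := sup_adherent e0 hasS.
have xnu t : 0 <= t -> nu t <= x.
  by move=> t0; apply: ub_le_sup; [case: hasS|exists t].
(* [s / 2 >= s0] puts [nu (s / 2)] within [e] of [x], and [s >= 2] lets a bound on [s * b v v] bound
   [b v v] too. *)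
pose s := 2 * s0 + 2.
have sp : 0 < s by rewrite /s; lra.
have s2 : 0 <= s / 2 by lra.
have s_ge0 := ltW sp.
have hs2 : x - e < nu (s / 2).
  by apply: lt_le_trans hs0 (nu_mono s00 _); rewrite /s; lra.
pose M := (s * Cb + 2 * K) * (2 * K) ^+ 2.
have M0 : 0 <= M by rewrite mulr_ge0 ?sqr_ge0 // addr_ge0 ?mulr_ge0 // ltW.
(* [M] bounds [a w w], so this tolerance makes Cauchy-Schwarz give [|a v w| <= e]. *)
pose tau := Num.min e (e ^+ 2 / (M + 1)).
have tau0 : 0 < tau.
  by rewrite lt_min e0 divr_gt0 ?exprn_gt0 // ltr_wpDl.
have taue : tau <= e by rewrite ge_min lexx.
have tauM : tau * M <= e ^+ 2.
  apply: (@le_trans _ _ (tau * (M + 1))); first by rewrite ler_pM2l // lerDl.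
  rewrite -ler_pdivlMr ?ltr_wpDl //; by rewrite ge_min lexx orbT.
have [_ [v [Vv v1] <-] hv] := inf_adherent tau0 (hasF (ltW sp)).
exists v; split=> //.
(* The forms for [s] and [s / 2] differ by [s / 2 * b v v], while their infima differ by less than
   [e]. *)
have h1 : s * b v v <= 2 * (tau + e).
  have := nu_le s2 Vv v1; have := xnu s (ltW sp); move: hv; rewrite -/(nu s) /f; lra.
have b1 : b v v <= tau + e.
  by have := b_ge0 v; rewrite /s in h1; nra.
set w := X v - (nu s)%:C%C *: v.
have Vw : V w by apply: subspaceB; [case: sX => _ _ _; apply|exact: subspace_scale].
have nuK : `|nu s| <= K by rewrite ler_norml nu_lb ?nu_ub ?ltW.
have wK : rnorm w <= 2 * K.
  apply: le_trans (inNB_le J _ _) _; rewrite (inNZ J) rnormC v1 mulr1.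
  by have [_ _ /(_ v)] := sX; rewrite v1 mulr1; lra.
pose a u v := (s * b u v + ip (X u) v) + (- nu s) * ip u v.
have sa0 : symform (fun u v => s * b u v + ip (X u) v).
  by apply: symformD; [exact: symformZ|exact: symform_selfadj sX].
have sa : symform a.
  by apply: symformD => //; apply: symformZ; exact: symform_ip.
have pa u : V u -> 0 <= a u u.
  move=> Vu; rewrite /a mulNr; apply: (psd_of_unit sa0 _ Vu) => u' Vu' u1.
  exact: nu_le (ltW sp) Vu' u1.
have CS := psd_CS sa sV pa Vv Vw.
have avv : a v v <= tau.
  by move: hv; rewrite -/(nu s) /a /f (inN J) v1 expr1n; lra.
have aww : a w w <= (s * Cb + 2 * K) * (2 * K) ^+ 2.
  have hw2 : rnorm w ^+ 2 <= (2 * K) ^+ 2.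
    by rewrite ler_pXn2r ?nnegrE ?rnorm_ge0 ?mulr_ge0.
  apply: (@le_trans _ _ ((s * Cb + 2 * K) * rnorm w ^+ 2)); last first.
    by rewrite ler_wpM2l // addr_ge0 ?mulr_ge0.
  have h2 := ler_wpM2l (ltW sp) (b_le w).
  have h3 : ip (X w) w <= K * rnorm w ^+ 2.
    apply: le_trans (in_le J _ _) _; rewrite expr2 mulrA ler_wpM2r ?rnorm_ge0 //.
    by case: sX.
  have h4 : - nu s * rnorm w ^+ 2 <= K * rnorm w ^+ 2.
    by rewrite ler_wpM2r ?sqr_ge0 //; move: nuK; rewrite ler_norml; lra.
  by rewrite /a (inN J); lra.
have avw : `|a v w| <= e.
  rewrite -(@ler_pXn2r _ 2) ?nnegrE ?(ltW e0) // sqr_normr.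
  apply: le_trans CS (le_trans _ tauM); rewrite -/M in aww.
  by apply: ler_pM => //; exact: pa.
have ew : rnorm w ^+ 2 = a v w - s * b v w.
  by rewrite /a -(inN J) /w (inBl J) (inR J); ring.
have bvw : `|b v w| <= (`|CX| + K) * b v v.
  have -> : b v w = b v (X v) - nu s * b v v.
    by rewrite /w sfDr // -scaleN1r -realCN1 scalerA -rmorphM /= sfRr // mulN1r mulNr.
  apply: le_trans (ler_normB _ _) _; rewrite normrM (ger0_norm (b_ge0 v)) mulrDl.
  apply: lerD; last by rewrite ler_wpM2r.
  by apply: le_trans (bX v) _; rewrite ler_wpM2r // ler_norm.
have w2 : rnorm w ^+ 2 <= (4 * (`|CX| + K) + 1) * e.
  have h5 : `|s * b v w| <= (`|CX| + K) * (4 * e).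
    rewrite normrM (gtr0_norm sp); apply: (@le_trans _ _ (s * ((`|CX| + K) * b v v))).
      by rewrite ler_wpM2l // ltW.
    rewrite mulrCA ler_wpM2l ?addr_ge0 //; lra.
  have := ler_norm (a v w); have := ler_norm (- (s * b v w)); rewrite normrN ew.
  by move: h5 avw; lra.
have xw : rnorm (X v - x%:C%C *: v) <= rnorm w + e.
  have -> : X v - x%:C%C *: v = w + (nu s - x)%:C%C *: v.
    by rewrite /w rmorphB /= scalerBl addrA subrK.
  apply: le_trans (inND J _ _) _; rewrite lerD2l (inNZ J) rnormC v1 mulr1.
  have := xnu s (ltW sp); have : nu (s / 2) <= nu s by apply: nu_mono => //; lra.
  by rewrite ler_norml; move: hs2 => *; apply/andP; split; lra.
have xw2 : rnorm (X v - x%:C%C *: v) ^+ 2 <= 2 * rnorm w ^+ 2 + 2 * e ^+ 2.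
  have := rnorm_ge0 (X v - x%:C%C *: v); have := rnorm_ge0 w.
  have := sqr_ge0 (rnorm w - e).
  by move: xw; nra.
by nra.
Qed.

End Step.

End JointSpectrum.

Section Shift.
Context {F : fieldType} {V : lmodType F}.
Implicit Types (X : {linear V -> V}) (x a : F) (u v : V).

Lemma shiftD X x u v :
  X (u + v) - x *: (u + v) = (X u - x *: u) + (X v - x *: v).
Proof. by rewrite [X _]linearD scalerDr opprD addrACA. Qed.

Lemma shiftB X x u v :
  X (u - v) - x *: (u - v) = (X u - x *: u) - (X v - x *: v).
Proof. by rewrite [X _]linearB scalerBr !opprD !opprK addrACA. Qed.

Lemma shiftZ X x a u : X (a *: u) - x *: (a *: u) = a *: (X u - x *: u).
Proof. by rewrite [X _]linearZ /= scalerBr !scalerA mulrC. Qed.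

Lemma shift_comm (S X : {linear V -> V}) x u :
  S (X u) = X (S u) -> S (X u - x *: u) = X (S u) - x *: S u.
Proof. by move=> <-; rewrite [S _]linearB [S (_ *: _)]linearZ. Qed.

End Shift.

Section JointSpectrumKey.
Context {R : realType} {H : completeNormedModType R[i]}.
Variable dot : {dot H for Num.conj}.
Hypothesis dotE : forall x : H, dot x x = `|x| ^+ 2.
Local Notation ip := (ip dot).
Let J := inner_ip dotE.
Implicit Types X Y D Z : {linear H -> H}.

Definition sqform X (x : R) (u v : H) :=
  ip (X u - x%:C%C *: u) (X v - x%:C%C *: v).

Lemma sqform_norm X x v : sqform X x v v = rnorm (X v - x%:C%C *: v) ^+ 2.
Proof. exact: (inN J). Qed.

Lemma sqform_ge0 X x v : 0 <= sqform X x v v.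
Proof. by rewrite sqform_norm sqr_ge0. Qed.

Lemma sqform_sym X x : symform (sqform X x).
Proof.
split.
- by move=> u v; rewrite /sqform (inC J).
- by move=> u v w; rewrite /sqform shiftD (inD J).
- by move=> t u v; rewrite /sqform shiftZ (inR J).
Qed.

Lemma sqform_le V X K x v : selfadj dot V X K ->
  sqform X x v v <= (K + `|x|) ^+ 2 * rnorm v ^+ 2.
Proof.
move=> [_ K0 bX _]; rewrite sqform_norm -exprMn.
rewrite ler_pXn2r ?nnegrE ?mulr_ge0 ?addr_ge0 ?rnorm_ge0 //.
apply: le_trans (inNB_le J _ _) _; rewrite (inNZ J) rnormC mulrDl lerD2r; exact: bX.
Qed.

(** This is the hypothesis [bX] of [joint_step]: an operator commuting with [X] also commutes with
    [X - x], so the penalty sees it only as a bounded factor. *)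
Lemma sqform_comm V X Z K x v : selfadj dot V Z K ->
  (forall u, X (Z u) = Z (X u)) -> `|sqform X x v (Z v)| <= K * sqform X x v v.
Proof.
move=> [_ K0 bZ _] XZ; rewrite /sqform XZ -linearZ -linearB /=.
apply: le_trans (in_CS J _ _) _; rewrite (inN J) expr2 mulrCA ler_wpM2l ?rnorm_ge0 //.
Qed.

(** [D - m] is nonnegative on [V], so Cauchy-Schwarz for its form turns minimising vectors of [D]
    into approximate eigenvectors. The form of [(D - m)^2] then serves as penalty in [joint_step]
    for [X], and its sum with the form of [(X - x)^2] as penalty for [Y]. *)
Lemma joint_eigen V D X Y KD KX KY :
  Defs.subspace V ->
  selfadj dot V D KD -> selfadj dot V X KX -> selfadj dot V Y KY ->
  (forall u, D (X u) = X (D u)) -> (forall u, D (Y u) = Y (D u)) ->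
  (forall u, X (Y u) = Y (X u)) ->
  (exists v, V v /\ rnorm v = 1) ->
  let m := inf [set ip (D v) v | v in [set v | V v /\ rnorm v = 1]] in
  exists x y : R, forall e, 0 < e -> exists v, [/\ V v, rnorm v = 1,
    rnorm (D v - m%:C%C *: v) < e, rnorm (X v - x%:C%C *: v) < e &
    rnorm (Y v - y%:C%C *: v) < e].
Proof.
move=> sV sD sX sY DX DY XY exV m.
have hF : has_inf [set ip (D v) v | v in [set v | V v /\ rnorm v = 1]].
  split; first by have [v [Vv v1]] := exV; exists (ip (D v) v), v.
  exists (- KD) => _ [v [Vv v1] <-].
  by have := selfadj_quad dotE sD v1; rewrite ler_norml => /andP[].
have KD0 : 0 <= KD by case: sD.
pose d u v := ip (D u) v + (- m) * ip u v.
have sd0 := symform_selfadj dotE sD.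
have sd : symform d.
  by apply: symformD => //; apply: symformZ; exact: symform_ip.
have pd u : V u -> 0 <= d u u.
  move=> Vu; rewrite /d mulNr; apply: (psd_of_unit dotE sV sd0 _ Vu) => v Vv v1.
  by apply: ge_inf; [case: hF|exists v].
have inf1 e : 0 < e -> exists v, [/\ V v, rnorm v = 1 & sqform D m v v < e].
  move=> e0; have C0 : 0 < KD + `|m| + 1 by rewrite ltr_wpDl // addr_ge0.
  have [_ [v [Vv v1] <-] hv] := inf_adherent (divr_gt0 e0 C0) hF.
  exists v; split=> //; rewrite sqform_norm.
  set w := D v - _.
  have Vw : V w by apply: (subspaceB sV); [case: sD => _ _ _; apply|exact: subspace_scale].
  have CS := psd_CS sd sV pd Vv Vw.
  have dvw : d v w = rnorm w ^+ 2 by rewrite /d -(inN J) /w (inBl J) (inR J); ring.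
  have dvv : d v v < e / (KD + `|m| + 1).
    by move: hv; rewrite -/m /d (inN J) v1 expr1n; lra.
  have dww : d w w <= (KD + `|m| + 1) * rnorm w ^+ 2.
    have h3 : ip (D w) w <= KD * rnorm w ^+ 2.
      apply: le_trans (in_le J _ _) _; rewrite expr2 mulrA ler_wpM2r ?rnorm_ge0 //.
      by case: sD.
    rewrite /d (inN J); have := ler_norm (- m); rewrite normrN.
    by have := sqr_ge0 (rnorm w); nra.
  rewrite ltr_pdivlMr // in dvv; rewrite dvw in CS.
  have [w0|w0] := eqVneq (rnorm w) 0; first by rewrite w0 expr0n.
  have w2 : 0 < rnorm w ^+ 2 by rewrite lt_def sqrf_eq0 w0 sqr_ge0.
  rewrite -(ltr_pM2l w2) -expr2; apply: le_lt_trans CS _.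
  apply: le_lt_trans (ler_wpM2l (pd _ Vv) dww) _.
  by rewrite mulrA mulrC ltr_pM2l.
have [x [Mx hx]] := joint_step dotE sV (sqform_sym D m) (sqform_ge0 D m)
  (fun v => sqform_le m v sD) (fun v => sqform_comm m v sX DX) sX inf1.
pose b2 u v := sqform D m u v + sqform X x u v.
have sb2 : symform b2 by apply: symformD; exact: sqform_sym.
have b2_ge0 v : 0 <= b2 v v by rewrite addr_ge0 ?sqform_ge0.
have b2_le v : b2 v v <= ((KD + `|m|) ^+ 2 + (KX + `|x|) ^+ 2) * rnorm v ^+ 2.
  by rewrite mulrDl lerD // (sqform_le _ _ sD, sqform_le _ _ sX).
have b2Y v : `|b2 v (Y v)| <= KY * b2 v v.
  apply: le_trans (ler_normD _ _) _; rewrite mulrDr lerD //.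
  - exact: (sqform_comm m v sY DY).
  - exact: (sqform_comm x v sY XY).
have inf2 e : 0 < e -> exists v, [/\ V v, rnorm v = 1 & b2 v v < e].
  move=> e0; have C0 : 0 < `|Mx| + 1 by rewrite ltr_wpDl.
  pose e' := Num.min 1 (e / (`|Mx| + 1)).
  have e'0 : 0 < e' <= 1 by rewrite lt_min ltr01 divr_gt0 //= ge_min lexx.
  have [v [Vv v1 hv]] := hx _ e'0; exists v; split=> //.
  rewrite /b2 sqform_norm sqform_norm in hv *; apply: le_lt_trans hv _.
  apply: (@lt_le_trans _ _ ((`|Mx| + 1) * e')).
    by case/andP: e'0 => p _; rewrite ltr_pM2r //; have := ler_norm Mx; lra.
  by rewrite mulrC -ler_pdivlMr // ge_min lexx orbT.
have [y [My hy]] := joint_step dotE sV sb2 b2_ge0 b2_le b2Y sY inf2.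
exists x, y => e e0.
have C0 : 0 < `|My| + 1 by rewrite ltr_wpDl.
pose e' := Num.min 1 (e ^+ 2 / (`|My| + 1)).
have e'0 : 0 < e' <= 1 by rewrite lt_min ltr01 divr_gt0 ?exprn_gt0 //= ge_min lexx.
have [v [Vv v1 hv]] := hy _ e'0; exists v.
have h : b2 v v + rnorm (Y v - y%:C%C *: v) ^+ 2 < e ^+ 2.
  apply: le_lt_trans hv _; apply: (@lt_le_trans _ _ ((`|My| + 1) * e')).
    by case/andP: e'0 => p _; rewrite ltr_pM2r //; have := ler_norm My; lra.
  by rewrite mulrC -ler_pdivlMr // ge_min lexx orbT.
rewrite /b2 !sqform_norm in h.
have := sqr_ge0 (rnorm (D v - m%:C%C *: v)); have := sqr_ge0 (rnorm (X v - x%:C%C *: v)).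
have := sqr_ge0 (rnorm (Y v - y%:C%C *: v)) => h1 h2 h3.
by split=> //; rewrite -(@ltr_pXn2r _ 2) ?nnegrE ?rnorm_ge0 ?(ltW e0) //; lra.
Qed.

End JointSpectrumKey.

Section NormalTheory.
Context {R : realType} {H : completeNormedModType R[i]}.
Variable dot : {dot H for Num.conj}.
Hypothesis dotE : forall x : H, dot x x = `|x| ^+ 2.
Local Notation ip := (ip dot).
Let J := inner_ip dotE.
Variables (T Ts : {linear H -> H}) (K : R).
Hypothesis BN : bounded_normal dot T Ts K.

Lemma ipT x y : ip (T x) y = ip x (Ts y).
Proof. by rewrite /ip (bn_adj BN). Qed.

Lemma ipTs x y : ip (Ts x) y = ip x (T y).
Proof. by rewrite (inC J) -ipT (inC J). Qed.

Lemma bn_K0 : 0 <= K. Proof. by case: BN. Qed.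
Lemma bn_T x : rnorm (T x) <= K * rnorm x. Proof. by case: BN. Qed.

Lemma normTs x : rnorm (Ts x) = rnorm (T x).
Proof.
apply/eqP; rewrite -(@eqrXn2 _ 2) ?rnorm_ge0 // -!(inN J).
by rewrite ipTs (bn_com BN) ipT.
Qed.

Lemma bn_Ts x : rnorm (Ts x) <= K * rnorm x.
Proof. by rewrite normTs bn_T. Qed.

Lemma bounded_normal_adj : bounded_normal dot Ts T K.
Proof.
split=> [x y|x||x]; [|by rewrite (bn_com BN)|exact: bn_K0|exact: bn_Ts].
by rewrite dotC -(bn_adj BN) -dotC.
Qed.

End NormalTheory.

Section NormalShift.
Context {R : realType} {H : completeNormedModType R[i]}.
Variable dot : {dot H for Num.conj}.
Hypothesis dotE : forall x : H, dot x x = `|x| ^+ 2.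
Local Notation ip := (ip dot).
Let J := inner_ip dotE.
Variables (T Ts : {linear H -> H}) (K : R).
Hypothesis BN : bounded_normal dot T Ts K.
Let ipT := ipT BN.
Let ipTs := ipTs dotE BN.
Let bn_T := bn_T BN.
Let bn_Ts := bn_Ts dotE BN.
Let bn_K0 := bn_K0 BN.

Lemma bounded_normal_shift (l : R[i]) : exists B Bs : {linear H -> H},
  [/\ forall x, B x = T x - l *: x, forall x, Bs x = Ts x - l^* *: x &
      bounded_normal dot B Bs (K + rnorm l)].
Proof.
have [B hB] : exists B : {linear H -> H}, forall x, B x = T x - l *: x.
  by apply: linear_exists => a u v; rewrite shiftD shiftZ.
have [Bs hBs] : exists B : {linear H -> H}, forall x, B x = Ts x - l^* *: x.
  by apply: linear_exists => a u v; rewrite shiftD shiftZ.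
exists B, Bs; split=> //; split.
- by move=> x y; rewrite hB hBs linearBl linearBr /= dotZl dotZr conjCK (bn_adj BN).
- move=> x; rewrite !hB !hBs !linearB !linearZ /= (bn_com BN) !scalerA.
  by rewrite [l * _]mulrC addrACA.
- by rewrite addr_ge0 ?bn_K0 ?rnorm_ge0.
- move=> x; rewrite hB; apply: le_trans (inNB_le J _ _) _.
  by rewrite (inNZ J) mulrDl lerD2r bn_T.
Qed.

Lemma norm_shift_adj (l : R[i]) x : rnorm (Ts x - l^* *: x) = rnorm (T x - l *: x).
Proof.
have [B [Bs [hB hBs bn]]] := bounded_normal_shift l; rewrite -hB -hBs.
exact: (normTs dotE bn x).
Qed.

Definition approx_eigen (V : set H) (l : R[i]) := forall e : R, 0 < e ->
  exists v, [/\ V v, rnorm v = 1 & rnorm (T v - l *: v) < e].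

(** [joint_eigen] for the real and imaginary parts of [T]. It stands in for the spectral theorem:
    when [D] is built from [T] and [Ts], [m] has to be the corresponding expression in the spectral
    point [l]. *)
Lemma joint_spectrum V (D : {linear H -> H}) KD :
  Defs.subspace V -> (forall v, V v -> V (T v)) -> (forall v, V v -> V (Ts v)) ->
  selfadj dot V D KD ->
  (forall u, D (T u) = T (D u)) -> (forall u, D (Ts u) = Ts (D u)) ->
  (exists v, V v /\ rnorm v = 1) ->
  let m := inf [set ip (D v) v | v in [set v | V v /\ rnorm v = 1]] in
  exists l : R[i], forall e, 0 < e -> exists v, [/\ V v, rnorm v = 1,
    rnorm (D v - m%:C%C *: v) < e & rnorm (T v - l *: v) < e].
Proof.
move=> sV VT VTs sD DT DTs exV m.
have sV' a u v : V u -> V v -> V (a *: u + v) by exact: (proj2 sV).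
have K0 := bn_K0.
have ii : 'i%C * 'i%C = -1 :> R[i] by rewrite -expr2 sqr_i.
have i1 : rnorm ('i%C : R[i]) = 1.
  apply/eqP; rewrite -(@eqrXn2 _ 2) ?rnorm_ge0 // sqr_rnorm /=.
  by rewrite expr0n !expr1n add0r.
have iJ : ('i%C : R[i])^* = - 'i%C.
  by apply/eqP; rewrite eq_complex /= !oppr0 !eqxx.
pose h : R[i] := (2^-1)%:C%C.
have hJ : h^* = h by apply/eqP; rewrite eq_complex /= oppr0 !eqxx.
have h2 : h + h = 1 by rewrite /h -rmorphD /=; congr (_%:C%C); lra.
have hn : rnorm h = 2^-1 by rewrite rnormC ger0_norm // invr_ge0.
have [X hX] : exists X : {linear H -> H}, forall x, X x = h *: (T x + Ts x).
  by exists (h \*: (T \+ Ts)).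
have [Y hY] : exists Y : {linear H -> H}, forall x, Y x = h *: ('i%C *: (Ts x - T x)).
  by exists (h \*: ('i%C \*: (Ts \- T))).
have sX : selfadj dot V X K.
  split=> //.
  - by move=> u v; rewrite !hX (inR J) (inRr J) (inD J) (inDr J) ipT ipTs addrC.
  - move=> u; rewrite hX (inNZ J) hn; have := inND J (T u) (Ts u).
    by have := bn_T u; have := bn_Ts u; lra.
  - move=> u Vu; rewrite hX; apply: (subspace_scale sV).
    by have := sV' 1 _ _ (VT _ Vu) (VTs _ Vu); rewrite scale1r.
have sY : selfadj dot V Y K.
  split=> //.
  - move=> u v; rewrite !hY (inR J) (inRr J) (inZ J) (inBl J) ipT ipTs -(inBr J) iJ.
    by rewrite [T _]linearZ [Ts _]linearZ /= !scaleNr opprK addrC scalerBr.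
  - move=> u; rewrite hY !(inNZ J) hn; have := inNB_le J (Ts u) (T u).
    by rewrite i1 mul1r; have := bn_T u; have := bn_Ts u; lra.
  - move=> u Vu; rewrite hY; do 2 apply: (subspace_scale sV).
    by apply: (subspaceB sV); [exact: VTs|exact: VT].
have DX u : D (X u) = X (D u) by rewrite !hX linearZ linearD /= DT DTs.
have DY u : D (Y u) = Y (D u) by rewrite !hY linearZ /= linearZ /= linearB /= DT DTs.
have XY u : X (Y u) = Y (X u).
  have TY w : T (Y w) = Y (T w) by rewrite !hY linearZ /= linearZ /= linearB /= (bn_com BN).
  have TsY w : Ts (Y w) = Y (Ts w) by rewrite !hY linearZ /= linearZ /= linearB /= (bn_com BN).
  by rewrite hX TY TsY hX linearZ /= [Y (_ + _)]linearD.
have [x [y hxy]] := joint_eigen dotE sV sD sX sY DX DY XY exV.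
exists (x%:C%C + 'i%C * y%:C%C) => e e0.
have [v [Vv v1 h1 h3 h4]] := hxy _ (divr_gt0 e0 (ltr0n R 2)).
exists v; split=> //; first by lra.
have -> : T v = X v + 'i%C *: Y v.
  rewrite hX hY !scalerA [_ * h]mulrC -mulrA ii mulrN1 scaleNr -scalerBr.
  by rewrite opprB addrA addrAC addrK scalerDr -scalerDl h2 scale1r.
rewrite scalerDl opprD addrACA -scalerA -scalerBr.
apply: le_lt_trans (inND J _ _) _; rewrite (inNZ J) i1 mul1r; lra.
Qed.
End NormalShift.

Lemma isolatedP {R : realType} (X : set R[i]) (w : R[i]) :
  isolated (X : set R[i]^o) w <->
  X w /\ exists2 rho : R, 0 < rho & forall w', X w' -> rnorm (w' - w) < rho -> w' = w.
Proof.
split=> [[Xw [U /nbhs_ballP[e /= e0 eU] UX]]|[Xw [rho r0 h]]].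
  have eR : e = (complex.Re e)%:C%C by rewrite RRe_real // gtr0_real.
  split; first by rewrite inE in Xw.
  exists (complex.Re e) => [|w' Xw' hw]; first by rewrite -ltcR -eR.
  suff : (U `&` X) w' by rewrite UX.
  split=> //; apply: eU; rewrite -ball_normE /= distrC rnormE eR ltcR.
  exact: hw.
split; first by rewrite inE.
exists (ball (w : R[i]^o) (rho%:C%C)).
  by apply: nbhsx_ballx; rewrite ltcR.
apply/seteqP; split=> [w' [hw Xw']|_ ->].
  apply: h => //; rewrite -ball_normE /= distrC in hw.
  by rewrite -ltcR -rnormE.
by split=> //; apply: ballxx; rewrite ltcR.
Qed.

(** * Approximate eigenvectors and isolated points of the spectrum *)

Section Spectrum.
Context {R : realType} {H : completeNormedModType R[i]}.
Variable dot : {dot H for Num.conj}.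
Hypothesis dotE : forall x : H, dot x x = `|x| ^+ 2.
Local Notation ip := (ip dot).
Local Notation nH := (@rnorm R H).
Let J := inner_ip dotE.
Variables (T Ts : {linear H -> H}) (K : R).
Hypothesis BN : bounded_normal dot T Ts K.
Let opT : operator H := Operator setT T.
Let K0 := bn_K0 BN.

Lemma bounded_below_of_approx (V : set H) (l : R[i]) : Defs.subspace V ->
  ~ approx_eigen T V l ->
  exists2 k : R, 0 < k & forall v, V v -> k * rnorm v <= rnorm (T v - l *: v).
Proof.
move=> sV /existsNP[e /not_implyP[e0 he]]; exists e => // v Vv.
have [->|v0] := eqVneq v 0.
  by rewrite rnorm0 mulr0 rnorm_ge0.
have [t [w [t0 w1 ev ew]]] := unit_scale dotE v0.
have Vw : V w by rewrite ew; exact: subspace_scale.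
rewrite ev shiftZ !(inNZ J) w1 mulr1 mulrC rnormC gtr0_norm //.
rewrite ler_pM2l // leNgt; apply/negP => h; apply: he; by exists w.
Qed.

Lemma approx_of_bounded_below (V : set H) (l : R[i]) (k : R) : 0 < k ->
  (forall v, V v -> k * rnorm v <= rnorm (T v - l *: v)) -> ~ approx_eigen T V l.
Proof.
move=> k0 h /(_ _ k0)[v [Vv v1]]; have := h v Vv; rewrite v1 mulr1.
by move=> /le_lt_trans h1 /h1; rewrite ltxx.
Qed.

Lemma approx_mono (V W : set H) l : V `<=` W -> approx_eigen T V l -> approx_eigen T W l.
Proof. by move=> VW h e /h[v [Vv v1 hv]]; exists v; split=> //; exact: VW. Qed.

Lemma subspace_setT : Defs.subspace [set: H].
Proof. by []. Qed.

(** The range of [B = T - l] is complete because [B] is bounded below. A vector orthogonal to it is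
    killed by [Bs], hence also by [B], whose norm on each vector is that of [Bs]. *)
Lemma bounded_below_onto (l : R[i]) (k : R) : 0 < k ->
  (forall v, k * rnorm v <= rnorm (T v - l *: v)) ->
  forall h, exists x, T x - l *: x = h.
Proof.
move=> k0 hk h; have [B [Bs [hB hBs bn]]] := bounded_normal_shift dotE BN l.
pose W : set H := range B.
have sW : Defs.subspace W.
  split; first by exists 0 => //; rewrite linear0.
  by move=> a _ _ [u _ <-] [v _ <-]; exists (a *: u + v) => //; rewrite linearP.
have cW : completeN nH W.
  move=> u Wu cu; have ex n : exists x, B x = u n by have [x] := Wu n; exists x.
  have [x hx] := choice ex.
  have [||y _ cy] := @completeH _ _ x.
  - by [].
  - move=> e e0; have [N hN] := cu _ (mulr_gt0 e0 k0); exists N => m n Nm Nn.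
    have := hk (x m - x n); rewrite -hB linearB !hx /= => h1.
    by rewrite -(ltr_pM2r k0) mulrC; apply: le_lt_trans h1 (hN m n Nm Nn).
  exists (B y); first by exists y.
  have kb : 0 < K + rnorm l + 1 by rewrite ltr_wpDl // addr_ge0 ?rnorm_ge0.
  move=> e e0; have [N hN] := cy _ (divr_gt0 e0 kb); exists N => n Nn.
  rewrite -hx -linearB; apply: le_lt_trans (bn_bound bn _) _.
  apply: (@le_lt_trans _ _ ((K + rnorm l + 1) * rnorm (x n - y))).
    by rewrite ler_wpM2r ?rnorm_ge0 // lerDl.
  by rewrite mulrC -ltr_pdivlMr // hN.
have [_ [x _ <-] hx] := projection J h sW cW.
exists x; rewrite -hB; apply/eqP; rewrite eq_sym -subr_eq0; apply/eqP.
set e := h - B x in hx *.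
have Bse : Bs e = 0.
  apply: (ipr_eq0 dotE) => u; rewrite -(ipT bn); apply: hx; by exists u.
apply: rnorm_eq0; apply/eqP; rewrite eq_le rnorm_ge0 andbT.
have := hk e; rewrite -hB -(normTs dotE bn) Bse rnorm0.
by rewrite pmulr_rle0.
Qed.

(** A normal operator has no residual spectrum: a lower bound already entails surjectivity. *)
Lemma resolvent_setP (l : R[i]) : resolvent_set opT l <->
  exists2 k : R, 0 < k & forall v, k * rnorm v <= rnorm (T v - l *: v).
Proof.
split=> [[[_ hi hs] [C hC]]|[k k0 hk]].
  exists (`|C| + 1)^-1; first by rewrite invr_gt0 ltr_wpDl.
  move=> v; rewrite ler_pdivrMl ?ltr_wpDl //.
  have dv : dom (resolvent opT l) (T v - l *: v) by exists v.
  have := hC _ dv; set y := resolvent opT l _ => hy.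
  have [_ ey] : [set x | dom (Defs.shift opT l) x /\
      Defs.shift opT l x = T v - l *: v] y.
    exact: (@xgetPex _ 0 [set x | dom (Defs.shift opT l) x /\
      Defs.shift opT l x = T v - l *: v] (ex_intro _ v (conj Logic.I erefl))).
  have yv : y = v by apply: hi; rewrite ?inE.
  rewrite -{1}yv; apply: le_trans hy _; rewrite ler_wpM2r ?rnorm_ge0 //.
  by have := ler_norm C; lra.
have hinj u v : T u - l *: u = T v - l *: v -> u = v.
  move=> e; apply/eqP; rewrite -subr_eq0; apply/eqP; apply: rnorm_eq0.
  apply/eqP; rewrite eq_le rnorm_ge0 andbT -(pmulr_rle0 _ k0).
  by apply: le_trans (hk _) _; rewrite shiftB e subrr rnorm0.
have honto := bounded_below_onto k0 hk.
split; first split.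
- by [].
- by move=> u v _ _; exact: hinj.
- by move=> h _; have [x hx] := honto h; exists x.
exists k^-1 => y _; rewrite ler_pdivlMl //.
have [x hx] := honto y.
have [_ ey] := @xgetPex _ 0 [set x | dom (Defs.shift opT l) x /\
  Defs.shift opT l x = y] (ex_intro _ x (conj Logic.I hx)).
by apply: le_trans (hk _) _; rewrite -[X in _ <= rnorm X]ey.
Qed.

Lemma spectrumP (l : R[i]) : spectrum opT l <-> approx_eigen T setT l.
Proof.
split=> [h|h /resolvent_setP[k k0 hk]].
  apply: contrapT => /(bounded_below_of_approx subspace_setT)[k k0 hk].
  by apply: h; apply/resolvent_setP; exists k => // v; exact: hk.
exact: approx_of_bounded_below k0 (fun v _ => hk v) h.
Qed.

Lemma eigen_spectrum (l : R[i]) v : v != 0 -> T v = l *: v -> spectrum opT l.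
Proof.
move=> v0 hv; apply/spectrumP => e e0.
have [t [w [t0 w1 ev ew]]] := unit_scale dotE v0.
exists w; split=> //.
by rewrite ew linearZ /= hv scalerA mulrC -scalerA subrr rnorm0.
Qed.

Lemma spectrum_bound (l : R[i]) : spectrum opT l -> rnorm l <= K.
Proof.
move=> /spectrumP h; rewrite -subr_le0; apply: (@le0_of_small _ _ 1) => e /h.
move=> [v [_ v1 hv]]; have := bn_T BN v; rewrite v1.
have := inNB_le J (T v) (T v - l *: v); rewrite opprB addrC subrK (inNZ J) v1; lra.
Qed.

Lemma spectrum_closed (l : R[i]) :
  (forall e : R, 0 < e -> exists2 l', spectrum opT l' & rnorm (l' - l) < e) ->
  spectrum opT l.
Proof.
move=> h; apply/spectrumP => e e0.
have e2 := divr_gt0 e0 (ltr0n R 2); have [l' /spectrumP/(_ _ e2)[v [_ v1 hv]] hl] := h _ e2.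
exists v; split=> //.
have -> : T v - l *: v = (T v - l' *: v) + (l' - l) *: v.
  by rewrite scalerBl addrA subrK.
by apply: le_lt_trans (inND J _ _) _; rewrite (inNZ J) v1; lra.
Qed.

End Spectrum.

Section IsolatedPoint.
Context {R : realType} {H : completeNormedModType R[i]}.
Variable dot : {dot H for Num.conj}.
Hypothesis dotE : forall x : H, dot x x = `|x| ^+ 2.
Local Notation ip := (ip dot).
Local Notation nH := (@rnorm R H).
Let J := inner_ip dotE.
Variables (T Ts : {linear H -> H}) (K : R).
Hypothesis BN : bounded_normal dot T Ts K.
Let opT : operator H := Operator setT T.

Lemma subspace_shift (V : set H) (S : {linear H -> H}) (l : R[i]) v :
  Defs.subspace V -> (forall v, V v -> V (S v)) -> V v -> V (S v - l *: v).
Proof.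
move=> sV VS Vv; apply: (subspaceB sV); [exact: VS|exact: subspace_scale].
Qed.

(* With [B = T - l], the joint spectrum of [T] and [(B^* B)^2 - rho^2 B^* B]
   forces the latter to be nonnegative, i.e. [|B (B v)| >= rho |B v|]. *)
Lemma isolated_sqr_below (V : set H) (l : R[i]) (rho : R) :
  Defs.subspace V -> (forall v, V v -> V (T v)) -> (forall v, V v -> V (Ts v)) ->
  0 < rho -> (forall l', spectrum opT l' -> rnorm (l' - l) < rho -> l' = l) ->
  forall v, V v -> rho * rnorm (T v - l *: v) <=
     rnorm (T (T v - l *: v) - l *: (T v - l *: v)).
Proof.
move=> sV VT VTs rho0 hl v Vv.
have [B [Bs [hB hBs bn]]] := bounded_normal_shift dotE BN l.
rewrite -!hB leNgt; apply/negP => lt_v.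
have VB u : V u -> V (B u) by rewrite hB; exact: subspace_shift.
have VBs u : V u -> V (Bs u) by rewrite hBs; exact: subspace_shift.
have BBs := bn_com bn; have KB0 := bn_ge0 bn.
set KB := K + rnorm l in bn KB0.
have bB := bn_bound bn; have bBs := bn_Ts dotE bn.
have [B2 hB2] : exists B2 : {linear H -> H}, forall x, B2 x = Bs (B x).
  by exists (Bs \o B).
have [D hD] : exists D : {linear H -> H},
    forall x, D x = B2 (B2 x) - (rho ^+ 2)%:C%C *: B2 x.
  by exists ((B2 \o B2) \- ((rho ^+ 2)%:C%C \*: B2)).
have VB2 u : V u -> V (B2 u) by rewrite hB2 => Vu; exact: (VBs _ (VB _ Vu)).
have bB2 u : rnorm (B2 u) <= KB ^+ 2 * rnorm u.
  rewrite hB2; apply: le_trans (bBs _) _; rewrite expr2 -mulrA ler_wpM2l //.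
have B2sa u w : ip (B2 u) w = ip u (B2 w).
  by rewrite !hB2 (ipTs dotE bn) (ipT bn).
have BT u : B (T u) = T (B u) by rewrite !hB shift_comm.
have BTs u : B (Ts u) = Ts (B u) by rewrite !hB shift_comm // (bn_com BN).
have BsT u : Bs (T u) = T (Bs u) by rewrite !hBs shift_comm // (bn_com BN).
have BsTs u : Bs (Ts u) = Ts (Bs u) by rewrite !hBs shift_comm.
have quadD u : ip (D u) u = rnorm (B (B u)) ^+ 2 - rho ^+ 2 * rnorm (B u) ^+ 2.
  rewrite hD (inBl J) (inR J) B2sa (inN J).
  have -> : ip (B2 u) u = rnorm (B u) ^+ 2 by rewrite hB2 (ipTs dotE bn) (inN J).
  by rewrite hB2 (normTs dotE bn).
have sD : selfadj dot V D (KB ^+ 2 * KB ^+ 2 + rho ^+ 2 * KB ^+ 2).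
  split.
  - by move=> u w; rewrite !hD (inBl J) (inBr J) (inR J) (inRr J) !B2sa.
  - by rewrite addr_ge0 // mulr_ge0 // sqr_ge0.
  - move=> u; rewrite hD; apply: le_trans (inNB_le J _ _) _.
    rewrite (inNZ J) rnormC (ger0_norm (sqr_ge0 _)) mulrDl lerD //.
      by apply: le_trans (bB2 _) _; rewrite -mulrA ler_wpM2l ?sqr_ge0.
    by rewrite -mulrA ler_wpM2l ?sqr_ge0.
  - move=> u Vu; rewrite hD; apply: (subspaceB sV).
      exact: (VB2 _ (VB2 _ Vu)).
    exact: (subspace_scale sV _ (VB2 _ Vu)).
have DT u : D (T u) = T (D u).
  have B2T w : B2 (T w) = T (B2 w) by rewrite !hB2 BT BsT.
  by rewrite !hD [T (_ - _)]linearB [T (_ *: _)]linearZ /= !B2T.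
have DTs u : D (Ts u) = Ts (D u).
  have B2T w : B2 (Ts w) = Ts (B2 w) by rewrite !hB2 BTs BsTs.
  by rewrite !hD [Ts (_ - _)]linearB [Ts (_ *: _)]linearZ /= !B2T.
have v0 : v != 0.
  by apply: contraTneq lt_v => ->; rewrite !linear0 rnorm0 mulr0 ltxx.
have [t [w [t0 w1 ev ew]]] := unit_scale dotE v0.
have Vw : V w by rewrite ew; exact: subspace_scale.
have lt_w : ip (D w) w < 0.
  have : rnorm (B (B w)) < rho * rnorm (B w).
    move: lt_v; rewrite ev !linearZ /= !(inNZ J) rnormC gtr0_norm //.
    by rewrite mulrCA ltr_pM2l.
  move=> h; rewrite quadD subr_lt0 -exprMn ltr_pXn2r ?nnegrE ?rnorm_ge0 //.
  by rewrite mulr_ge0 ?rnorm_ge0 // ltW.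
have [|l' hl'] := joint_spectrum dotE BN sV VT VTs sD DT DTs.
  by exists w.
set m := inf _ in hl'.
have m0 : m < 0.
  apply: le_lt_trans lt_w; apply: ge_inf; last by exists w.
  exists (- (KB ^+ 2 * KB ^+ 2 + rho ^+ 2 * KB ^+ 2)) => _ [u [Vu u1] <-].
  by have := selfadj_quad dotE sD u1; rewrite ler_norml => /andP[].
have sl' : spectrum opT l'.
  by apply/(spectrumP dotE BN) => e /hl'[u [Vu u1 _ h]]; exists u.
pose a := l' - l; pose A2 := rnorm a ^+ 2; pose p := A2 * A2 - rho ^+ 2 * A2.
(* [D] is the polynomial [t^2 - rho^2 t] in [B2], and [B2] acts on approximate eigenvectors of [T]
   for [l'] nearly as multiplication by [A2], so [m] is the value of that polynomial at [A2]. *)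
have pm : p = m.
  apply/eqP; rewrite -subr_eq0 -normr_le0.
  pose C := (KB ^+ 2 + A2 + rho ^+ 2) * (KB + rnorm a) + 1.
  apply: (@le0_of_small _ _ C) => e /hl'[u [Vu u1 hDu hTu]].
  pose q := T u - l' *: u.
  have Bu : B u = q + a *: u by rewrite hB /q /a scalerBl addrA subrK.
  have hq' : rnorm (Bs u - a^* *: u) = rnorm q.
    rewrite hBs /a rmorphB /= scalerBl opprB addrA subrK.
    exact: (norm_shift_adj dotE BN).
  have A2E : a * a^* = A2%:C%C by rewrite mulrC mulJr.
  pose y := B2 u - A2%:C%C *: u.
  have hy : rnorm y <= (KB + rnorm a) * rnorm q.
    have -> : y = Bs q + a *: (Bs u - a^* *: u).
      by rewrite /y hB2 Bu linearD linearZ /= scalerBr scalerA A2E addrA.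
    apply: le_trans (inND J _ _) _; rewrite (inNZ J) hq' mulrDl lerD2r; exact: bBs.
  have hz : D u - p%:C%C *: u = B2 y + (A2 - rho ^+ 2)%:C%C *: y.
    rewrite hD /y [B2 (_ - _)]linearB [B2 (_ *: _)]linearZ /=.
    have -> : p%:C%C *: u = (A2 - rho ^+ 2)%:C%C *: (A2%:C%C *: u).
      by rewrite scalerA -rmorphM /= mulrBl.
    rewrite scalerBr addrA; congr (_ - _).
    by rewrite rmorphB /= scalerBl addrA subrK.
  have -> : `|p - m| = rnorm ((p - m)%:C%C *: u).
    by rewrite (inNZ J) u1 mulr1 rnormC.
  have -> : (p - m)%:C%C *: u = (D u - m%:C%C *: u) - (D u - p%:C%C *: u).
    by rewrite rmorphB /= scalerBl opprB [D u - _]addrC addrACA subrr addr0 addrC.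
  apply: le_trans (inNB_le J _ _) _; rewrite hz /C mulrDl mul1r addrC lerD ?(ltW hDu) //.
  apply: (@le_trans _ _ ((KB ^+ 2 + A2 + rho ^+ 2) * rnorm y)).
    apply: le_trans (inND J _ _) _; rewrite (inNZ J) rnormC -addrA mulrDl lerD //.
    rewrite ler_wpM2r ?rnorm_ge0 //; apply: le_trans (ler_normB _ _) _.
    by rewrite !ger0_norm ?sqr_ge0.
  rewrite -mulrA ler_wpM2l ?addr_ge0 ?sqr_ge0 //; apply: le_trans hy _.
  by apply: ler_wpM2l; [apply: addr_ge0; rewrite ?rnorm_ge0|exact: ltW].
(* A negative [m] forces [A2 < rho ^+ 2], so [l'] is within [rho] of [l]; isolation gives [l' = l],
   and then [m = 0]. *)
have A20 : 0 <= A2 by exact: sqr_ge0.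
have rho2 : 0 < rho ^+ 2 by rewrite exprn_gt0.
have A2rho : A2 < rho ^+ 2.
  by rewrite ltNge; apply/negP => h; move: m0; rewrite -pm /p; nra.
have arho : rnorm a < rho.
  by rewrite -(@ltr_pXn2r _ 2) ?nnegrE ?rnorm_ge0 // ltW.
have a0 : a = 0 by rewrite /a (hl _ sl' arho) subrr.
by move: m0; rewrite -pm /p /A2 a0 rnorm0; nra.
Qed.

(* By [isolated_sqr_below] it suffices that [(T - l) V] is dense in [V], i.e.
   that [Ts - l^*] is injective on [V]. *)
Lemma isolated_below (V : set H) (l : R[i]) :
  Defs.subspace V -> closedN nH V ->
  (forall v, V v -> V (T v)) -> (forall v, V v -> V (Ts v)) ->
  isolated (spectrum opT : set R[i]^o) l ->
  (forall v, V v -> T v = l *: v -> v = 0) -> ~ approx_eigen T V l.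
Proof.
move=> sV cV VT VTs /isolatedP[_ [rho rho0 hl]] inj.
have hl' l' : spectrum opT l' -> rnorm (l' - l) < rho -> l' = l by exact: hl.
have h2 := isolated_sqr_below sV VT VTs rho0 hl'.
have [B [Bs [hB hBs bn]]] := bounded_normal_shift dotE BN l.
have VB u : V u -> V (B u) by rewrite hB; exact: subspace_shift.
have VBs u : V u -> V (Bs u) by rewrite hBs; exact: subspace_shift.
pose W0 : set H := [set B u | u in V].
have sW0 : Defs.subspace W0.
  split; first by exists 0; [exact: (proj1 sV)|rewrite linear0].
  move=> a _ _ [u Vu <-] [v Vv <-]; exists (a *: u + v); last by rewrite linearP.
  exact: (proj2 sV).
have cW := closed_completeN (@completeH R H) (adherent_closedN J (W := W0)).
apply: (@approx_of_bounded_below _ _ _ _ _ rho) => // v Vv.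
have [w Ww hw] := projection J v (adherent_subspace J sW0) cW.
have Vw : V w.
  by apply: cV => e /Ww[_ [u Vu <-] hu]; exists (B u) => //; exact: VB.
(* Once [v] lies in the closure of [B V], the inequality [rho |B u| <= |B (B u)|] passes to the
   limit [v]. *)
suff e0 : v - w = 0.
  move/eqP: e0; rewrite subr_eq0 => /eqP->.
  rewrite -hB -subr_le0; apply: (@le0_of_small _ _ (rho + (K + rnorm l))) => e.
  move=> /Ww[_ [u Vu <-] hu]; have := h2 u Vu; rewrite -!hB => h3.
  have h4 := inND3 J (B (B u)) (B w) 0; rewrite !subr0 -linearB in h4.
  have h5 := bn_bound bn (B u - w).
  have h6 := inNB_le J (B u) (B u - w); rewrite opprB addrC subrK in h6.
  have := bn_ge0 bn; nra.
set y := v - w in hw *.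
have Vy : V y by exact: subspaceB.
have Bsy : Bs y = 0.
  apply: rnorm_eq0; apply/eqP; rewrite -sqrf_eq0 -(inN J) (ipTs dotE bn) (inC J).
  apply/eqP; apply: hw; apply: (adherent_sub J); exists (Bs y) => //; exact: VBs.
apply: inj => //; apply/eqP; rewrite -subr_eq0 -hB; apply/eqP.
by apply: rnorm_eq0; rewrite -(normTs dotE bn) Bsy rnorm0.
Qed.

End IsolatedPoint.

(** * Coercivity up to finite rank and Galerkin stability *)

Section LinearSpan.
Context {R : realType} {V : lmodType R[i]}.
Implicit Types X W : set V.

Lemma sub_lspan X : X `<=` lspan X.
Proof.
move=> x Xx; exists 1%N, (fun=> 1), (fun=> x); split=> //.
by rewrite big_ord1 scale1r.
Qed.

Lemma subspace_sum W n (c : 'I_n -> R[i]) (x : 'I_n -> V) :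
  Defs.subspace W -> (forall i, W (x i)) -> W (\sum_(i < n) c i *: x i).
Proof.
move=> [W0 WL] Wx; apply: (big_ind W) => // [u v Wu Wv|i _].
  by have := WL 1 u v Wu Wv; rewrite scale1r.
by have := WL (c i) _ _ (Wx i) W0; rewrite addr0.
Qed.

Lemma lspan_min X W : Defs.subspace W -> X `<=` W -> lspan X `<=` W.
Proof.
move=> sW XW _ [n [c [x [Xx ->]]]]; apply: subspace_sum => // i; exact: XW.
Qed.

Lemma lspan_subspace X : Defs.subspace (lspan X).
Proof.
split.
  by exists 0%N, (fun=> 0), (fun=> 0); split=> [[]//|]; rewrite big_ord0.
move=> a u v [n1 [c1 [x1 [X1 ->]]]] [n2 [c2 [x2 [X2 ->]]]].
exists (n1 + n2)%N, (fun i => match fintype.split i with inl j => a * c1 j | inr j => c2 j end),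
  (fun i => match fintype.split i with inl j => x1 j | inr j => x2 j end); split.
  by move=> i; case: (fintype.split i).
rewrite big_split_ord scaler_sumr /=; congr (_ + _); apply: eq_bigr => i _.
  have -> : fintype.split (lshift n2 i) = inl i by exact: (unsplitK (inl _ i)).
  by rewrite scalerA.
by have -> : fintype.split (rshift n1 i) = inr i by exact: (unsplitK (inr _ i)).
Qed.

Lemma lspan_mono X Y : X `<=` Y -> lspan X `<=` lspan Y.
Proof.
by move=> XY; apply: lspan_min (@lspan_subspace Y) _ => x /XY; exact: sub_lspan.
Qed.

End LinearSpan.

Section Orthonormal.
Context {R : realType} {H : completeNormedModType R[i]}.
Variable dot : {dot H for Num.conj}.
Hypothesis dotE : forall x : H, dot x x = `|x| ^+ 2.
Local Notation ip := (ip dot).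
Let J := inner_ip dotE.
Implicit Types (e : seq H) (u v x y : H).

Definition oproj e u : H := \sum_(x <- e) dot u x *: x.

Lemma oproj_linear e a u v : oproj e (a *: u + v) = a *: oproj e u + oproj e v.
Proof.
rewrite /oproj scaler_sumr -big_split /=; apply: eq_bigr => x _.
by rewrite linearDl /= dotZl scalerDl scalerA.
Qed.

Lemma oproj_in e u : lspan [set` e] (oproj e u).
Proof.
have sL := @lspan_subspace _ _ [set` e].
rewrite /oproj big_seq; apply: (big_ind (lspan [set` e])) => [|x y Lx Ly|x xe].
- exact: (proj1 sL).
- by have := proj2 sL 1 _ _ Lx Ly; rewrite scale1r.
- by apply: (subspace_scale sL); exact: sub_lspan.
Qed.

Lemma oproj_dot e u x : orthonormal dot e -> x \in e -> dot (oproj e u) x = dot u x.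
Proof.
move=> /orthonormalP[ue oe] xe.
rewrite linear_sumlz /= (bigD1_seq x) //= dotZl.
rewrite (oe x x) //.
rewrite eqxx mulr1 big_seq_cond big1 ?addr0 //.
by move=> y /andP[ye yx]; rewrite dotZl (oe y x) // (negbTE yx) mulr0.
Qed.

Lemma dot_lspan0 (X : set H) v : (forall x, X x -> dot v x = 0) ->
  forall y, lspan X y -> dot v y = 0.
Proof.
move=> h _ [n [c [x [Xx ->]]]]; rewrite linear_sumr /= big1 // => i _.
by rewrite dotZr h ?mulr0.
Qed.

Lemma oproj_orth e u y : orthonormal dot e -> lspan [set` e] y ->
  dot (u - oproj e u) y = 0.
Proof.
move=> oe; apply: dot_lspan0 => x xe; rewrite linearBl /= oproj_dot ?subrr //.
Qed.

Lemma oproj_id e y : orthonormal dot e -> lspan [set` e] y -> oproj e y = y.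
Proof.
move=> oe Ly; apply/eqP; rewrite eq_sym -subr_eq0; apply/eqP; apply: rnorm_eq0.
apply/eqP; rewrite -sqrf_eq0 -(inN J) /ip oproj_orth //.
apply: (subspaceB (@lspan_subspace _ _ _)) => //; exact: oproj_in.
Qed.

Lemma oproj_sqr e u : orthonormal dot e ->
  rnorm u ^+ 2 = rnorm (u - oproj e u) ^+ 2 + rnorm (oproj e u) ^+ 2.
Proof.
move=> oe; rewrite -{1}(subrK (oproj e u) u) (sqrD_in J).
by rewrite /ip (oproj_orth _ oe) ?mulr0 ?addr0 //; exact: oproj_in.
Qed.

Lemma oproj_le e u : orthonormal dot e -> rnorm (oproj e u) <= rnorm u.
Proof.
move=> oe; rewrite -(@ler_pXn2r _ 2) ?nnegrE ?rnorm_ge0 //.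
by rewrite [leRHS](oproj_sqr _ oe) lerDr sqr_ge0.
Qed.

Lemma oprojC_le e u : orthonormal dot e -> rnorm (u - oproj e u) <= rnorm u.
Proof.
move=> oe; rewrite -(@ler_pXn2r _ 2) ?nnegrE ?rnorm_ge0 //.
by rewrite [leRHS](oproj_sqr _ oe) lerDl sqr_ge0.
Qed.

Lemma gram_schmidt (s : seq H) : exists e,
  orthonormal dot e /\ lspan [set` e] = lspan [set` s].
Proof.
elim: s => [|y s [e [oe es]]]; first by exists [::].
have sL := @lspan_subspace _ _ [set` e].
have sLy := @lspan_subspace _ _ [set` y :: s].
have ssub : lspan [set` e] `<=` lspan [set` y :: s].
  by rewrite es; apply: lspan_mono => x /= xs; rewrite inE xs orbT.
pose y' := y - oproj e y.
have yE : y = y' + oproj e y by rewrite subrK.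
have Ly' : lspan [set` y :: s] y'.
  apply: (subspaceB sLy); first by apply: sub_lspan; rewrite /= inE eqxx.
  by apply: ssub; exact: oproj_in.
have [y0|y0] := eqVneq y' 0.
  exists e; split=> //; apply/seteqP; split; first exact: ssub.
  apply: lspan_min => // x /=; rewrite inE => /orP[/eqP->|xs].
    by rewrite yE y0 add0r; exact: oproj_in.
  by rewrite es; exact: sub_lspan.
have [t [x [t0 x1 ex ey]]] := unit_scale dotE y0.
have xorth z : lspan [set` e] z -> dot x z = 0.
  by move=> Lz; rewrite ey dotZl oproj_orth ?mulr0.
exists (x :: e); split.
  rewrite /orthonormal /= dotE rnormE x1 expr1n eqxx /=.
  move: oe; rewrite /orthonormal => /andP[-> ->]; rewrite !andbT.
  by apply/allP => z ze /=; rewrite xorth //; exact: sub_lspan.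
have ssub' : lspan [set` e] `<=` lspan [set` x :: e].
  by apply: lspan_mono => z /= zs; rewrite inE zs orbT.
have sLx := @lspan_subspace _ _ [set` x :: e].
apply/seteqP; split; apply: lspan_min => // z /=; rewrite inE => /orP[/eqP->|zs].
- by rewrite ey; exact: subspace_scale.
- by apply: ssub; exact: sub_lspan.
- rewrite yE ex; apply: (proj2 sLx).
    by apply: sub_lspan; rewrite /= inE eqxx.
  by apply: ssub'; exact: oproj_in.
- by apply: ssub'; rewrite es; exact: sub_lspan.
Qed.

Lemma finite_dim_orthonormal (U : set H) : finite_dim U ->
  exists e, orthonormal dot e /\ U = lspan [set` e].
Proof. by move=> [s ->]; have [e [oe <-]] := gram_schmidt s; exists e. Qed.

End Orthonormal.

Lemma bolzano_weierstrass {R : realType} (u : nat -> R[i]) (M : R) :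
  (forall n, rnorm (u n) <= M) ->
  exists x, forall e, 0 < e -> forall k, exists2 n, (k <= n)%N & rnorm (u n - x) < e.
Proof.
move=> uM; pose v n : R * R := (complex.Re (u n), complex.Im (u n)).
have hc : compact (`[- M, M]%classic `*` `[- M, M]%classic : set (R * R)).
  by apply: compact_setX; exact: segment_compact.
have hv n : (`[- M, M]%classic `*` `[- M, M]%classic) (v n).
  have hr := le_trans (Re_le_rnorm (u n)) (uM n).
  have hi : `|complex.Im (u n)| <= M.
    apply: le_trans (uM n); rewrite -(@ler_pXn2r _ 2) ?nnegrE ?rnorm_ge0 //.
    by rewrite sqr_normr sqr_rnorm lerDr sqr_ge0.
  by split; rewrite /= in_itv /= -ler_norml.
have [|[a b] [_ cl]] := hc (v @ \oo) _.
  by exists 0%N => // n _; exact: hv.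
exists (a +i* b)%C => e e0 k.
have e2 : 0 < e / 2 by rewrite divr_gt0.
have h1 : (v @ \oo) [set v n | n in [set n | (k <= n)%N]].
  by exists k => // n kn; exists n.
have h2 : nbhs (a, b) (ball (a, b) (e / 2)) by exact: nbhsx_ballx.
have [_ [[n kn <-] [h3 h4]]] := cl _ _ h1 h2.
exists n => //; move: h3 h4; rewrite -!ball_normE /= /v.
case: (u n) => c d /= h3 h4.
rewrite -(@ltr_pXn2r _ 2) ?nnegrE ?rnorm_ge0 ?(ltW e0) // sqr_rnorm /=.
have q3 : (c - a) ^+ 2 < (e / 2) ^+ 2.
  by rewrite -sqr_normr distrC ltr_pXn2r ?nnegrE // ltW.
have q4 : (d - b) ^+ 2 < (e / 2) ^+ 2.
  by rewrite -sqr_normr distrC ltr_pXn2r ?nnegrE // ltW.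
by have := sqr_ge0 e; rewrite exprMn in q3 q4; nra.
Qed.

(** * Coercivity of [G] off finitely many eigenvectors *)

Section Coercive.
Context {R : realType} {H : completeNormedModType R[i]}.
Variable dot : {dot H for Num.conj}.
Hypothesis dotE : forall x : H, dot x x = `|x| ^+ 2.
Local Notation ip := (ip dot).
Local Notation nH := (@rnorm R H).
Let J := inner_ip dotE.
Variables (T Ts : {linear H -> H}) (K : R).
Hypothesis BN : bounded_normal dot T Ts K.
Let opT : operator H := Operator setT T.
Implicit Types (l w p : R[i]) (u v x y : H).

Lemma eigen_adj l x : T x = l *: x -> Ts x = l^* *: x.
Proof.
move=> h; apply/eqP; rewrite -subr_eq0; apply/eqP; apply: rnorm_eq0.
by rewrite (norm_shift_adj dotE BN) h subrr rnorm0.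
Qed.

Lemma eigen_orth l l' x y : T x = l *: x -> T y = l' *: y -> l != l' -> dot x y = 0.
Proof.
move=> hx hy ll; have := bn_adj BN x y.
rewrite hx (eigen_adj hy) dotZl dotZr conjCK => /eqP.
by rewrite -subr_eq0 -mulrBl mulf_eq0 subr_eq0 (negbTE ll) /= => /eqP.
Qed.

Lemma ipZx (a : R[i]) u : ip (a *: u) u = complex.Re a * rnorm u ^+ 2.
Proof.
rewrite -(inN J) /ip dotZl dotE rnormE -rmorphXn /=; case: a => b c /=.
by rewrite mulr0 subr0.
Qed.

(** Eigenspaces of a normal operator for distinct eigenvalues are orthogonal, so their orthonormal
    bases can be concatenated. *)
Lemma eigbasis (Z : seq R[i]) : uniq Z ->
  (forall l, l \in Z -> finite_dim (eigspace opT l)) ->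
  exists e : seq H, [/\ orthonormal dot e,
    forall x, x \in e -> exists2 l, l \in Z & T x = l *: x &
    forall l, l \in Z -> eigspace opT l `<=` lspan [set` e]].
Proof.
elim: Z => [|l Z IH] /=; first by exists [::].
move=> /andP[lZ uZ] fd; have [|e [oe he se]] := IH uZ.
  by move=> l' l'Z; apply: fd; rewrite inE l'Z orbT.
have [|f [of_ ef]] := finite_dim_orthonormal dotE (U := eigspace opT l).
  by apply: fd; rewrite inE eqxx.
have hf x : x \in f -> T x = l *: x.
  move=> xf; have : eigspace opT l x by rewrite ef; exact: sub_lspan.
  by case.
exists (f ++ e); split.
- rewrite orthonormal_cat of_ oe /=; apply/allP => x xf /=; apply/allP => y ye /=.
  have [l' l'Z hy] := he y ye; apply/eqP; apply: (eigen_orth (hf x xf) hy).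
  by apply: contraNneq lZ => ->.
- move=> x; rewrite mem_cat => /orP[xf|xe]; first by exists l; [rewrite inE eqxx|exact: hf].
  by have [l' l'Z hx] := he x xe; exists l' => //; rewrite inE l'Z orbT.
- move=> l'; rewrite inE => /orP[/eqP->|l'Z] x Ex.
    move: Ex; rewrite ef; apply: lspan_mono => y /= yf; by rewrite mem_cat yf.
  by apply: (lspan_mono _ (se l' l'Z x Ex)) => y /= yf; rewrite mem_cat yf orbT.
Qed.

(* [Gop w] is [(T - w)(T^* - w)]; on an eigenvector of [T] for [l] it acts as the
   element [gsym w l] of the set [Sigma_w] that defines [quad_set]. *)
Definition Gop w u := T (Ts u - w *: u) - w *: (Ts u - w *: u).
Definition gsym w l := (l - w) * (l^* - w).

Lemma Gop_approx w l u :
  rnorm (Gop w u - gsym w l *: u) <= (K + rnorm l + 2 * rnorm w) * rnorm (T u - l *: u).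
Proof.
pose q := T u - l *: u; pose qs := Ts u - l^* *: u.
have eqs : rnorm qs = rnorm q by exact: (norm_shift_adj dotE BN).
have h1 : Ts u - w *: u = qs + (l^* - w) *: u by rewrite scalerBl addrA subrK.
have h2 : T u - w *: u = q + (l - w) *: u by rewrite scalerBl addrA subrK.
have -> : Gop w u - gsym w l *: u = (T qs - w *: qs) + (l^* - w) *: q.
  rewrite /Gop h1 shiftD shiftZ h2 [_ *: (q + _)]scalerDr scalerA /gsym [(l^* - w) * _]mulrC.
  by rewrite addrA addrK.
apply: le_trans (inND J _ _) _; rewrite (inNZ J).
have h3 : rnorm (T qs - w *: qs) <= (K + rnorm w) * rnorm q.
  apply: le_trans (inNB_le J _ _) _; rewrite (inNZ J) mulrDl eqs lerD2r -eqs.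
  exact: bn_T BN qs.
have h4 : rnorm (l^* - w) <= rnorm l + rnorm w.
  rewrite -(rnormJ l) -lecR rmorphD /= -!rnormE; exact: ler_normB.
have := ler_wpM2r (rnorm_ge0 q) h4; rewrite -/q; lra.
Qed.

Lemma Gop_selfadj V w p : Defs.subspace V ->
  (forall v, V v -> V (T v)) -> (forall v, V v -> V (Ts v)) ->
  exists (D : {linear H -> H}) (KD : R), [/\ selfadj dot V D KD,
    forall u, D (T u) = T (D u), forall u, D (Ts u) = Ts (D u) &
    forall u, ip (D u) u = ip (p *: Gop w u) u].
Proof.
move=> sV VT VTs.
have [B1 [B1s [hB1 hB1s bn1]]] := bounded_normal_shift dotE BN w.
have [B2 [B2s [hB2 hB2s bn2]]] := bounded_normal_shift dotE BN w^*.
have [G hG] : exists G : {linear H -> H}, forall x, G x = B1 (B2s x) by exists (B1 \o B2s).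
have [Gs hGs] : exists G : {linear H -> H}, forall x, G x = B2 (B1s x) by exists (B2 \o B1s).
have GE u : G u = Gop w u by rewrite hG hB1 !hB2s conjCK.
have Gadj u v : ip (G u) v = ip u (Gs v).
  by rewrite hG hGs (ipT bn1) (ipTs dotE bn2).
have comG (S : {linear H -> H}) u : (forall v, S (T v) = T (S v)) ->
    (forall v, S (Ts v) = Ts (S v)) -> G (S u) = S (G u) /\ Gs (S u) = S (Gs u).
  move=> ST STs; split.
    by rewrite !hG !hB1 !hB2s (shift_comm _ (ST _)) (shift_comm _ (STs _)).
  by rewrite !hGs !hB2 !hB1s (shift_comm _ (ST _)) (shift_comm _ (STs _)).
have [GT GsT] : (forall u, G (T u) = T (G u)) /\ (forall u, Gs (T u) = T (Gs u)).
  by split=> u; have [] := comG T u _ (bn_com BN).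
have [GTs GsTs] : (forall u, G (Ts u) = Ts (G u)) /\ (forall u, Gs (Ts u) = Ts (Gs u)).
  by split=> u; have [] := comG Ts u (fun v => esym (bn_com BN v)) _.
pose h : R[i] := (2^-1)%:C%C.
have hn : rnorm h = 2^-1 by rewrite rnormC ger0_norm // invr_ge0.
have [D hD] : exists D : {linear H -> H}, forall x, D x = h *: (p *: G x + p^* *: Gs x).
  by exists (h \*: ((p \*: G) \+ (p^* \*: Gs))).
have K0 := bn_K0 BN; have w0 := rnorm_ge0 w.
pose KG := (K + rnorm w) * (K + rnorm w).
have KG0 : 0 <= KG by rewrite mulr_ge0 // addr_ge0.
have bG u : rnorm (G u) <= KG * rnorm u.
  rewrite hG; apply: le_trans (bn_bound bn1 _) _; rewrite /KG -mulrA ler_wpM2l ?addr_ge0 //.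
  by have := bn_Ts dotE bn2 u; rewrite rnormJ.
have bGs u : rnorm (Gs u) <= KG * rnorm u.
  rewrite hGs; apply: le_trans (bn_bound bn2 _) _; rewrite /KG -mulrA rnormJ.
  by rewrite ler_wpM2l ?addr_ge0 //; exact: (bn_Ts dotE bn1).
have ipp u v : ip (p *: G u) v = ip u (p^* *: Gs v).
  by rewrite (inZ J) Gadj linearZ.
have ipps u v : ip (p^* *: Gs u) v = ip u (p *: G v).
  by rewrite (inC J) -ipp (inC J).
exists D, (rnorm p * KG); split.
- split.
  + by move=> u v; rewrite !hD (inR J) (inRr J) (inD J) (inDr J) ipp ipps addrC.
  + by rewrite mulr_ge0 ?rnorm_ge0.
  + move=> u; rewrite hD (inNZ J) hn; have := inND J (p *: G u) (p^* *: Gs u).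
    rewrite !(inNZ J) rnormJ; have := ler_wpM2l (rnorm_ge0 p) (bG u).
    by have := ler_wpM2l (rnorm_ge0 p) (bGs u); lra.
  + have VB1 u : V u -> V (B1 u) by rewrite hB1; exact: subspace_shift.
    have VB2 u : V u -> V (B2 u) by rewrite hB2; exact: subspace_shift.
    have VB1s u : V u -> V (B1s u) by rewrite hB1s; exact: subspace_shift.
    have VB2s u : V u -> V (B2s u) by rewrite hB2s; exact: subspace_shift.
    move=> u Vu; rewrite hD hG hGs; apply: (subspace_scale sV); apply: (proj2 sV).
      exact: (VB1 _ (VB2s _ Vu)).
    by apply: (subspace_scale sV); exact: (VB2 _ (VB1s _ Vu)).
- by move=> u; rewrite !hD GT GsT [T (_ *: _)]linearZ /= [T (_ + _)]linearD /=
    ![T (_ *: _)]linearZ.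
- by move=> u; rewrite !hD GTs GsTs [Ts (_ *: _)]linearZ /= [Ts (_ + _)]linearD /=
    ![Ts (_ *: _)]linearZ.
- move=> u; rewrite hD (inR J) (inD J) ipps (inC J u) -GE; lra.
Qed.

Lemma gsym_continuous w p l : forall e : R, 0 < e -> exists2 del, 0 < del &
  forall l', rnorm (l' - l) < del ->
    `|complex.Re (p * gsym w l') - complex.Re (p * gsym w l)| < e.
Proof.
move=> e e0.
pose C := rnorm p * (rnorm (l - w) + rnorm (l^* - w) + 1) + 1.
have C0 : 0 < C.
  by rewrite ltr_wpDl // mulr_ge0 ?addr_ge0 ?rnorm_ge0.
exists (Num.min 1 (e / C)); first by rewrite lt_min ltr01 divr_gt0.
move=> l'; rewrite lt_min => /andP[h1 h2].
pose a := l' - l.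
rewrite -raddfB -mulrBr; apply: le_lt_trans (Re_le_rnorm _) _.
have -> : gsym w l' - gsym w l = a * (l^* - w) + (l - w) * a^* + a * a^*.
  rewrite /gsym /a rmorphB /=; ring.
rewrite rnormM.
have h3 : rnorm (a * (l^* - w) + (l - w) * a^* + a * a^*) <=
   (rnorm (l - w) + rnorm (l^* - w) + 1) * rnorm a.
  rewrite -lecR -rnormE; apply: le_trans (ler_normD _ _) _.
  apply: le_trans (lerD (ler_normD _ _) (lexx _)) _.
  rewrite !rnormE -!rmorphD /= lecR !rnormM rnormJ.
  have := rnorm_ge0 a; rewrite -/a in h1; nra.
rewrite ltr_pdivlMr // -/a in h2.
have := ler_wpM2l (rnorm_ge0 p) h3; rewrite mulrA => h4.
apply: le_lt_trans h4 _; apply: le_lt_trans _ h2.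
by rewrite mulrC ler_wpM2l ?rnorm_ge0 // /C lerDl.
Qed.

(* Infinitely many spectral points would accumulate at a point of the essential
   spectrum where the symbol is too small. *)
Lemma small_symbol_finite w p d : 0 < d ->
  (forall l, essential_spectrum opT l -> d <= complex.Re (p * gsym w l)) ->
  finite_set [set l | spectrum opT l /\ complex.Re (p * gsym w l) <= d / 2].
Proof.
move=> d0 hess; set Z := [set l | _]; apply: contrapT => infZ.
have [f] : $|{injfun [set: nat] >-> (Z : set R[i]^o)}|.
  by apply/pcard_leP; apply/infiniteP.
have Zf n : Z (f n) by exact: funS.
have injf m n : f m = f n -> m = n by move=> h; apply: (@inj _ _ _ f) => //; rewrite inE.
have [l hl] := bolzano_weierstrass (fun n => spectrum_bound dotE BN (proj1 (Zf n))).
have sl : spectrum opT l.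
  apply: (spectrum_closed dotE BN) => e /hl/(_ 0%N)[n _ hn].
  by exists (f n) => //; case: (Zf n).
have gl : complex.Re (p * gsym w l) <= d / 2.
  rewrite -subr_le0; apply: (@le0_of_small _ _ 1) => e e0.
  have [del del0 hdel] := gsym_continuous w p l e0.
  have [n _ /hdel] := hl _ del0 0%N; have [_] := Zf n.
  rewrite mul1r ltr_norml => h /andP[h1 _]; lra.
have : ~ essential_spectrum opT l by move=> /hess; lra.
move=> /not_andP[//|/contrapT[/isolatedP[_ [rho rho0 hrho]] _ _]].
have [n1 _ h1] := hl _ rho0 0%N; have [n2 n12 h2] := hl _ rho0 n1.+1.
have e1 := hrho _ (proj1 (Zf n1)) h1; have e2 := hrho _ (proj1 (Zf n2)) h2.
by have := injf _ _ (etrans e1 (esym e2)) => e12; rewrite e12 ltnn in n12.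
Qed.

(** [e] spans the eigenspaces of the finitely many spectral points where the symbol is at most
    [d / 2], and [V] is its complement. If the form fell below [d / 2] on [V], [joint_spectrum]
    would give an approximate eigenvalue [l] of [T] on [V] with symbol below [d / 2]. Then [l] is
    one of the removed isolated points, [T - l] is injective on [V], and [isolated_below] gives a
    contradiction. *)
Lemma coercive_split w p d : 0 < d ->
  (forall l, essential_spectrum opT l -> d <= complex.Re (p * gsym w l)) ->
  exists e : seq H, [/\ orthonormal dot e,
    forall x, x \in e -> exists2 l, spectrum opT l & T x = l *: x &
    forall v, (forall x, x \in e -> dot v x = 0) ->
      d / 2 * rnorm v ^+ 2 <= ip (p *: Gop w v) v].
Proof.
move=> d0 hess.
have /finite_seqP[s hs] := small_symbol_finite d0 hess.
have Zdisc l : l \in undup s -> discrete_spectrum opT l.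
  rewrite mem_undup => ls.
  have [sl gl] : [set l | spectrum opT l /\ complex.Re (p * gsym w l) <= d / 2] l.
    by rewrite hs.
  have : ~ essential_spectrum opT l by move=> /hess; lra.
  by move=> /not_andP[//|/contrapT].
have [|e [oe he se]] := eigbasis (undup_uniq s).
  by move=> l /Zdisc[].
exists e; split=> //.
  by move=> x /he[l /Zdisc[/isolatedP[sl _] _ _] hx]; exists l.
pose V : set H := [set v | forall x, x \in e -> dot v x = 0].
have sV : Defs.subspace V.
  split; first by move=> x _; rewrite linear0l.
  by move=> a u v Vu Vv x xe; rewrite linearDl /= dotZl Vu // Vv // mulr0 addr0.
have VT v : V v -> V (T v).
  move=> Vv x xe; have [l _ hx] := he x xe.
  by rewrite (bn_adj BN) (eigen_adj hx) dotZr Vv ?mulr0.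
have VTs v : V v -> V (Ts v).
  move=> Vv x xe; have [l _ hx] := he x xe.
  by rewrite (bn_adj (bounded_normal_adj dotE BN)) hx dotZr Vv ?mulr0.
have cV : closedN nH V.
  move=> v hv x xe; apply: rnorm_eq0; apply/eqP; rewrite eq_le rnorm_ge0 andbT.
  apply: (@le0_of_small _ _ (rnorm x)) => eps /hv[u Vu hu].
  have -> : dot v x = dot (v - u) x by rewrite linearBl /= (Vu x xe) subr0.
  apply: le_trans (dot_CS dotE _ _) _; rewrite mulrC ler_wpM2l ?rnorm_ge0 //.
  by rewrite (inNB J) ltW.
move=> v Vv; rewrite leNgt; apply/negP => lt_v.
have v0 : v != 0.
  apply: contraTneq lt_v => ->; rewrite (in0r J) rnorm0 expr0n /= mulr0 ltxx //.
have [D [KD [sD DT DTs hD]]] := Gop_selfadj w p sV VT VTs.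
have [t [x [t0 x1 ev ex]]] := unit_scale dotE v0.
have Vx : V x by rewrite ex; exact: (subspace_scale sV _ Vv).
have lt_x : ip (D x) x < d / 2.
  move: lt_v; rewrite -hD ev linearZ /= (inR J) (inRr J) (inNZ J) rnormC x1 mulr1.
  by rewrite sqr_normr; nra.
have [|l hl] := joint_spectrum dotE BN sV VT VTs sD DT DTs; first by exists x.
set m := inf _ in hl.
have m_lt : m < d / 2.
  apply: le_lt_trans lt_x; apply: ge_inf; last by exists x.
  exists (- KD) => _ [u [Vu u1] <-].
  by have := selfadj_quad dotE sD u1; rewrite ler_norml => /andP[].
have appl : approx_eigen T V l by move=> eps /hl[u [Vu u1 _ h]]; exists u.
have sl : spectrum opT l.
  by apply/(spectrumP dotE BN); exact: approx_mono appl.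
have gl : complex.Re (p * gsym w l) = m.
  apply/eqP; rewrite -subr_eq0 -normr_le0.
  apply: (@le0_of_small _ _ (1 + rnorm p * (K + rnorm l + 2 * rnorm w))) => eps.
  move=> /hl[u [Vu u1 hDu hTu]].
  have e1 : ip (D u) u - m = ip (D u - m%:C%C *: u) u.
    by rewrite (inBl J) (inR J) (inN J) u1 expr1n mulr1.
  have e2 : ip (D u) u - complex.Re (p * gsym w l) =
      ip (p *: (Gop w u - gsym w l *: u)) u.
    rewrite hD (scalerBr p (Gop w u)) (inBl J (p *: Gop w u)) (scalerA p).
    by rewrite ipZx u1 expr1n mulr1.
  have -> : complex.Re (p * gsym w l) - m =
    ip (D u - m%:C%C *: u) u - ip (p *: (Gop w u - gsym w l *: u)) u.
    by rewrite -e1 -e2; ring.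
  apply: le_trans (ler_normB _ _) _; rewrite mulrDl mul1r; apply: lerD.
    by apply: le_trans (in_CS J _ _) _; rewrite u1 mulr1 ltW.
  apply: le_trans (in_CS J _ _) _; rewrite u1 mulr1 (inNZ J) -mulrA.
  rewrite ler_wpM2l ?rnorm_ge0 //; apply: le_trans (Gop_approx w l u) _.
  apply: ler_wpM2l; last exact: ltW.
  have := bn_K0 BN; have := rnorm_ge0 l; have := rnorm_ge0 w; lra.
have lZ : l \in undup s.
  rewrite mem_undup; suff : [set` s] l by [].
  by rewrite -hs /=; split=> //; rewrite gl ltW.
have [iso _ _] := Zdisc l lZ.
apply: (isolated_below dotE BN sV cV VT VTs iso) appl => u Vu hu.
apply: rnorm_eq0; apply/eqP; rewrite -sqrf_eq0 -(inN J) /ip.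
rewrite (@dot_lspan0 _ _ dot [set` e] u) //.
by apply: (se l lZ); split.
Qed.

End Coercive.

Section ProjectionFamily.
Context {R : realType} {H : completeNormedModType R[i]}.
Variable dot : {dot H for Num.conj}.
Hypothesis dotE : forall x : H, dot x x = `|x| ^+ 2.
Local Notation ip := (ip dot).
Let J := inner_ip dotE.

Record is_oproj (U : set H) (P : {linear H -> H}) := IsOproj {
  opr_sub : Defs.subspace U;
  opr_in : forall x, U (P x);
  opr_orth : forall x q, U q -> dot (x - P x) q = 0 }.

Variables (U : set H) (P : {linear H -> H}).
Hypothesis hP : is_oproj U P.

Lemma opr_ip x q : U q -> ip (x - P x) q = 0.
Proof. by move=> Uq; rewrite /ip (opr_orth hP). Qed.

Lemma opr_id x : U x -> P x = x.
Proof.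
move=> Ux; apply/eqP; rewrite eq_sym -subr_eq0; apply/eqP; apply: rnorm_eq0.
apply/eqP; rewrite -sqrf_eq0 -(inN J) opr_ip //.
exact: (subspaceB (opr_sub hP) Ux (opr_in hP x)).
Qed.

Lemma opr_sa x y : ip (P x) y = ip x (P y).
Proof.
have h1 := opr_ip y (opr_in hP x); have h2 := opr_ip x (opr_in hP y).
rewrite (inC J) (inBr J) in h1; rewrite (inBl J) in h2; lra.
Qed.

Lemma opr_sqr x q : U q -> rnorm (x - q) ^+ 2 = rnorm (x - P x) ^+ 2 + rnorm (P x - q) ^+ 2.
Proof.
move=> Uq; have -> : x - q = (x - P x) + (P x - q) by rewrite addrA subrK.
rewrite (sqrD_in J) opr_ip ?mulr0 ?addr0 //.
exact: (subspaceB (opr_sub hP) (opr_in hP x) Uq).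
Qed.

Lemma opr_best x q : U q -> rnorm (x - P x) <= rnorm (x - q).
Proof.
move=> Uq; rewrite -(@ler_pXn2r _ 2) ?nnegrE ?rnorm_ge0 // (opr_sqr _ Uq).
by rewrite lerDl sqr_ge0.
Qed.

Lemma opr_le x : rnorm (P x) <= rnorm x.
Proof.
have := opr_sqr x (proj1 (opr_sub hP)); rewrite !subr0 => h.
by rewrite -(@ler_pXn2r _ 2) ?nnegrE ?rnorm_ge0 // h lerDr sqr_ge0.
Qed.

End ProjectionFamily.

Section Galerkin.
Context {R : realType} {H : completeNormedModType R[i]}.
Variable dot : {dot H for Num.conj}.
Hypothesis dotE : forall x : H, dot x x = `|x| ^+ 2.
Local Notation ip := (ip dot).
Let J := inner_ip dotE.
Variables (T Ts : {linear H -> H}) (K : R).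
Hypothesis BN : bounded_normal dot T Ts K.
Let opT : operator H := Operator setT T.
Local Notation Gop := (Gop T Ts).
Implicit Types (l w p : R[i]) (u v x y : H).

Lemma parseval (e : seq H) (c : H -> R[i]) : orthonormal dot e ->
  rnorm (\sum_(x <- e) c x *: x) ^+ 2 = \sum_(x <- e) rnorm (c x) ^+ 2.
Proof.
move=> oe; have [ue de] := orthonormalP oe.
rewrite -(inN J) (in_sum_l J) !big_seq; apply: eq_bigr => x xe.
rewrite (inZ J) /ip dotZr conjCK linear_sumr /=.
rewrite -big_seq (bigD1_seq x) //= dotZr (de x x) // eqxx mulr1 big_seq_cond.
rewrite big1 ?addr0 => [|y /andP[ye yx]].
  by rewrite mulrC mulJr.
by rewrite dotZr (de x y) // eq_sym (negbTE yx) mulr0.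
Qed.

Lemma Gop_linear w : exists G : {linear H -> H}, forall x, G x = Gop w x.
Proof. by exists ((T \- (w \*: idfun)) \o (Ts \- (w \*: idfun))). Qed.

Lemma Gop_bound w u : rnorm (Gop w u) <= (K + rnorm w) ^+ 2 * rnorm u.
Proof.
have K0 := bn_K0 BN; have w0 := rnorm_ge0 w.
have h1 a : rnorm (T a - w *: a) <= (K + rnorm w) * rnorm a.
  by apply: le_trans (inNB_le J _ _) _; rewrite (inNZ J) mulrDl lerD2r (bn_T BN).
have h2 a : rnorm (Ts a - w *: a) <= (K + rnorm w) * rnorm a.
  by apply: le_trans (inNB_le J _ _) _; rewrite (inNZ J) mulrDl lerD2r (bn_Ts dotE BN).
apply: le_trans (h1 _) _; rewrite expr2 -mulrA ler_wpM2l ?addr_ge0 //.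
Qed.

Lemma Gop_dot w l v x : T x = l *: x -> dot (Gop w v) x = gsym w l * dot v x.
Proof.
move=> hx; have hs := eigen_adj dotE BN hx.
rewrite linearBl /= dotZl (bn_adj BN) hs dotZr conjCK.
rewrite linearBl /= dotZl (bn_adj (bounded_normal_adj dotE BN)) hx dotZr.
by rewrite /gsym; ring.
Qed.

Lemma Gop_eig w l x : T x = l *: x -> Gop w x = gsym w l *: x.
Proof.
move=> hx; have hs := eigen_adj dotE BN hx.
transitivity (T (Ts x - w *: x) - w *: (Ts x - w *: x)); first by [].
by rewrite hs -scalerBl shiftZ hx -scalerBl scalerA mulrC.
Qed.

(* The test vector [Jt] of the stability estimate: [p^* u] up to a correction of
   finite rank, chosen so that [Re <G u, Jt u>] controls [|u - Pi u|^2]. *)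
Section Stability.
Variables (w p : R[i]) (k : R) (e : seq H).
Hypothesis k0 : 0 < k.
Hypothesis oe : orthonormal dot e.
Hypothesis he : forall x, x \in e -> exists2 l, spectrum opT l & T x = l *: x.
Hypothesis coe : forall v, (forall x, x \in e -> dot v x = 0) ->
  k * rnorm v ^+ 2 <= ip (p *: Gop w v) v.

(** On a unit eigenvector [x] this is the value of the symbol, so [e0] collects the vectors of [e]
    killed by [G(w)]; coercivity will show that they span its whole kernel. *)
Let gam x := dot (Gop w x) x.
Let e0 := [seq x <- e | gam x == 0].
Let Jt u := p^* *: (u - oproj dot e u) + Gop w (oproj dot e u).

Let gamE x l : x \in e -> T x = l *: x -> gam x = gsym w l.
Proof.
move=> xe hx; have [_ de] := orthonormalP oe.
by rewrite /gam (Gop_dot _ _ hx) (de x x) // eqxx mulr1.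
Qed.

Let Gx x : x \in e -> Gop w x = gam x *: x.
Proof. by move=> xe; have [l _ hx] := he xe; rewrite (gamE xe hx) (Gop_eig _ hx). Qed.

Let Gdot v x : x \in e -> dot (Gop w v) x = gam x * dot v x.
Proof. by move=> xe; have [l _ hx] := he xe; rewrite (gamE xe hx) (Gop_dot _ _ hx). Qed.

Let oe0 : orthonormal dot e0.
Proof.
have [ue de] := orthonormalP oe; apply/orthonormalP; split; first exact: filter_uniq.
by move=> x y; rewrite !mem_filter => /andP[_ xe] /andP[_ ye]; exact: de.
Qed.

Let gsum u : Gop w (oproj dot e u) = \sum_(x <- e) (gam x * dot u x) *: x.
Proof.
have [G hG] := Gop_linear w.
rewrite -hG /oproj linear_sum /= !big_seq; apply: eq_bigr => x xe.
by rewrite linearZ /= hG Gx // scalerA mulrC.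
Qed.

Let oproj0E u : oproj dot e0 u = \sum_(x <- e) (if gam x == 0 then dot u x else 0) *: x.
Proof.
rewrite /oproj big_filter big_mkcond /=; apply: eq_bigr => x _.
by case: eqP => // _; rewrite scale0r.
Qed.

Let gam_min : exists2 k', 0 < k' & forall x, x \in e -> gam x != 0 -> k' <= rnorm (gam x) ^+ 2.
Proof.
elim: (e) => [|y s [k1 k10 h]]; first by exists 1.
have [y0|y0] := eqVneq (gam y) 0.
  by exists k1 => // x; rewrite inE => /orP[/eqP->|/h//]; rewrite y0 eqxx.
exists (Num.min k1 (rnorm (gam y) ^+ 2)).
  by rewrite lt_min k10 exprn_gt0 // rnorm_gt0.
move=> x; rewrite inE => /orP[/eqP->|xs] x0; first by rewrite ge_min lexx orbT.
by rewrite ge_min h.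
Qed.

Let Gop_oprojC u : ip (Gop w (u - oproj dot e u)) (Gop w (oproj dot e u)) = 0.
Proof.
rewrite gsum (inC J) (in_sum_l J) big_seq big1 // => x xe.
rewrite (inC J) (inZr dotE) /ip dotZl Gdot //.
rewrite (oproj_orth u oe) ?mulr0 //; exact: sub_lspan.
Qed.

Let Gop_span u : lspan [set` e] (Gop w (oproj dot e u)).
Proof.
have sL := @lspan_subspace _ _ [set` e].
rewrite gsum big_seq; apply: (big_ind (lspan [set` e])) => [|x y Lx Ly|x xe].
- exact: (proj1 sL).
- by have := proj2 sL 1 _ _ Lx Ly; rewrite scale1r.
- by apply: (subspace_scale sL); exact: sub_lspan.
Qed.

(** [G(w)] respects the splitting into the span of [e] and its complement, so the cross terms
    vanish. The complement contributes through [coe]; on the span the test vector is the image under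
    [G(w)] itself, which yields the sum of [|gam x|^2 |<u, x>|^2]. *)
Let coercive : exists2 k', 0 < k' & forall u,
  k' * rnorm (u - oproj dot e0 u) ^+ 2 <= ip (Gop w u) (Jt u).
Proof.
have [k1 k10 hk1] := gam_min.
have [G hG] := Gop_linear w.
exists (Num.min k k1); first by rewrite lt_min k0.
move=> u; set u1 := oproj dot e u; set u0 := u - u1.
have u0e x : x \in e -> dot u0 x = 0.
  by move=> xe; apply: (oproj_orth u oe); exact: sub_lspan.
have u01 (v : H) : lspan [set` e] v -> ip u0 v = 0.
  by move=> Lv; rewrite /ip (oproj_orth u oe).
have LG := Gop_span u; rewrite -/u1 in LG.
have -> : ip (Gop w u) (Jt u) = ip (p *: Gop w u0) u0 + rnorm (Gop w u1) ^+ 2.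
  rewrite /Jt -/u1 -/u0; have -> : Gop w u = Gop w u0 + Gop w u1.
    by rewrite -!hG -linearD subrK.
  have h1 : ip (Gop w u0) (Gop w u1) = 0 := Gop_oprojC u.
  have h2 : ip (Gop w u1) (p^* *: u0) = 0.
    rewrite (inC J) (inZ J); apply: u01.
    exact: (subspace_scale (@lspan_subspace _ _ _)).
  move: (Gop w u0) (Gop w u1) h1 h2 => g0 g1 h1 h2.
  by rewrite (inDr J) !(inD J) h1 h2 (inN J) (inZ J); ring.
have e1 : u - oproj dot e0 u = u0 + \sum_(x <- e) (if gam x == 0 then 0 else dot u x) *: x.
  have -> : u - oproj dot e0 u = u0 + (u1 - oproj dot e0 u) by rewrite addrA subrK.
  congr (_ + _); rewrite oproj0E /u1 /oproj -sumrB; apply: eq_bigr => x _.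
  by case: eqP => _; rewrite ?subrr ?scale0r ?subr0.
rewrite e1 (sqrD_in J) u01; last first.
  have sL := @lspan_subspace _ _ [set` e].
  rewrite big_seq; apply: (big_ind (lspan [set` e])) => [|x y Lx Ly|x xe].
  - exact: (proj1 sL).
  - by have := proj2 sL 1 _ _ Lx Ly; rewrite scale1r.
  - by apply: (subspace_scale sL); exact: sub_lspan.
rewrite mulr0 addr0 mulrDr lerD //.
  apply: le_trans (coe u0e); rewrite ler_wpM2r ?sqr_ge0 //.
  by rewrite ge_min lexx.
rewrite gsum !parseval // mulr_sumr big_seq [leRHS]big_seq; apply: ler_sum => x xe.
case: eqP => [_|/eqP g0]; first by rewrite rnorm0 expr0n /= mulr0 sqr_ge0.
rewrite rnormM exprMn ler_wpM2r ?sqr_ge0 //.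
by apply: le_trans (hk1 x xe g0); rewrite ge_min lexx orbT.
Qed.

Let Jt_linear : exists L : {linear H -> H}, forall u, L u = Jt u.
Proof.
have [G hG] := Gop_linear w.
have [Q hQ] : exists Q : {linear H -> H}, forall u, Q u = oproj dot e u.
  by apply: linear_exists => a u v; exact: oproj_linear.
exists ((p^* \*: (idfun \- Q)) \+ (G \o Q)) => u.
by rewrite /Jt /= -!hQ hG.
Qed.

Let oproj_sub u : oproj dot e (oproj dot e0 u) = oproj dot e0 u.
Proof.
apply: (oproj_id dotE oe); apply: (lspan_mono _ (oproj_in dot e0 u)) => x /=.
by rewrite mem_filter => /andP[].
Qed.

Let Gop0 u : Gop w (oproj dot e0 u) = 0.
Proof.
have [G hG] := Gop_linear w.
rewrite -hG /oproj linear_sum /= big_seq big1 // => x.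
rewrite mem_filter => /andP[/eqP g0 xe].
by rewrite linearZ /= hG Gx // g0 scale0r scaler0.
Qed.

Let Jt0 u : Jt (oproj dot e0 u) = 0.
Proof. by rewrite /Jt oproj_sub subrr scaler0 Gop0 addr0. Qed.

Let Jt_bound u : rnorm (Jt u) <= (rnorm p + (K + rnorm w) ^+ 2) * rnorm (u - oproj dot e0 u).
Proof.
have [L hL] := Jt_linear.
have -> : Jt u = Jt (u - oproj dot e0 u) by rewrite -!hL linearB /= !hL Jt0 subr0.
move: (u - _) => v; rewrite /Jt; apply: le_trans (inND J _ _) _.
rewrite (inNZ J) rnormJ mulrDl lerD //.
  by rewrite ler_wpM2l ?rnorm_ge0 // oprojC_le.
apply: le_trans (Gop_bound _ _) _; rewrite ler_wpM2l ?sqr_ge0 //.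
exact: oproj_le.
Qed.

Let Jt_orth0 u x : x \in e0 -> dot (Jt u) x = 0.
Proof.
rewrite mem_filter => /andP[/eqP g0 xe].
rewrite /Jt linearDl /= dotZl Gdot // g0 mul0r addr0.
by rewrite (oproj_orth u oe) ?mulr0 //; exact: sub_lspan.
Qed.

Let ker_sub u : Gop w u = 0 -> oproj dot e0 u = u.
Proof.
move=> Gu; have [k' k'0 h] := coercive; have := h u.
rewrite Gu (in0l J) pmulr_rle0 // => h1.
apply/eqP; rewrite eq_sym -subr_eq0; apply/eqP; apply: rnorm_eq0; apply/eqP.
by rewrite -sqrf_eq0 eq_le h1 sqr_ge0.
Qed.

Variables (Un : nat -> set H) (P : nat -> {linear H -> H}).
Hypothesis hP : forall n, is_oproj dot (Un n) (P n).
Hypothesis cP : forall x (eps : R), 0 < eps ->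
  exists N, forall n, (N <= n)%N -> rnorm (x - P n x) < eps.

(** Strong convergence of the projections is uniform on a finite-dimensional space. *)
Lemma oproj_approx (s : seq H) : orthonormal dot s -> forall eps : R, 0 < eps ->
  exists N, forall n, (N <= n)%N -> forall b, lspan [set` s] b ->
    rnorm (b - P n b) <= eps * rnorm b.
Proof.
move=> os eps eps0.
have [N hN] : exists N, forall n, (N <= n)%N ->
    \sum_(x <- s) rnorm (x - P n x) <= eps.
  elim: (s) eps eps0 => [|x t IH] eps eps0.
    by exists 0%N => n _; rewrite big_nil ltW.
  have e2 := divr_gt0 eps0 (ltr0n R 2).
  have [N1 h1] := IH _ e2; have [N2 h2] := cP x e2.
  exists (maxn N1 N2) => n; rewrite geq_max => /andP[/h1 a1 /h2 a2].
  rewrite big_cons; lra.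
exists N => n Nn b Lb; rewrite -{1 2}(oproj_id dotE os Lb) /oproj linear_sum /= -sumrB.
apply: le_trans (in_sumN J _ _ _) _; apply: le_trans (ler_wpM2r (rnorm_ge0 b) (hN n Nn)).
rewrite mulr_suml big_seq [leRHS]big_seq; apply: ler_sum => x xs.
rewrite linearZ /= -scalerBr (inNZ J) mulrC ler_wpM2l ?rnorm_ge0 //.
apply: le_trans (dot_CS dotE _ _) _.
have [_ ds] := orthonormalP os.
have -> : rnorm x = 1; last by rewrite mulr1.
apply/eqP; rewrite -(@eqrXn2 _ 2) ?rnorm_ge0 // -(inN J) /ip (ds x x) // eqxx.
by rewrite expr1n.
Qed.

(** Split [<G u, Jt u>] at the projection of [Jt u]. As [u] is a trial vector, so is its multiple in
    [Jt u]; only the finite-rank part is missed by [P n], by a small amount uniform in [u], which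
    coercivity absorbs. The second term on the right is the price of replacing [u] by its component
    [x] off the kernel, which is no longer a trial vector. *)
Lemma galerkin_stability : exists e0 : seq H, [/\ orthonormal dot e0,
  forall x, x \in e0 -> exists2 l, spectrum opT l & T x = l *: x /\ gsym w l = 0,
  forall u, Gop w u = 0 -> lspan [set` e0] u &
  exists (C : R) (N : nat), 0 < C /\ forall n, (N <= n)%N -> forall u, Un n u ->
    rnorm (u - oproj dot e0 u) <=
      C * (rnorm (P n (Gop w u) - oproj dot e0 (P n (Gop w u))) +
           rnorm (oproj dot e0 u - P n (oproj dot e0 u)))].
Proof.
exists e0; split=> //.
- move=> x; rewrite mem_filter => /andP[/eqP g0 xe].
  by have [l sl hx] := he xe; exists l => //; rewrite -(gamE xe hx).
- by move=> u /ker_sub <-; exact: oproj_in.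
have [k' k'0 hk'] := coercive; have [G hG] := Gop_linear w; have [L hL] := Jt_linear.
pose CG := (K + rnorm w) ^+ 2; have CG0 : 0 <= CG by exact: sqr_ge0.
pose CJ := rnorm p + CG; have CJ0 : 0 <= CJ by rewrite addr_ge0 ?rnorm_ge0.
(* [CG] bounds [G(w)] and [CJ] bounds [Jt]; with this tolerance the projection error of the
   finite-rank part costs at most half of [k']. *)
have eta0 : 0 < k' / 2 / (CG * CJ + 1).
  by rewrite !divr_gt0 // ltr_wpDl // mulr_ge0.
have [N hN] := oproj_approx oe eta0.
exists (2 / k' * (CJ + CG * rnorm p) + 1), N; split.
  rewrite ltr_wpDl // mulr_ge0 ?divr_ge0 ?(ltW k'0) //.
  by rewrite addr_ge0 // mulr_ge0 ?rnorm_ge0.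
move=> n Nn u Uu; set x := u - _; set h := P n (Gop w u).
set rho := rnorm (_ - P n _); set a := rnorm (h - _).
have hx : Gop w u = Gop w x by rewrite -!hG linearB /= !hG Gop0 subr0.
have Jx : Jt u = Jt x by rewrite -!hL linearB /= !hL Jt0 subr0.
pose Kx := Jt x - p^* *: x.
have Pu := opr_id dotE (hP n) Uu.
have e1 : Jt u - P n (Jt u) =
    (Kx - P n Kx) - p^* *: (oproj dot e0 u - P n (oproj dot e0 u)).
  have e2 : Jt u - p^* *: u = Kx - p^* *: oproj dot e0 u.
    by rewrite Jx /Kx /x scalerBr opprB addrA addrAC addrK.
  have -> : Jt u - P n (Jt u) = (Jt u - p^* *: u) - P n (Jt u - p^* *: u).
    by rewrite [P n (Jt u - _)]linearB [P n (_ *: _)]linearZ /= Pu opprB addrA subrK.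
  rewrite e2 [P n (Kx - _)]linearB [P n (_ *: _)]linearZ /=.
  rewrite [_ *: (oproj _ _ _ - _)]scalerBr.
  move: (P n Kx) (p^* *: oproj _ _ _) (p^* *: P n _) => a2 a3 a4.
  by rewrite !opprD !opprK addrACA.
have KxE : Kx = Gop w (oproj dot e x) - p^* *: oproj dot e x.
  rewrite /Kx /Jt scalerBr.
  move: (p^* *: x) (p^* *: oproj _ _ _) (Gop w (oproj _ _ _)) => a1 a2 a3.
  by rewrite addrAC [a1 - a2]addrC addrK addrC.
have Kx_in : lspan [set` e] Kx.
  rewrite KxE; have sL := @lspan_subspace _ _ [set` e].
  apply: (subspaceB sL); last exact: (subspace_scale sL _ (oproj_in _ _ _)).
  exact: Gop_span.
have Kx_le : rnorm Kx <= CJ * rnorm x.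
  rewrite KxE; apply: le_trans (inNB_le J _ _) _; rewrite (inNZ J) rnormJ.
  rewrite addrC /CJ mulrDl lerD //.
    by rewrite ler_wpM2l ?rnorm_ge0 // oproj_le.
  by apply: le_trans (Gop_bound _ _) _; rewrite ler_wpM2l // oproj_le.
have X0 := rnorm_ge0 x; have a0 : 0 <= a := rnorm_ge0 _.
have rho_ge0 : 0 <= rho := rnorm_ge0 _.
have h1 : ip (Gop w u) (P n (Jt u)) <= a * (CJ * rnorm x).
  rewrite -(opr_sa dotE (hP n)) -/h.
  have -> : ip h (Jt u) = ip (h - oproj dot e0 h) (Jt u).
    rewrite (inBl J) (inC J (oproj _ _ _)) /ip.
    by rewrite (dot_lspan0 (Jt_orth0 u) (oproj_in dot e0 h)) subr0.
  apply: le_trans (in_le J _ _) _; rewrite ler_wpM2l ?rnorm_ge0 //.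
  exact: Jt_bound.
have h2 : rnorm (Jt u - P n (Jt u)) <= k' / 2 / (CG * CJ + 1) * (CJ * rnorm x) + rnorm p * rho.
  rewrite e1; apply: le_trans (inNB_le J _ _) _; rewrite (inNZ J) rnormJ lerD2r.
  apply: le_trans (hN n Nn _ Kx_in) _; rewrite ler_wpM2l // ltW //.
have h3 : rnorm (Gop w u) <= CG * rnorm x by rewrite hx; exact: Gop_bound.
have h4 : CG * (k' / 2 / (CG * CJ + 1) * CJ) <= k' / 2.
  have -> : CG * (k' / 2 / (CG * CJ + 1) * CJ) = (CG * CJ) / (CG * CJ + 1) * (k' / 2).
    by ring.
  have q0 : 0 < CG * CJ + 1 by rewrite ltr_wpDl // mulr_ge0.
  have k2 : 0 < k' / 2 by rewrite divr_gt0.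
  by rewrite ger_pMl // ler_pdivrMr // mul1r lerDl.
have h5 : ip (Gop w u) (Jt u - P n (Jt u)) <= CG * rnorm x *
    (k' / 2 / (CG * CJ + 1) * (CJ * rnorm x) + rnorm p * rho).
  apply: le_trans (in_le J _ _) _; apply: ler_pM => //; exact: rnorm_ge0.
have := hk' u; rewrite -/x -[X in ip _ X](subrK (P n (Jt u))) (inDr J) => h6.
set q := k' / 2 / (CG * CJ + 1) in h4 h5.
have h7 : k' * rnorm x ^+ 2 <= rnorm x * (k' / 2 * rnorm x + (CJ * a + CG * rnorm p * rho)).
  have := ler_wpM2r (mulr_ge0 X0 X0) h4; lra.
have p0 := rnorm_ge0 p.
have cc : 0 <= CJ * a + CG * rnorm p * rho.
  exact: (addr_ge0 (mulr_ge0 CJ0 a0) (mulr_ge0 (mulr_ge0 CG0 p0) rho_ge0)).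
have h8 : k' / 2 * rnorm x <= CJ * a + CG * rnorm p * rho.
  have [->|xn0] := eqVneq (rnorm x) 0; first by rewrite mulr0.
  have xp : 0 < rnorm x by rewrite lt_def xn0.
  move: h7; rewrite expr2 mulrCA ler_pM2l //; lra.
have h9 : rnorm x <= 2 / k' * (CJ * a + CG * rnorm p * rho).
  by rewrite -[2 / k' * _]mulrA mulrCA ler_pdivlMl //; lra.
apply: le_trans h9 _.
apply: (@le_trans _ _ (2 / k' * ((CJ + CG * rnorm p) * (a + rho)))).
  rewrite ler_wpM2l ?divr_ge0 ?(ltW k'0) //.
  by have := mulr_ge0 CJ0 rho_ge0; have := mulr_ge0 (mulr_ge0 CG0 p0) a0; lra.
by rewrite mulrA ler_wpM2r ?addr_ge0 // lerDl.
Qed.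

End Stability.
End Galerkin.

(** * Spectral subspaces in finite dimension *)

Section Factors.
Context {R : realType} {V : lmodType R[i]}.
Local Notation F := R[i].
Variable B : {linear V -> V}.
Implicit Types (rs : seq F) (u v w : V) (mu : F).

Definition fact rs u := foldr (fun mu v => B v - mu *: v) u rs.

Lemma fact_lin rs a u v : fact rs (a *: u + v) = a *: fact rs u + fact rs v.
Proof.
by elim: rs => //= mu rs ->; rewrite shiftD shiftZ.
Qed.

Lemma fact0 rs : fact rs 0 = 0.
Proof. by have := fact_lin rs (-1) 0 0; rewrite scaler0 addr0 scaleN1r addNr. Qed.

Lemma factD rs u v : fact rs (u + v) = fact rs u + fact rs v.
Proof. by have := fact_lin rs 1 u v; rewrite !scale1r. Qed.

Lemma factZ rs a u : fact rs (a *: u) = a *: fact rs u.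
Proof. by have := fact_lin rs a u 0; rewrite fact0 !addr0. Qed.

Lemma factB rs u v : fact rs (u - v) = fact rs u - fact rs v.
Proof. by rewrite -scaleN1r factD factZ scaleN1r. Qed.

Lemma fact_B rs u : fact rs (B u) = B (fact rs u).
Proof. by elim: rs => //= mu rs ->; rewrite -shift_comm. Qed.

Lemma fact_cons rs mu u : fact (mu :: rs) u = fact rs (B u - mu *: u).
Proof. by rewrite factB factZ fact_B. Qed.

Lemma fact_cat r s u : fact (r ++ s) u = fact r (fact s u).
Proof. by rewrite /fact foldr_cat. Qed.

Lemma fact_nseq k mu u : fact (nseq k mu) u = iter k (fun v => B v - mu *: v) u.
Proof. by elim: k => //= k ->. Qed.

Variable U : set V.
Hypothesis sU : Defs.subspace U.
Hypothesis UB : forall v, U v -> U (B v).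

Lemma sub_scale a u : U u -> U (a *: u).
Proof. by move=> Uu; have := proj2 sU a u 0 Uu (proj1 sU); rewrite addr0. Qed.

Lemma subD u v : U u -> U v -> U (u + v).
Proof. by move=> Uu Uv; have := proj2 sU 1 u v Uu Uv; rewrite scale1r. Qed.

Lemma subB u v : U u -> U v -> U (u - v).
Proof. by move=> Uu Uv; have := proj2 sU (-1) v u Uv Uu; rewrite scaleN1r addrC. Qed.

Lemma fact_in rs u : U u -> U (fact rs u).
Proof.
by move=> Uu; elim: rs => //= mu rs h; apply: subB; [exact: UB|exact: sub_scale].
Qed.

(** For one more factor [be]: if [w2] solves the equation with right side [(B - be) w], then
    [B - mu] maps [w - w2] to [(be - mu) w]. *)
Lemma fact_solve mu rs w : mu \notin rs -> U w -> fact rs w = 0 ->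
  exists w', [/\ U w', B w' - mu *: w' = w & fact rs w' = 0].
Proof.
elim: rs w => [|be rs IH] w /=.
  by move=> _ _ ->; exists 0; split; [exact: (proj1 sU)|rewrite linear0 scaler0 subr0|].
rewrite inE negb_or => /andP[mb mrs] Uw hw.
have mb0 : be - mu != 0 by rewrite subr_eq0 eq_sym.
have Uw1 : U (B w - be *: w) by apply: subB; [exact: UB|exact: sub_scale].
have [|w2 [U2 e2 f2]] := IH _ mrs Uw1; first by rewrite -fact_cons.
exists ((be - mu)^-1 *: (w - w2)); split.
- by apply: sub_scale; exact: subB.
- rewrite linearZ /= scalerA mulrC -scalerA -scalerBr.
  have -> : B (w - w2) - mu *: (w - w2) = (be - mu) *: w.
    rewrite shiftB e2 scalerBl opprB.
    by rewrite addrC addrA subrK.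
  by rewrite scalerA mulVf // scale1r.
- have f2' : fact (be :: rs) w2 = 0 by rewrite /= f2 linear0 scaler0 subr0.
  have hw' : fact (be :: rs) w = 0 by [].
  suff : fact (be :: rs) ((be - mu)^-1 *: (w - w2)) = 0 by [].
  by rewrite factZ factB hw' f2' subr0 scaler0.
Qed.

(** The decomposition for coprime factors, with [fact_solve] in place of a Bezout identity: [B - mu]
    is inverted on the summand whose factors do not include [mu]. *)
Lemma fact_split (p : pred F) rs u : U u -> fact rs u = 0 -> exists a b,
  [/\ U a, U b, u = a + b, fact (seq.filter p rs) a = 0 & fact (seq.filter (predC p) rs) b = 0].
Proof.
elim: rs u => [|mu rs IH] u Uu.
  by move=> /= ->; exists 0, 0; split; rewrite ?addr0 //; exact: (proj1 sU).
rewrite fact_cons => hu.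
have Uu1 : U (B u - mu *: u) by apply: subB; [exact: UB|exact: sub_scale].
have [a [b [Ua Ub eab fa fb]]] := IH _ Uu1 hu.
have [pm|pm] := boolP (p mu).
  have [|b' [Ub' eb' fb']] := fact_solve (mu := mu) _ Ub fb.
    by rewrite mem_filter /= pm.
  exists (u - b'), b'; split=> //=; rewrite ?subrK ?pm //=; first exact: subB.
  suff : fact (mu :: seq.filter p rs) (u - b') = 0 by [].
  rewrite fact_cons.
  by rewrite shiftB eb' eab addrK.
have [|a' [Ua' ea' fa']] := fact_solve (mu := mu) _ Ua fa.
  by rewrite mem_filter /= (negbTE pm).
exists a', (u - a'); split=> //=; rewrite ?(negbTE pm) //=; first exact: subB.
- by rewrite addrC subrK.
- suff : fact (mu :: seq.filter (predC p) rs) (u - a') = 0 by [].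
  rewrite fact_cons.
  by rewrite shiftB ea' eab addrC addKr.
Qed.

End Factors.

Section SpectralSubspace.
Context {R : realType} {V : lmodType R[i]}.
Variable B : {linear V -> V}.
Variable U : set V.
Hypothesis sU : Defs.subspace U.
Hypothesis UB : forall v, U v -> U (B v).
Implicit Types (rs : seq R[i]) (u v w : V) (mu : R[i]).
Local Notation fact := (fact B).

Definition spectral_sub (p : set R[i]) : set V :=
  lspan (\bigcup_(mu in p) [set v | U v /\ exists k, fact (nseq k mu) v = 0]).

Lemma spectral_sub_in p : spectral_sub p `<=` U.
Proof. by apply: lspan_min => // v [mu _ []]. Qed.

Lemma spectral_sub_subspace p : Defs.subspace (spectral_sub p).
Proof. exact: lspan_subspace. Qed.

Lemma fact_nseqD k1 k2 mu u v : fact (nseq k1 mu) u = 0 -> fact (nseq k2 mu) v = 0 ->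
  fact (nseq (k1 + k2) mu) (u + v) = 0.
Proof.
move=> h1 h2; by rewrite factD {1}addnC !nseqD !fact_cat h1 h2 !fact0 addr0.
Qed.

(** [B - mu] is onto on a generalized eigenspace for another eigenvalue; this lets
    [fact_spectral_sub] remove one factor at a time. *)
Lemma spectral_sub_split p mu u : p mu -> spectral_sub p u -> exists a b,
  [/\ U a, exists k, fact (nseq k mu) a = 0, spectral_sub p b &
      u = a + (B b - mu *: b)].
Proof.
move=> pmu; pose W : set V := [set u | exists a b,
  [/\ U a, exists k, fact (nseq k mu) a = 0, spectral_sub p b &
      u = a + (B b - mu *: b)]].
have sW : Defs.subspace W.
  split.
    exists 0, 0; split; [exact: (proj1 sU)|by exists 0%N| |].
      exact: (proj1 (spectral_sub_subspace _)).
    by rewrite linear0 scaler0 subr0 addr0.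
  move=> a u1 u2 [a1 [b1 [Ua1 [k1 f1] Mb1 ->]]] [a2 [b2 [Ua2 [k2 f2] Mb2 ->]]].
  exists (a *: a1 + a2), (a *: b1 + b2); split.
  - exact: (proj2 sU).
  - exists (k1 + k2)%N; apply: fact_nseqD => //; by rewrite factZ f1 scaler0.
  - exact: (proj2 (spectral_sub_subspace _)).
  - by rewrite scalerDr addrACA shiftD shiftZ.
move: u; apply: (lspan_min sW) => v [be pbe [Uv [k fk]]].
have [bm|bm] := eqVneq be mu; first rewrite bm in fk.
  exists v, 0; split=> //; [by exists k|exact: (proj1 (spectral_sub_subspace _))|].
  by rewrite linear0 scaler0 subr0 addr0.
have mk : mu \notin nseq k be by rewrite mem_nseq eq_sym (negbTE bm) andbF.
have [b [Ub eb fb]] := fact_solve sU UB mk Uv fk.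
exists 0, b; split; [exact: (proj1 sU)|by exists 0%N| |by rewrite add0r].
by apply: sub_lspan; exists be => //; split=> //; exists k.
Qed.

Lemma fact_spectral_sub (p : set R[i]) rs u : U u -> fact rs u = 0 ->
  (forall mu, mu \in rs -> p mu) -> spectral_sub p u.
Proof.
elim: rs u => [|mu rs IH] u Uu.
  by move=> /= -> _; exact: (proj1 (spectral_sub_subspace _)).
rewrite fact_cons => hu hp.
have pmu : p mu by apply: hp; rewrite inE eqxx.
have Uu1 : U (B u - mu *: u) by apply: (subB sU); [exact: UB|exact: sub_scale].
have [|a [b [Ua [k fk] Mb e]]] := spectral_sub_split pmu (IH _ Uu1 hu _).
  by move=> be bers; apply: hp; rewrite inE bers orbT.
rewrite -(subrK b u); apply: (subD (spectral_sub_subspace p)) => //.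
have Ub := spectral_sub_in Mb.
apply: sub_lspan; exists mu => //; split; first exact: (subB sU).
exists k.+1; suff : fact (mu :: nseq k mu) (u - b) = 0 by [].
by rewrite fact_cons shiftB e addrK.
Qed.

(** A factor without eigenvector in [U] is injective there and can be cancelled. *)
Lemma fact_clean (q : pred R[i]) rs u : U u -> fact rs u = 0 ->
  (forall mu v, ~~ q mu -> U v -> B v = mu *: v -> v = 0) ->
  fact (seq.filter q rs) u = 0.
Proof.
move=> Uu hu inj; elim: rs u Uu hu => //= mu rs IH u Uu hu.
have [qm|qm] := boolP (q mu).
  suff : fact (mu :: seq.filter q rs) u = 0 by [].
  rewrite fact_cons; apply: IH; last by rewrite -fact_cons.
  by apply: (subB sU); [exact: UB|exact: sub_scale].
apply: IH => //; apply: (inj mu) => //; first exact: (fact_in sU UB).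
by move/eqP: hu; rewrite subr_eq0 => /eqP.
Qed.

End SpectralSubspace.

Section Annihilator.
Context {R : realType} {V : lmodType R[i]}.
Variable B : {linear V -> V}.

Lemma lspan_seqP (s : seq V) v : lspan [set` s] v <->
  exists c : 'rV[R[i]]_(size s), v = \sum_i c 0 i *: s`_i.
Proof.
split=> [|[c ->]]; last first.
  apply: subspace_sum (@lspan_subspace _ _ _) _ => i; apply: sub_lspan => /=.
  exact: mem_nth.
pose W : set V := [set v | exists c : 'rV_(size s), v = \sum_i c 0 i *: s`_i].
apply: (@lspan_min _ _ [set` s] W _ _ v); last first.
  move=> x /= xs; exists (delta_mx 0 (Ordinal (etrans (index_mem x s) xs))).
  rewrite (bigD1 (Ordinal (etrans (index_mem x s) xs))) //= mxE !eqxx scale1r.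
  rewrite nth_index // big1 ?addr0 // => i ni.
  by rewrite mxE eqxx /= (negbTE ni) scale0r.
split.
  by exists 0; rewrite big1 // => i _; rewrite mxE scale0r.
move=> a _ _ [c1 ->] [c2 ->]; exists (a *: c1 + c2).
rewrite scaler_sumr -big_split; apply: eq_bigr => i _ /=.
by rewrite !mxE scalerDl scalerA.
Qed.

(** Cayley-Hamilton for a matrix of [B] on a spanning family. The family may be dependent and the
    matrix not unique, but only the relation [B (comb c) = comb (c *m M)] is used. *)
Lemma annihilator (U : set V) : finite_dim U -> (forall v, U v -> U (B v)) ->
  forall u, U u -> exists rs, fact B rs u = 0.
Proof.
move=> [s Us] UB u Uu; have {}Uu : lspan [set` s] u by rewrite -Us.
case: (posnP (size s)) => [s0|s0].
  exists [::] => /=; move/lspan_seqP: Uu => [c ->]; rewrite big1 // => -[i hi].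
  by exfalso; rewrite s0 in hi.
(* Square matrices of positive size form a nonzero ring, as [horner_mx] requires. *)
have [n en] : exists n, size s = n.+1 by exists (size s).-1; rewrite prednK.
pose x (i : 'I_n.+1) := s`_i.
pose comb (c : 'rV[R[i]]_n.+1) := \sum_i c 0 i *: x i.
have lsP v : lspan [set` s] v -> exists c, v = comb c.
  by move/lspan_seqP; rewrite en.
have ex i : exists c, B (x i) = comb c.
  apply: lsP; rewrite -Us; apply: UB; rewrite Us; apply: sub_lspan => /=.
  by rewrite mem_nth // en.
have [m hm] := choice ex.
pose M := \matrix_(i, j) (m i) 0 j.
have combM c : B (comb c) = comb (c *m M).
  rewrite /comb linear_sum /=.
  under eq_bigr => i _ do rewrite linearZ /= hm /comb scaler_sumr.
  rewrite exchange_big /=; apply: eq_bigr => j _.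
  rewrite mxE scaler_suml; apply: eq_bigr => i _.
  by rewrite !mxE scalerA.
have [rs hrs] := closed_field_poly_normal (char_poly M).
have [c ->] := lsP u Uu; exists rs.
have key r : fact B r (comb c) = comb (c *m horner_mx M (\prod_(z <- r) ('X - z%:P))).
  elim: r => [|z r IH]; first by rewrite big_nil rmorph1 mulmx1.
  rewrite big_cons mulrC rmorphM /= mulmxA IH combM rmorphB /= horner_mx_X horner_mx_C.
  rewrite mulmxBr mul_mx_scalar; set d := c *m _.
  rewrite /comb scaler_sumr -sumrB; apply: eq_bigr => i _.
  by rewrite !mxE scalerBl scalerA.
rewrite key.
have := Cayley_Hamilton M; rewrite hrs (monicP (char_poly_monic M)) scale1r => ->.
by rewrite mulmx0 /comb big1 // => i _; rewrite mxE scale0r.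
Qed.

End Annihilator.

Definition to0 {R : realType} (a : nat -> R) := forall e : R, 0 < e ->
  exists N, forall n, (N <= n)%N -> a n < e.

Lemma to0_contract {R : realType} (a b : nat -> R) (q : R) : 0 <= q < 1 ->
  (forall n, 0 <= a n) -> (forall n, a n.+1 <= q * a n + b n) -> to0 b -> to0 a.
Proof.
move=> /andP[q0 q1] a0 ab tb e e0.
have d0 : 0 < 1 - q by rewrite subr_gt0.
have [N hN] := tb _ (mulr_gt0 (divr_gt0 e0 (ltr0n R 2)) d0).
have h k : a (N + k)%N <= q ^+ k * a N + e / 2.
  elim: k => [|k IH]; first by rewrite addn0 expr0 mul1r lerDl divr_ge0 // ltW.
  rewrite addnS; apply: le_trans (ab _) _.
  have := hN _ (leq_addr k N); have := ler_wpM2l q0 IH; rewrite exprS; lra.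
have [K hK] : exists K, forall k, (K <= k)%N -> q ^+ k * a N < e / 2.
  have : (fun k => q ^+ k * a N) @ \oo --> (0 * a N : R).
    by apply: cvgMl; apply: cvg_expr; rewrite ger0_norm.
  rewrite mul0r => /cvgrPdist_lt/(_ _ (divr_gt0 e0 (ltr0n R 2)))[K _ hK].
  exists K => k /hK /=; rewrite sub0r normrN.
  exact: le_lt_trans (ler_norm _).
exists (N + K)%N => n Nn; rewrite -(subnKC (leq_trans (leq_addr K N) Nn)).
apply: le_lt_trans (h _) _.
have /hK : (K <= n - N)%N by rewrite leq_subRL // (leq_trans (leq_addr K N) Nn).
lra.
Qed.

(** Iterated square roots of [-1] give primitive roots of the orders [2 ^ j.+1]; that these are
    arbitrarily large is enough for the averages below. *)
Lemma primitive_root_exp2 {R : realType} j :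
  exists z : R[i], (2 ^ j.+1).-primitive_root z.
Proof.
have [z hz] : exists z : R[i], z ^+ (2 ^ j) = -1.
  elim: j => [|j [z hz]]; first by exists (-1); rewrite expn0 expr1.
  by exists (sqrtC z); rewrite expnS exprM sqrtCK.
have z1 : z ^+ (2 ^ j.+1) = 1 by rewrite expnS mulnC exprM hz sqrrN expr1n.
have [m pm] := prim_order_exists (expn_gt0 2 j.+1) z1.
move=> /(dvdn_pfactor _ _ (isT : prime 2))[i ij em]; subst m.
move: ij; rewrite leq_eqVlt => /orP[/eqP<-|ij]; first by exists z.
have := prim_expr_order pm => zi.
have : z ^+ (2 ^ j) = 1.
  by rewrite -(subnKC (ij : (i <= j)%N)) expnD exprM zi expr1n.
rewrite hz => /(congr1 (@complex.Re R)) /= h.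
by exfalso; move: h; clear; lra.
Qed.

Lemma sum_prim_root {F : fieldType} (k i : nat) (z : F) : k.-primitive_root z ->
  \sum_(l < k) z ^+ (l * i) = if (k %| i)%N then k%:R else 0.
Proof.
move=> pz; case: ifPn => ki.
  rewrite (eq_bigr (fun=> 1)) ?sumr_const ?card_ord // => l _.
  by rewrite mulnC exprM (eqP (_ : z ^+ i == 1)) ?expr1n // -(prim_order_dvd pz).
have zi : z ^+ i - 1 != 0 by rewrite subr_eq0 -(prim_order_dvd pz).
apply: (mulfI zi); rewrite mulr0.
transitivity ((z ^+ i) ^+ k - 1); last first.
  by rewrite -exprM mulnC exprM (prim_expr_order pz) expr1n subrr.
rewrite [RHS]subrX1; congr (_ * _); apply: eq_bigr => l _.
by rewrite -exprM mulnC.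
Qed.

(** * Spectral dichotomy at the unit circle *)

Section Dichotomy.
Context {R : realType} {V : lmodType R[i]}.
Variables (ip : V -> V -> R) (N : V -> R).
Hypothesis I : inner ip N.
Variable B : {linear V -> V}.
Variable U : set V.
Hypothesis sU : Defs.subspace U.
Hypothesis UB : forall v, U v -> U (B v).
Hypothesis fU : finite_dim U.
(** The operator is scaled so that the circle is the unit circle: [kap^-1] bounds the resolvent
    there, and no eigenvalue lies in the annulus up to [rho], so that [Mh] belongs to the
    eigenvalues in the open unit disc. *)
Variable kap : R.
Hypothesis kap0 : 0 < kap.
Hypothesis kapP : forall (z : R[i]) v, rnorm z = 1 -> U v ->
  kap * N v <= N (v - z *: B v).
Variable rho : R.
Hypothesis rho1 : 1 < rho.
Hypothesis annulus : forall mu v, 1 <= rnorm mu < rho -> U v -> B v = mu *: v -> v = 0.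
Implicit Types (rs : seq R[i]) (u v w : V) (mu z : R[i]).
Local Notation fact := (fact B).
Let Mh := spectral_sub B U [set mu | rnorm mu < rho].

(** Induction on the factors: [B^(k+1) v] is [be B^k v] plus [B^k] applied to [(B - be) v], which
    tends to 0 by induction, and [|be| < 1]. *)
Lemma iter_to0 rs v : (forall mu, mu \in rs -> rnorm mu < 1) -> fact rs v = 0 ->
  to0 (fun k => N (iter k B v)).
Proof.
elim: rs v => [|be rs IH] v hrs.
  move=> /= -> e e0; exists 0%N => k _.
  by have -> : iter k B 0 = 0; [elim: k => //= k ->; rewrite linear0|rewrite (inN0 I)].
rewrite fact_cons => /IH-/(_ (fun mu h => hrs mu (mem_behead (s := be :: rs) h))) h.
have b1 : 0 <= rnorm be < 1 by rewrite rnorm_ge0 hrs // inE eqxx.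
apply: (to0_contract b1 (fun k => inge0 I _) _ h) => k.
have -> : iter k.+1 B v = be *: iter k B v + iter k B (B v - be *: v).
  have iterB j u w a : iter j B (u - a *: w) = iter j B u - a *: iter j B w.
    by elim: j => //= j ->; rewrite [B (_ - _)]linearB [B (_ *: _)]linearZ.
  by rewrite iterB -iterSr addrC subrK.
by apply: le_trans (inND I _ _) _; rewrite (inNZ I).
Qed.

(** The same contraction for backward orbits, with ratio [1 / |be|]. *)
Lemma chain_to0 rs (y : nat -> V) : (forall mu, mu \in rs -> 1 < rnorm mu) ->
  (forall k, fact rs (y k) = 0) -> (forall k, B (y k.+1) = y k) -> to0 (fun k => N (y k)).
Proof.
elim: rs y => [|be rs IH] y hrs hy By.
  by move=> e e0; exists 0%N => k _; have /= -> := hy k; rewrite (inN0 I).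
pose x k := B (y k) - be *: y k.
have hx : to0 (fun k => N (x k)).
  apply: IH => [mu h|k|k]; first by apply: hrs; rewrite inE h orbT.
    by rewrite -fact_cons.
  by rewrite /x -(By k) shift_comm.
have b1 : 1 < rnorm be by apply: hrs; rewrite inE eqxx.
have b0 : 0 < rnorm be by exact: lt_trans b1.
have q : 0 <= (rnorm be)^-1 < 1 by rewrite invr_ge0 ltW //= invf_lt1.
have hx' : to0 (fun k => (rnorm be)^-1 * N (x k.+1)).
  move=> e e0; have [K hK] := hx e e0; exists K => k Kk.
  apply: le_lt_trans (hK k.+1 (leqW Kk)).
  by rewrite ler_piMl ?(inge0 I) //; case/andP: q => _ /ltW.
apply: (to0_contract q (fun k => inge0 I _) _ hx') => k.
rewrite -mulrDr ler_pdivlMl // -(inNZ I).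
have -> : be *: y k.+1 = y k - x k.+1 by rewrite /x By opprB addrC subrK.
exact: (inNB_le I).
Qed.

Lemma split_in_out u : U u -> exists a b ra rb,
  [/\ U a, U b, u = a + b, fact ra a = 0 /\ (forall mu, mu \in ra -> rnorm mu < 1) &
      fact rb b = 0 /\ (forall mu, mu \in rb -> 1 < rnorm mu)].
Proof.
move=> Uu; have [rs hrs] := annihilator fU UB Uu.
pose q mu := (rnorm mu < 1) || (rho <= rnorm mu).
have frs : fact (seq.filter q rs) u = 0.
  apply: (fact_clean sU UB Uu hrs) => mu v; rewrite negb_or -leNgt -ltNge.
  exact: annulus.
have [a [b [Ua Ub -> fa fb]]] := fact_split sU UB (fun mu => rnorm mu < 1) Uu frs.
exists a, b; do 2 eexists; split=> //; split; [exact: fa| |exact: fb|] => mu.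
  by rewrite mem_filter => /andP[].
rewrite !mem_filter /q /= => /and3P[/negbTE->/= h _].
exact: lt_le_trans rho1 h.
Qed.

Lemma Mh_of_fact a ra : U a -> fact ra a = 0 -> (forall mu, mu \in ra -> rnorm mu < 1) ->
  Mh a.
Proof.
move=> Ua fa hra; apply: (fact_spectral_sub sU UB Ua fa) => mu /hra h /=.
exact: lt_trans rho1.
Qed.

Lemma Mh_iter v : Mh v -> to0 (fun k => N (iter k B v)).
Proof.
move: v; apply: lspan_min => [|v [mu /= mu_rho [Uv [k fk]]]].
  have i0 k : iter k B 0 = 0 by elim: k => //= k ->; rewrite linear0.
  split; first by move=> e e0; exists 0%N => k _; rewrite i0 (inN0 I).
  move=> a u v hu hv e e0.
  have a0 : 0 < rnorm a + 1 by rewrite ltr_wpDl // rnorm_ge0.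
  have [N1 h1] := hu _ (divr_gt0 (divr_gt0 e0 (ltr0n R 2)) a0).
  have [N2 h2] := hv _ (divr_gt0 e0 (ltr0n R 2)).
  exists (maxn N1 N2) => n; rewrite geq_max => /andP[/h1 b1 /h2 b2].
  have -> : iter n B (a *: u + v) = a *: iter n B u + iter n B v.
    by elim: (n) => //= j ->; rewrite linearP.
  apply: le_lt_trans (inND I _ _) _; rewrite (inNZ I).
  rewrite ltr_pdivlMr // in b1; have := inge0 I (iter n B u); nra.
have [mu1|mu1] := ltP (rnorm mu) 1.
  apply: (iter_to0 (rs := nseq k mu)) => // be.
  by rewrite mem_nseq => /andP[_ /eqP->].
have v0 : fact [::] v = 0.
  elim: k fk => // k IH fk; apply: IH.
  apply: (annulus (mu := mu)); [by rewrite mu1|exact: (fact_in sU UB)|].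
  by move/eqP: fk; rewrite /= subr_eq0 => /eqP.
exact: (iter_to0 (rs := [::])).
Qed.

(* Inverting the discrete Fourier transform over the roots of unity recovers
   [B^i v] from the vectors [g_l = sum_(a < k) z^(l a) B^a v], which solve
   [(1 - z^l B) g_l = v - B^k v]. *)
Lemma Mh_power v i : Mh v -> N (iter i B v) <= kap^-1 * N v.
Proof.
move=> Mv; have Uv := spectral_sub_in sU Mv.
have Ui k : U (iter k B v) by elim: k => //= k; exact: UB.
rewrite -subr_le0; apply: (@le0_of_small _ _ kap^-1) => e /(Mh_iter Mv)[K hK].
(* [k] exceeds [i], so that the index [i] occurs in the sums, and [K], so that [B^k v] is
   negligible. *)
pose k := (2 ^ (maxn i K).+1)%N.
have k_gt : (maxn i K < k)%N by apply: leq_trans (ltn_expl _ (isT : 1 < 2)%N) _; rewrite leq_exp2l.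
have ik : (i < k)%N := leq_ltn_trans (leq_maxl _ _) k_gt.
have kK : (K <= k)%N := ltnW (leq_ltn_trans (leq_maxr _ _) k_gt).
have [z pz] := @primitive_root_exp2 R (maxn i K); rewrite -/k in pz.
have k0 : (0 < k)%N := prim_order_gt0 pz.
have z1 : rnorm z = 1.
  have := rnormX z k; rewrite (prim_expr_order pz) rnorm1 => /esym/eqP.
  by rewrite pexpr_eq1 ?rnorm_ge0 // => /eqP.
pose g l := \sum_(a < k) z ^+ (l * a) *: iter a B v.
have gE l : g l - z ^+ l *: B (g l) = v - iter k B v.
  have -> : z ^+ l *: B (g l) = \sum_(a < k) z ^+ (l * a.+1) *: iter a.+1 B v.
    rewrite /g linear_sum scaler_sumr; apply: eq_bigr => a _.
    by rewrite linearZ /= scalerA -exprD mulnS.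
  rewrite /g -sumrB -(big_mkord xpredT
    (fun a => z ^+ (l * a) *: iter a B v - z ^+ (l * a.+1) *: iter a.+1 B v)).
  rewrite (eq_bigr (fun a => - (z ^+ (l * a.+1) *: iter a.+1 B v - z ^+ (l * a) *: iter a B v))).
    rewrite sumrN telescope_sumr // opprB muln0 expr0 scale1r.
    by rewrite mulnC exprM (prim_expr_order pz) expr1n scale1r.
  by move=> a _; rewrite opprB.
have Ug l : U (g l) by apply: subspace_sum.
have ng l : N (g l) <= kap^-1 * N (v - iter k B v).
  rewrite ler_pdivlMl // -(gE l); apply: kapP => //.
  by rewrite rnormX z1 expr1n.
(* The exponent [l * (k - i)] stands for [- l * i] modulo [k]. *)
have gsum : \sum_(l < k) z ^+ (l * (k - i)) *: g l = k%:R *: iter i B v.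
  rewrite /g; under eq_bigr => l _ do rewrite scaler_sumr.
  rewrite exchange_big /= (bigD1 (Ordinal ik)) //= [X in _ + X]big1 ?addr0.
    under eq_bigr => l _ do rewrite scalerA -exprD -mulnDr subnK 1?ltnW //.
    by rewrite -scaler_suml sum_prim_root // dvdnn.
  move=> a ai; under eq_bigr => l _ do rewrite scalerA -exprD -mulnDr.
  rewrite -scaler_suml sum_prim_root // ifN ?scale0r //.
  apply: contraNN ai => /dvdnP[m hm]; apply/eqP/val_inj => /=.
  have aux (a' k' : nat) : (a' < k')%N -> (i < k')%N -> (k' - i + a' = m * k')%N -> a' = i.
    by clear; case: m => [|[|m]]; nia.
  exact: aux (ltn_ord a) ik hm.
have kR : rnorm (k%:R : R[i]) = k%:R.
  by rewrite -[k%:R](rmorph_nat (real_complex R)) rnormC normr_nat.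
have : k%:R * N (iter i B v) <= k%:R * (kap^-1 * N (v - iter k B v)).
  rewrite -{1}kR -(inNZ I) -gsum; apply: le_trans (in_sumN I _ _ _) _.
  rewrite -[X in X%:R]card_ord mulr_natl -sumr_const; apply: ler_sum => l _.
  by rewrite (inNZ I) rnormX z1 expr1n mul1r.
rewrite ler_pM2l ?ltr0n // => h; apply: le_trans (lerB h (lexx _)) _.
rewrite -mulrBr ler_pM2l ?invr_gt0 // lerBlDl.
by apply: le_trans (inNB_le I _ _) _; rewrite lerD2l ltW // hK.
Qed.

(** [B] is invertible on the kernel of the outer factors, and backward orbits tend to 0 there.
    Choosing preimages one at a time avoids constructing the inverse. *)
Lemma outer_chain b rs : U b -> fact rs b = 0 -> (forall mu, mu \in rs -> 1 < rnorm mu) ->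
  exists y : nat -> V, [/\ forall k, U (y k), forall k, iter k B (y k) = b,
    forall k, fact rs (y k) = 0 & to0 (fun k => N (y k))].
Proof.
move=> Ub fb hrs.
have rs0 : 0 \notin rs.
  by apply/negP => /hrs; rewrite rnorm0 ltNge ler01.
have ex w : exists w', U w -> fact rs w = 0 -> [/\ U w', B w' = w & fact rs w' = 0].
  have [[Uw fw]|h] := pselect (U w /\ fact rs w = 0); last by exists 0 => Uw fw; case: h.
  have [w' [Uw' ew' fw']] := fact_solve sU UB rs0 Uw fw.
  by exists w' => _ _; split=> //; rewrite -ew' scale0r subr0.
have [f hf] := choice ex.
pose y k := iter k f b.
have hy k : U (y k) /\ fact rs (y k) = 0.
  by elim: k => //= k [h1 h2]; have [] := hf _ h1 h2.
have By k : B (y k.+1) = y k by have [h1 h2] := hy k; have [] := hf _ h1 h2.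
exists y; split.
- by move=> k; case: (hy k).
- by elim=> // k IH; rewrite iterSr By.
- by move=> k; case: (hy k).
- by apply: (chain_to0 hrs) => // k; case: (hy k).
Qed.

(* [g_l] approximates [y + z^l B y], whose average over the roots of unity is
   [y]; the average of the components of [g_l] outside [Mh] tends to 0. *)
Lemma Mh_dist y tau : 0 < tau -> U y ->
  exists2 h, Mh h & N (y - h) <= kap^-1 * N (B (B y)) + tau.
Proof.
move=> tau0 Uy; have [a [b [ra [rb [Ua Ub ey [fa hra] [fb hrb]]]]]] := split_in_out Uy.
have sM : Defs.subspace Mh := @spectral_sub_subspace _ _ _ _ _.
have [c [Uc iterc fc c0]] := outer_chain Ub fb hrb.
have kk : 0 < kap^-1 + 1 by rewrite ltr_wpDl // invr_ge0 ltW.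
have [K hK] := c0 _ (divr_gt0 tau0 kk).
pose k := (2 ^ K.+1)%N.
have Kk : (K < k)%N by apply: leq_trans (ltn_expl _ (isT : 1 < 2)%N) _; rewrite leq_exp2l.
have [z pz] := @primitive_root_exp2 R K; rewrite -/k in pz.
(* With more than one root of unity their sum vanishes, so that the average of [y + z^l B y] is
   [y]. *)
have k2 : (1 < k)%N by rewrite -{1}(expn0 2) ltn_exp2l.
have k0 : (0 < k)%N := ltnW k2.
have z1 : rnorm z = 1.
  have := rnormX z k; rewrite (prim_expr_order pz) rnorm1 => /esym/eqP.
  by rewrite pexpr_eq1 ?rnorm_ge0 // => /eqP.
have zl1 l : rnorm (z ^+ l) = 1 by rewrite rnormX z1 expr1n.
have zl0 l : z ^+ l != 0.
  by apply/negP => /eqP h; have := zl1 l; rewrite h rnorm0 => /eqP; rewrite eq_sym oner_eq0.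
have solve l w s : U w -> fact s w = 0 -> (forall mu, mu \in s -> rnorm mu != 1) ->
    exists g, [/\ U g, g - z ^+ l *: B g = w & fact s g = 0].
  move=> Uw fw hs; have mus : (z ^+ l)^-1 \notin s.
    by apply/negP => /hs; rewrite rnormV zl1 invr1 eqxx.
  have [w' [Uw' ew' fw']] := fact_solve sU UB mus Uw fw.
  exists (- ((z ^+ l)^-1 *: w')); split.
  - by rewrite -scaleN1r; do 2 apply: (sub_scale sU).
  - have -> : z ^+ l *: B (- (z ^- l *: w')) = - B w'.
      by rewrite [B (- _)]linearN [B (_ *: _)]linearZ /= scalerN scalerA mulfV // scale1r.
    by rewrite opprK addrC.
  - by rewrite -scaleN1r !factZ fw' !scaler0.
have exg l : exists g, Mh g /\ g - z ^+ l *: B g = a.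
  have [|g [Ug eg fg]] := solve l a ra Ua fa.
    by move=> mu /hra h; rewrite lt_eqF.
  by exists g; split=> //; exact: Mh_of_fact fg hra.
have [g hg] := choice exg.
have exd l : exists d, U d /\ d - z ^+ l *: B d = c k.
  have [|d [Ud ed fd]] := solve l (c k) rb (Uc k) (fc k).
    by move=> mu /hrb h; rewrite gt_eqF.
  by exists d.
have [d hd] := choice exd.
have avg0 (w : nat -> V) (C : R) : (forall l, N (w l) <= C) ->
    N (k%:R^-1 *: \sum_(l < k) w l) <= C.
  move=> hw; rewrite (inNZ I) rnormV.
  have -> : rnorm (k%:R : R[i]) = k%:R.
    by rewrite -[k%:R](rmorph_nat (real_complex R)) rnormC normr_nat.
  rewrite ler_pdivrMl ?ltr0n //; apply: le_trans (in_sumN I _ _ _) _.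
  by rewrite -[X in X%:R]card_ord mulr_natl -sumr_const; apply: ler_sum.
have kn0 : (k%:R : R[i]) != 0 by rewrite pnatr_eq0 -lt0n.
have iterZ j (s : R[i]) w : iter j B (s *: w) = s *: iter j B w.
  by elim: j => //= j ->; rewrite linearZ.
have iterB m u w : iter m B (u - w) = iter m B u - iter m B w.
  by elim: m => //= m ->; rewrite linearB.
have iterS j u : iter j B (B u) = B (iter j B u) by rewrite -iterSr.
have Ui j u : U u -> U (iter j B u) by move=> Uu; elim: j => //= j; exact: UB.
(* [D l] solves the equation with right side [b] and need not be small. But [d l - D l] is a finite
   Fourier sum whose average over [l] is [c k], so the average of the [D l] is of the size of
   [c k]. *)
pose D l := iter k B (d l).
have hD l : D l - z ^+ l *: B (D l) = b.
  by rewrite -(iterc k) -(proj2 (hd l)) iterB iterZ iterS.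
have dD l : d l - D l = \sum_(j < k) z ^+ (l * j) *: iter j B (c k).
  have st j : z ^+ (l * j) *: iter j B (c k) =
      - (z ^+ (l * j.+1) *: iter j.+1 B (d l) - z ^+ (l * j) *: iter j B (d l)).
    rewrite -(proj2 (hd l)) iterB iterZ iterS scalerBr opprB scalerA; congr (_ - _ *: _).
    by rewrite mulnS exprD mulrC.
  under eq_bigr => j _ do rewrite st.
  rewrite sumrN -(big_mkord xpredT (fun j => z ^+ (l * j.+1) *: iter j.+1 B (d l) -
    z ^+ (l * j) *: iter j B (d l))) telescope_sumr // opprB muln0 expr0 scale1r.
  by rewrite mulnC exprM (prim_expr_order pz) expr1n scale1r.
have dDsum : \sum_(l < k) D l = \sum_(l < k) d l - k%:R *: c k.
  apply/eqP; rewrite eq_sym subr_eq addrC -subr_eq -sumrB; apply/eqP.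
  under eq_bigr => l _ do rewrite dD.
  rewrite exchange_big /= (bigD1 (Ordinal k0)) //= [X in _ + X]big1 ?addr0.
    under eq_bigr => l _ do rewrite muln0 expr0 scale1r.
    by rewrite sumr_const card_ord scaler_nat.
  move=> j j0; rewrite -scaler_suml sum_prim_root // ifN ?scale0r //.
  apply: contraNN j0 => /dvdn_leq h; apply/eqP/val_inj => /=; apply/eqP.
  by rewrite -leqn0 leqNgt; apply/negP => /h; rewrite leqNgt ltn_ord.
pose h := k%:R^-1 *: \sum_(l < k) g l.
pose W l := y + z ^+ l *: B y.
have zsum : \sum_(l < k) z ^+ l = 0.
  have := sum_prim_root 1 pz; rewrite ifN => [|]; last first.
    by rewrite dvdn1 neq_ltn k2 orbT.
  by under eq_bigr => l _ do rewrite muln1.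
have yW : y = k%:R^-1 *: \sum_(l < k) W l.
  rewrite big_split /= -scaler_suml zsum scale0r addr0 sumr_const card_ord.
  by rewrite -[y *+ k]scaler_nat scalerA mulVf // scale1r.
(* [1 - z^l B] maps [W l] to [y - z^(2l) B^2 y], [g l] to [a] and [D l] to [b]; as [y = a + b], only
   [B^2 y] is left. *)
have NW l : N (W l - g l - D l) <= kap^-1 * N (B (B y)).
  have Ug : U (g l) := spectral_sub_in sU (proj1 (hg l)).
  have UW : U (W l - g l - D l).
    apply: (subB sU); last exact: (Ui _ _ (proj1 (hd l))).
    apply: (subB sU) => //; apply: (subD sU) => //.
    by apply: (sub_scale sU); exact: UB.
  rewrite ler_pdivlMl //; apply: le_trans (kapP (zl1 l) UW) _.
  have -> : W l - g l - D l - z ^+ l *: B (W l - g l - D l) =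
      (W l - z ^+ l *: B (W l)) - (g l - z ^+ l *: B (g l)) - (D l - z ^+ l *: B (D l)).
    rewrite [B (_ - _)]linearB [B (_ - _)]linearB !scalerBr /=.
    have subrACA (p q s t : V) : (p - q) - (s - t) = (p - s) - (q - t).
      by rewrite !opprB addrACA [- q - s]addrC addrACA.
    by rewrite [in LHS]subrACA [W l - g l - _]subrACA.
  have -> : W l - z ^+ l *: B (W l) = y - (z ^+ l * z ^+ l) *: B (B y).
    rewrite /W [B (y + _)]linearD [B (_ *: _)]linearZ [z ^+ l *: (_ + _)]scalerDr scalerA /=.
    by rewrite opprD addrA addrK.
  rewrite hD (proj2 (hg l)) -addrA -opprD -ey addrAC subrr add0r -scaleNr (inNZ I).
  by rewrite {1}/rnorm normrN -/(rnorm _) rnormM zl1 !mul1r.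
exists h.
  by rewrite /h scaler_sumr; apply: (subspace_sum _ sM) => l; case: (hg l).
have -> : y - h = k%:R^-1 *: (\sum_(l < k) (W l - g l - D l)) + (k%:R^-1 *: \sum_(l < k) d l - c k).
  by rewrite !sumrB !scalerBr -yW -/h dDsum scalerBr scalerA mulVf // scale1r subrK.
apply: le_trans (inND I _ _) _; apply: lerD.
  by apply: (avg0 (fun l => W l - g l - D l)).
have dn : N (k%:R^-1 *: \sum_(l < k) d l) <= kap^-1 * N (c k).
  apply: (avg0 d) => l; rewrite ler_pdivlMl // -(proj2 (hd l)).
  by apply: kapP => //; case: (hd l).
apply: le_trans (inNB_le I _ _) _; apply: le_trans (lerD dn (lexx _)) _.
rewrite -[X in _ + X]mul1r -mulrDl mulrC -ler_pdivlMr //.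
by apply/ltW/hK/ltnW.
Qed.

End Dichotomy.

(** * The compressed quadratic pencil *)

Lemma rnormD {R : realType} (V : normedZmodType R[i]) (u v : V) :
  rnorm (u + v) <= rnorm u + rnorm v.
Proof. by rewrite -lecR rmorphD /= -!rnormE ler_normD. Qed.

(** Boundedness makes the supremum finite, and the supremum inherits the inequality. This closes
    estimates that pass from each power of an operator to the next. *)
Lemma half_contract {R : realType} (x : nat -> R) (b M : R) :
  (forall i, x i <= x i.+1 / 2 + b) -> (forall i, x i <= M) -> x 0%N <= 2 * b.
Proof.
move=> xb xM.
have hs : has_sup (range x) by split; [exists (x 0%N), 0%N|exists M => _ [i _ <-]].
have ub i : x i <= sup (range x) by apply: (ub_le_sup (proj2 hs)); exists i.
have : sup (range x) <= sup (range x) / 2 + b.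
  apply: ge_sup; first by exists (x 0%N), 0%N.
  by move=> _ [i _ <-]; apply: le_trans (xb i) _; have := ub i.+1; lra.
by have := ub 0%N; lra.
Qed.

Lemma half_le {R : realType} (x y z : R) : x <= y + z -> y <= x / 2 -> x <= 2 * z.
Proof. lra. Qed.

Lemma summand_le {R : realType} (a b c d : R) : 0 <= a -> 0 <= b -> 0 <= c -> 0 <= d ->
  [/\ a <= a + b + c + d, b <= a + b + c + d, c <= a + b + c + d & d <= a + b + c + d].
Proof. by move=> *; split; lra. Qed.

Section LinearOp.
Context {F : pzRingType} {V : lmodType F}.
Variable T : {linear V -> V}.
Implicit Types (a : F) (u v : V).

Lemma linD u v : T (u + v) = T u + T v. Proof. exact: linearD. Qed.
Lemma linN u : T (- u) = - T u. Proof. exact: linearN. Qed.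
Lemma linZ a u : T (a *: u) = a *: T u. Proof. exact: linearZ. Qed.
Definition linE := (linD, linN, linZ).

End LinearOp.

Section SpectralSubspaceMore.
Context {R : realType} {V : lmodType R[i]}.
Variable S : {linear V -> V}.
Variable U : set V.
Hypothesis sU : Defs.subspace U.
Hypothesis US : forall v, U v -> U (S v).
Implicit Types (u v : V) (mu : R[i]) (p : set R[i]).

Lemma spectral_sub_stable p v : spectral_sub S U p v -> spectral_sub S U p (S v).
Proof.
have sM : Defs.subspace (spectral_sub S U p) := @spectral_sub_subspace _ _ _ _ _.
apply: (@lspan_min _ _ _ [set v | spectral_sub S U p (S v)]) => [|x [mu hmu [Ux [k fk]]]].
  split=> [|b u w] /=; first by rewrite linear0; exact: (proj1 sM).
  by rewrite linearP; exact: (proj2 sM).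
apply: sub_lspan; exists mu => //; split; first exact: US.
by exists k; rewrite fact_B fk linear0.
Qed.

Lemma spectral_sub_eigenvector p h : spectral_sub S U p h -> h != 0 ->
  exists mu v, [/\ p mu, U v, v != 0 & S v = mu *: v].
Proof.
move=> Mh h0; apply: contrapT => no; move/negP: h0; apply; apply/eqP; move: Mh.
apply: (@lspan_min _ _ _ [set 0]) => [|x [mu /= hmu [Ux [k fk]]]].
  by split=> //= b u v -> ->; rewrite scaler0 addr0.
have v0 v : U v -> S v = mu *: v -> v = 0.
  by move=> Uv Sv; apply: contrapT => /eqP v0; apply: no; exists mu, v.
elim: k fk => // k IH /= fk; apply: IH.
apply: v0; last by apply/eqP; rewrite -subr_eq0 fk.
exact: (fact_in sU US).
Qed.

Lemma spectral_sub_rescale (B : {linear V -> V}) (c : R[i]) (s r : R) : 0 < s ->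
  (forall v, B v = (s%:C%C)^-1 *: (S v - c *: v)) ->
  spectral_sub S U [set mu | rnorm (mu - c) < r] =
  spectral_sub B U [set mu | rnorm mu < r / s].
Proof.
move=> s0 hB.
have ns : rnorm (s%:C%C : R[i]) = s by rewrite rnormC gtr0_norm.
have sC0 : s%:C%C != 0 :> R[i].
  by rewrite -(rmorph0 (real_complex R)) (inj_eq (@complexI R)) gt_eqF.
have B_shift mu v : B v - mu *: v = (s%:C%C)^-1 *: (S v - (c + s%:C%C * mu) *: v).
  rewrite hB scalerDl opprD addrA [RHS]scalerBr scalerA mulrA mulVf // mul1r.
  by rewrite scalerBr.
have iterE k mu v : fact B (nseq k mu) v =
    (s%:C%C)^-1 ^+ k *: fact S (nseq k (c + s%:C%C * mu)) v.
  elim: k => [|k IH]; first by rewrite scale1r.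
  transitivity (B (fact B (nseq k mu) v) - mu *: fact B (nseq k mu) v) => //.
  by rewrite B_shift IH shiftZ scalerA -exprS.
have sk0 k : (s%:C%C)^-1 ^+ k != 0 :> R[i] by rewrite expf_neq0 // invr_eq0.
congr lspan; apply/seteqP; split=> v [mu /= hmu [Uv [k fk]]].
  exists ((s%:C%C)^-1 * (mu - c)) => /=.
    by rewrite rnormM rnormV ns mulrC ltr_pM2r // invr_gt0.
  split=> //; exists k; rewrite iterE mulrA mulfV // mul1r addrC subrK fk.
  exact: scaler0.
exists (c + s%:C%C * mu) => /=.
  by rewrite addrC addKr rnormM ns mulrC -ltr_pdivlMr.
split=> //; exists k; move/eqP: fk; rewrite iterE scaler_eq0 (negbTE (sk0 k)) /=.
by move/eqP.
Qed.

End SpectralSubspaceMore.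

Section FinitePencil.
Context {R : realType} {H : completeNormedModType R[i]}.
Variable dot : {dot H for Num.conj}.
Hypothesis dotE : forall x : H, dot x x = `|x| ^+ 2.
Local Notation ip := (ip dot).
Let J := inner_ip dotE.
Let J2 := inner_ip2 dotE.
Variables (T Ts : {linear H -> H}) (K : R).
Hypothesis BN : bounded_normal dot T Ts K.
Local Notation Gop := (Gop T Ts).
Local Notation N2 := (@pair_norm R H).
Implicit Types (l w : R[i]) (u x y : H) (v : (H * H)%type).

Lemma dotl_eq u (v : H) : (forall x, dot u x = dot v x) -> u = v.
Proof.
move=> h; apply/eqP; rewrite -subr_eq0; apply/eqP; apply: rnorm_eq0.
by apply/eqP; rewrite -sqrf_eq0 -(inN J) /ip linearBl /= h subrr.
Qed.

Lemma dotDl x (u v : H) : dot (u + v) x = dot u x + dot v x. Proof. exact: linearDl. Qed.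
Lemma dotNl x u : dot (- u) x = - dot u x. Proof. exact: linearNl. Qed.
Let dotlE := (dotDl, dotNl, @dotZl R H dot).

Variables (U : set H) (P : {linear H -> H}).
Hypothesis hP : is_oproj dot U P.
Variable S : {linear (H * H)%type -> (H * H)%type}.
Hypothesis hS : forall v, S v = (P (T v.1 + Ts v.1) - P (T (Ts v.2)), v.1).
Let U2 : set (H * H) := [set v | U v.1 /\ U v.2].
Let sU := opr_sub hP.

Lemma sum_bound x : rnorm (T x + Ts x) <= 2 * K * rnorm x.
Proof.
apply: le_trans (inND J _ _) _; have := bn_T BN x; have := bn_Ts dotE BN x; lra.
Qed.

Lemma prod_bound x : rnorm (T (Ts x)) <= K ^+ 2 * rnorm x.
Proof.
apply: le_trans (bn_T BN _) _; rewrite expr2 -mulrA ler_wpM2l ?(bn_K0 BN) //.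
exact: (bn_Ts dotE BN).
Qed.

Lemma pencil_subspace : Defs.subspace U2.
Proof.
split; first by split; exact: (proj1 sU).
by move=> a u v [h1 h2] [h3 h4]; split; apply: (proj2 sU).
Qed.

Lemma pencil_stable v : U2 v -> U2 (S v).
Proof.
move=> [h1 h2]; rewrite hS; split=> //=.
by apply: (subB sU); exact: (opr_in hP).
Qed.

Lemma pencil_bound v : N2 (S v) <= (2 * K + K ^+ 2 + 1) * N2 v.
Proof.
apply: le_trans (pair_le _) _; rewrite hS /=.
have h := le_trans (inNB_le J _ _) (lerD (opr_le dotE hP (T v.1 + Ts v.1)) (opr_le dotE hP (T (Ts v.2)))).
have K0 := bn_K0 BN.
have := ler_wpM2l K0 (le_pair1 v); have := ler_wpM2l (sqr_ge0 K) (le_pair2 v).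
have := le_pair1 v; have := sum_bound v.1; have := prod_bound v.2; lra.
Qed.

(** [S] linearises the quadratic pencil: eliminating the first component from [(S - l) v = f]
    expresses [P (G(l) v.2)] by [f] alone. *)
Lemma pencil_id l v : U2 v -> let f := S v - l *: v in
  P (Gop l v.2) = P (T f.2 + Ts f.2) - l *: f.2 - f.1.
Proof.
move=> [U1 U2'] f.
have -> : f.1 = P (T v.1 + Ts v.1) - P (T (Ts v.2)) - l *: v.1 by rewrite /f hS.
have -> : f.2 = v.1 - l *: v.2 by rewrite /f hS.
have -> : Gop l v.2 = T (Ts v.2) - l *: (T v.2 + Ts v.2) + (l * l) *: v.2.
  transitivity (T (Ts v.2 - l *: v.2) - l *: (Ts v.2 - l *: v.2)) => //.
  rewrite !(linE T).
  by apply: dotl_eq => x; rewrite !dotlE; ring.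
have Pv := opr_id dotE hP U2'.
rewrite !(linE T) !(linE Ts) !(linE P) Pv; apply: dotl_eq => x; rewrite !dotlE; ring.
Qed.

(** The bound for the pencil controls [v.2], and [v.1 = f.2 + l v.2] follows along. *)
Lemma pencil_resolvent l (C M : R) : 0 <= C -> rnorm l <= M ->
  (forall u, U u -> rnorm u <= C * rnorm (P (Gop l u))) ->
  forall v, U2 v -> N2 v <= (1 + (M + 1) * (C * (2 * K + M + 1))) * N2 (S v - l *: v).
Proof.
move=> C0 lM hC v Uv; set f := S v - l *: v.
have M0 := le_trans (rnorm_ge0 l) lM; have K0 := bn_K0 BN.
have h2 : rnorm v.2 <= C * ((2 * K + M + 1) * N2 f).
  apply: le_trans (hC _ (proj2 Uv)) _; rewrite ler_wpM2l // (pencil_id l Uv) -/f.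
  apply: le_trans (inNB_le J _ _) _; rewrite !mulrDl; apply: lerD; last by rewrite mul1r le_pair1.
  apply: le_trans (inNB_le J _ _) _; apply: lerD.
    apply: le_trans (opr_le dotE hP _) _; apply: le_trans (sum_bound _) _.
    by have := ler_wpM2l K0 (le_pair2 f); lra.
  by rewrite (inNZ J) ler_pM ?rnorm_ge0 ?le_pair2.
have h1 : rnorm v.1 <= N2 f + M * rnorm v.2.
  have -> : v.1 = f.2 + l *: v.2 by rewrite /f hS /= subrK.
  apply: le_trans (inND J _ _) _; rewrite (inNZ J) lerD ?le_pair2 //.
  by rewrite ler_wpM2r ?rnorm_ge0.
apply: le_trans (pair_le _) _; apply: le_trans (lerD h1 (lexx _)) _.
have M10 : 0 <= M + 1 by lra.
have := ler_wpM2l M10 h2; lra.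
Qed.

Variables (c : R[i]) (e0 : seq H).
Hypothesis oe0 : orthonormal dot e0.
Hypothesis he0 : forall x, x \in e0 -> exists2 l, T x = l *: x & gsym c l = 0.
Local Notation Fc := (lspan [set` e0]).
Local Notation pr := (oproj dot e0).

Lemma eigen_or x : x \in e0 -> exists2 l, T x = l *: x & l = c \/ l = c^*.
Proof.
move=> /he0[l hx /eqP]; rewrite mulf_eq0 !subr_eq0 => /orP[]/eqP h; exists l => //.
  by left.
by right; rewrite -h conjCK.
Qed.

(** Every eigenvalue on the span of [e0] is [c] or its conjugate, and [T + Ts], like [T Ts], does
    not distinguish the two. *)
Lemma kernel_sum b : Fc b -> T b + Ts b = (c + c^*) *: b.
Proof.
apply: (@lspan_min _ _ _ [set b | T b + Ts b = (c + c^*) *: b]) => [|x /eigen_or[l hx lc] /=].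
  split=> [|a u v]; first by rewrite /= !linear0 addr0.
  move=> /= hu hv; rewrite !(linE T) !(linE Ts) addrACA -scalerDr hu hv.
  by rewrite scalerDr !scalerA mulrC.
rewrite hx (eigen_adj dotE BN hx) -scalerDl; case: lc => ->; rewrite ?conjCK //.
by rewrite addrC.
Qed.

Lemma kernel_prod b : Fc b -> T (Ts b) = (c * c^*) *: b.
Proof.
apply: (@lspan_min _ _ _ [set b | T (Ts b) = (c * c^*) *: b]) => [|x /eigen_or[l hx lc] /=].
  split=> [|a u v]; first by rewrite /= !linear0.
  move=> /= hu hv; rewrite !(linE Ts) !(linE T) hu hv.
  by rewrite scalerDr !scalerA mulrC.
rewrite (eigen_adj dotE BN hx) (linE T) hx scalerA; case: lc => ->; rewrite ?conjCK //.
by rewrite mulrC.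
Qed.

Lemma kernel_dot mu u b : Fc b -> dot (Gop mu u) b = gsym mu c * dot u b.
Proof.
apply: (@lspan_min _ _ _ [set b | dot (Gop mu u) b = gsym mu c * dot u b]) => [|x /eigen_or[l hx lc] /=].
  split=> [|a x y] /=; first by rewrite ?linear0r ?mulr0.
  by rewrite !linearDr /= !dotZr => -> ->; ring.
rewrite (Gop_dot dotE BN _ _ hx) /gsym; case: lc => ->; rewrite ?conjCK //.
by rewrite [(c^* - _) * _]mulrC.
Qed.

Local Notation qn x := (rnorm (x - pr x)).

Let prL : exists L : {linear H -> H}, forall x, L x = pr x.
Proof. by apply: linear_exists => a u x; exact: oproj_linear. Qed.

Lemma qnD x y : qn (x + y) <= qn x + qn y.
Proof.
have [L hL] := prL; rewrite -!hL (linE L).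
have -> : x + y - (L x + L y) = (x - L x) + (y - L y) by rewrite opprD addrACA.
exact: (inND J).
Qed.

Lemma qnZ a x : qn (a *: x) = rnorm a * qn x.
Proof. by have [L hL] := prL; rewrite -!hL (linE L) -scalerBr (inNZ J). Qed.

Lemma qnB x y : qn (x - y) <= qn x + qn y.
Proof.
rewrite -[- y]scaleN1r; apply: le_trans (qnD _ _) _; rewrite qnZ.
by rewrite -realCN1 rnormC normrN1 mul1r.
Qed.

Lemma qn_proj b : Fc b -> qn (P b) <= rnorm (b - P b).
Proof.
move=> Fb; have [L hL] := prL.
have -> : P b - pr (P b) = (P b - b) - pr (P b - b).
  rewrite -!hL !(linE L) !hL (oproj_id dotE oe0 Fb); apply: dotl_eq => x.
  by rewrite !dotlE; ring.
by apply: le_trans (oprojC_le dotE _ oe0) _; rewrite (inNB J).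
Qed.

Variable eta : R.
Hypothesis eta0 : 0 <= eta.
Hypothesis heta : forall b, Fc b -> rnorm (b - P b) <= eta * rnorm b.
Definition qn2 v := N2 (v.1 - pr v.1, v.2 - pr v.2).
Let a := rnorm c.

Lemma qn2_1 v : qn v.1 <= qn2 v. Proof. exact: (le_pair1 (_, _)). Qed.
Lemma qn2_2 v : qn v.2 <= qn2 v. Proof. exact: (le_pair2 (_, _)). Qed.

Lemma heta' x : rnorm (pr x - P (pr x)) <= eta * rnorm x.
Proof.
apply: le_trans (heta (oproj_in _ _ _)) _; rewrite ler_wpM2l //; exact: oproj_le.
Qed.

Lemma qn_sum x : qn (P (T x + Ts x)) <= 2 * K * qn x + 2 * a * (eta * rnorm x).
Proof.
have -> : P (T x + Ts x) = P (T (x - pr x) + Ts (x - pr x)) + (c + c^*) *: P (pr x).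
  rewrite -(linE P) -(kernel_sum (oproj_in _ _ _)) -(linE P) addrACA.
  by rewrite -(linE T) -(linE Ts) subrK.
apply: le_trans (qnD _ _) _; apply: lerD.
  apply: le_trans (oprojC_le dotE _ oe0) _; apply: le_trans (opr_le dotE hP _) _.
  exact: sum_bound.
rewrite qnZ; apply: ler_pM; rewrite ?rnorm_ge0 //.
  by apply: le_trans (rnormD _ _) _; rewrite rnormJ -/a; lra.
apply: le_trans (qn_proj (oproj_in _ _ _)) _; exact: heta'.
Qed.

(* The second component of [(S - c)(S - c^* ) v]; it vanishes in the limit
   because [c] and [c^*] are the only eigenvalues on the kernel of [Gop c]. *)
Definition quad_defect v := (S v).1 - (c + c^*) *: v.1 + (c * c^*) *: v.2.
Definition defectC := 2 * K + K ^+ 2 + 2 * a + a ^+ 2.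

Let CE0 : 0 <= defectC.
Proof. by rewrite /defectC !addr_ge0 ?mulr_ge0 ?sqr_ge0 ?(bn_K0 BN) ?rnorm_ge0. Qed.

Lemma qn2_ge0 v : 0 <= qn2 v. Proof. exact: sqrtr_ge0. Qed.

(** On pairs of kernel vectors the defect would be 0 without the projection; what remains is the
    part of [v] off the kernel and the error of projecting kernel vectors. *)
Lemma quad_defect_le v : rnorm (quad_defect v) <= defectC * (qn2 v + eta * N2 v).
Proof.
have -> : quad_defect v = P (T (v.1 - pr v.1) + Ts (v.1 - pr v.1)) - P (T (Ts (v.2 - pr v.2)))
   + (c + c^*) *: (P (pr v.1) - v.1) - (c * c^*) *: (P (pr v.2) - v.2).
  have h1 := kernel_sum (oproj_in dot e0 v.1).
  have h2 := kernel_prod (oproj_in dot e0 v.2).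
  rewrite /quad_defect hS /= !(linE T) !(linE Ts) !(linE T) h2.
  have -> : T v.1 + - T (pr v.1) + (Ts v.1 + - Ts (pr v.1)) =
     (T v.1 + Ts v.1) - (c + c^*) *: pr v.1 by rewrite -h1 addrACA opprD.
  by rewrite !(linE P); apply: dotl_eq => x; rewrite !dotlE; ring.
have hd x : rnorm (P (pr x) - x) <= qn x + eta * rnorm x.
  have -> : P (pr x) - x = - (x - pr x) - (pr x - P (pr x)).
    by apply: dotl_eq => y; rewrite !dotlE; ring.
  by apply: le_trans (inNB_le J _ _) _; rewrite (inNN J) lerD2l heta'.
have K0 := bn_K0 BN; have a0 : 0 <= a := rnorm_ge0 c.
set m := qn2 v + eta * N2 v.
have m1 : qn v.1 + eta * rnorm v.1 <= m.
  by rewrite lerD ?qn2_1 // ler_wpM2l ?le_pair1.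
have m2 : qn v.2 + eta * rnorm v.2 <= m.
  by rewrite lerD ?qn2_2 // ler_wpM2l ?le_pair2.
have q1 : qn v.1 <= m by apply: le_trans m1; rewrite lerDl mulr_ge0 ?rnorm_ge0.
have q2 : qn v.2 <= m by apply: le_trans m2; rewrite lerDl mulr_ge0 ?rnorm_ge0.
apply: le_trans (inNB_le J _ _) _; rewrite [leRHS]mulrDl; apply: lerD; last first.
  rewrite (inNZ J) rnormM rnormJ -expr2 ler_wpM2l ?sqr_ge0 //.
  exact: le_trans (hd _) m2.
apply: le_trans (inND J _ _) _; rewrite [leRHS]mulrDl; apply: lerD; last first.
  rewrite (inNZ J); apply: ler_pM; rewrite ?rnorm_ge0 //.
    by apply: le_trans (rnormD _ _) _; rewrite rnormJ -/a; lra.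
  exact: le_trans (hd _) m1.
apply: le_trans (inNB_le J _ _) _; rewrite [leRHS]mulrDl; apply: lerD.
  apply: le_trans (opr_le dotE hP _) _; apply: le_trans (sum_bound _) _.
  by rewrite ler_wpM2l ?mulr_ge0.
apply: le_trans (opr_le dotE hP _) _; apply: le_trans (prod_bound _) _.
by rewrite ler_wpM2l ?sqr_ge0.
Qed.

Lemma qn2_le v : qn2 v <= N2 v.
Proof.
rewrite -(@ler_pXn2r _ 2) ?nnegrE ?sqrtr_ge0 // !sqr_pair_norm /=.
by apply: lerD; rewrite ler_pXn2r ?nnegrE ?rnorm_ge0 ?(oprojC_le dotE).
Qed.

Lemma qn2_S v : qn2 (S v) <= (defectC + 2 * a + a ^+ 2 + 1) * (qn2 v + eta * N2 v).
Proof.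
have a0 : 0 <= a := rnorm_ge0 c.
set m := qn2 v + eta * N2 v.
have qm : qn2 v <= m by rewrite lerDl mulr_ge0 ?sqrtr_ge0.
have m0 : 0 <= m := le_trans (qn2_ge0 _) qm.
have e1 : (S v).1 = quad_defect v + (c + c^*) *: v.1 - (c * c^*) *: v.2.
  by rewrite /quad_defect; apply: dotl_eq => y; rewrite !dotlE; ring.
apply: le_trans (pair_le _) _ => /=.
have e2 : (S v).2 = v.1 by rewrite hS.
rewrite e2 [leRHS]mulrDl; apply: lerD; last by rewrite mul1r (le_trans (qn2_1 _)).
rewrite e1; apply: le_trans (qnB _ _) _; rewrite [leRHS]mulrDl; apply: lerD.
  apply: le_trans (qnD _ _) _; rewrite [leRHS]mulrDl; apply: lerD.
    exact: le_trans (oprojC_le dotE _ oe0) (quad_defect_le v).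
  rewrite qnZ; apply: ler_pM; rewrite ?rnorm_ge0 //.
    by apply: le_trans (rnormD _ _) _; rewrite rnormJ -/a; lra.
  exact: le_trans (qn2_1 _) qm.
rewrite qnZ rnormM rnormJ -expr2 ler_wpM2l ?sqr_ge0 //.
exact: le_trans (qn2_2 _) qm.
Qed.

Variable C0 : R.
Hypothesis C00 : 0 <= C0.
Hypothesis hC0 : forall u, U u -> qn u <= C0 * (qn (P (Gop c u)) + rnorm (pr u - P (pr u))).
Definition pencilC := 2 * K + K ^+ 2 + 1.
Definition shiftC := 1 + (a + 1) * C0 * (2 * K + a + 2 + 2 * a * (pencilC + a)).

(** The stability estimate at [c], carried over to [S] by [pencil_id]. Nothing is claimed along the
    kernel, so the distance to it appears on both sides. *)
Lemma qn2_shift v : U2 v -> qn2 v <= shiftC * (qn2 (S v - c *: v) + eta * N2 v).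
Proof.
move=> Uv; set f := S v - c *: v.
have a0 : 0 <= a := rnorm_ge0 c; have K0 := bn_K0 BN.
have CS0 : 0 <= pencilC by rewrite /pencilC !addr_ge0 ?mulr_ge0 ?sqr_ge0.
have Nf : N2 f <= (pencilC + a) * N2 v.
  apply: le_trans (inNB_le J2 _ _) _; rewrite mulrDl (inNZ J2) lerD2r.
  exact: pencil_bound.
set q := qn2 f; set m := eta * N2 v.
have q0 : 0 <= q := qn2_ge0 _; have m0 : 0 <= m by rewrite mulr_ge0 ?sqrtr_ge0.
have h : qn (P (Gop c v.2)) <= (2 * K + a + 1) * q + 2 * a * (pencilC + a) * m.
  rewrite (pencil_id c Uv) -/f.
  have := le_trans (qnB _ _) (lerD (qnB (P (T f.2 + Ts f.2)) (c *: f.2)) (lexx (qn f.1))).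
  move/le_trans; apply; rewrite qnZ -/a.
  have h1 := qn_sum f.2; have h2 := qn2_1 f; have h3 := qn2_2 f.
  have h4 : 2 * a * (eta * rnorm f.2) <= 2 * a * (pencilC + a) * m.
    rewrite -[leRHS]mulrA ler_wpM2l ?mulr_ge0 // /m mulrCA ler_wpM2l //.
    exact: le_trans (le_pair2 _) Nf.
  have := ler_wpM2l K0 h3; have := ler_wpM2l a0 h3; rewrite -/q in h2 h3 *; lra.
have qv2 : qn v.2 <= C0 * ((2 * K + a + 1) * q + 2 * a * (pencilC + a) * m + m).
  apply: le_trans (hC0 (proj2 Uv)) _; rewrite ler_wpM2l // lerD //.
  by apply: le_trans (heta' _) _; rewrite ler_wpM2l // le_pair2.
have qv1 : qn v.1 <= q + a * qn v.2.
  have -> : v.1 = f.2 + c *: v.2 by rewrite /f hS /= subrK.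
  by apply: le_trans (qnD _ _) _; rewrite qnZ lerD2r qn2_2.
apply: le_trans (pair_le _) _ => /=.
have h6 : C0 * ((2 * K + a + 1) * q + 2 * a * (pencilC + a) * m + m) <=
    C0 * (2 * K + a + 2 + 2 * a * (pencilC + a)) * (q + m).
  rewrite -[leRHS]mulrA ler_wpM2l // mulrDr.
  have x0 : 0 <= a * (pencilC + a) by exact: mulr_ge0 a0 (addr_ge0 CS0 a0).
  have := mulr_ge0 x0 q0; have := mulr_ge0 K0 m0; have := mulr_ge0 a0 m0; lra.
have a1 : 0 <= a + 1 by lra.
have := ler_wpM2l a1 (le_trans qv2 h6); rewrite /shiftC; lra.
Qed.

(** [s] is a radius so small that [qn2_shift] contracts, and [Kr] bounds the resolvent of [S]
    between the radii [s] and [r]; hence the eigenvalues within [r] of [c] are those within [s]. *)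
Variables (s r Kr : R).
Hypothesis s0 : 0 < s.
Hypothesis sr : s < r.
Hypothesis sC1 : shiftC * s <= 1 / 2.
Hypothesis Kr0 : 0 < Kr.
Hypothesis hres : forall l, s <= rnorm (l - c) <= r ->
  forall v, U2 v -> N2 v <= Kr * N2 (S v - l *: v).
Hypothesis fU : finite_dim U2.
Let Mhat := spectral_sub S U2 [set mu | rnorm (mu - c) < r].
Variable B : {linear (H * H)%type -> (H * H)%type}.
Hypothesis hB : forall v, B v = (s%:C%C)^-1 *: (S v - c *: v).
Let sC0 : s%:C%C != 0 :> R[i].
Proof. by rewrite -(rmorph0 (real_complex R)) (inj_eq (@complexI R)) gt_eqF. Qed.
Let ns : rnorm (s%:C%C : R[i]) = s. Proof. by rewrite rnormC gtr0_norm. Qed.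

Let UB v : U2 v -> U2 (B v).
Proof.
move=> Uv; rewrite hB; apply: (sub_scale pencil_subspace).
by apply: (subB pencil_subspace); [exact: pencil_stable|exact: (sub_scale pencil_subspace)].
Qed.

Let B_shift mu v : B v - mu *: v = (s%:C%C)^-1 *: (S v - (c + s%:C%C * mu) *: v).
Proof.
rewrite hB scalerDl opprD addrA [RHS]scalerBr scalerA mulrA mulVf // mul1r.
by rewrite scalerBr.
Qed.

Lemma spectral_sub_scale : Mhat = spectral_sub B U2 [set mu | rnorm mu < r / s].
Proof. exact: spectral_sub_rescale s0 hB. Qed.

(** With [B = (S - c) / s] and [|z| = 1], [1 - z B] is [- z / s] times [S - l] for [l = c + s / z],
    a point of the circle of radius [s]. *)
Let kap := (s * Kr)^-1.
Let kap0 : 0 < kap. Proof. by rewrite invr_gt0 mulr_gt0. Qed.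
Let kapP (z : R[i]) v : rnorm z = 1 -> U2 v -> kap * N2 v <= N2 (v - z *: B v).
Proof.
move=> z1 Uv; have z0 : z != 0.
  by apply/eqP => zz; move: z1; rewrite zz rnorm0 => /eqP; rewrite eq_sym oner_eq0.
have -> : v - z *: B v = (- z * (s%:C%C)^-1) *: (S v - (c + s%:C%C / z) *: v).
  rewrite -scalerA -B_shift scalerBr !scaleNr scalerA mulfV // scale1r opprK addrC.
  by [].
rewrite (inNZ J2) mulNr -[- (_ * _)]mulN1r rnormM -realCN1 rnormC normrN1 mul1r.
rewrite rnormM rnormV z1 mul1r ns /kap invfM -mulrA ler_pM2l ?invr_gt0 //.
rewrite ler_pdivrMl //; apply: hres => //.
by rewrite addrC addKr rnormM rnormV z1 invr1 mulr1 ns lexx ltW.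
Qed.

Let rho1 : 1 < r / s. Proof. by rewrite ltr_pdivlMr // mul1r. Qed.

Let annulus (mu : R[i]) v : 1 <= rnorm mu < r / s -> U2 v -> B v = mu *: v -> v = 0.
Proof.
move=> /andP[m1 m2] Uv /eqP; rewrite -subr_eq0 B_shift scaler_eq0 invr_eq0 (negbTE sC0) /=.
move=> /eqP e; apply: (ineq0 J2); apply/eqP; rewrite eq_le (inge0 J2) andbT.
have -> : 0 = Kr * N2 (S v - (c + s%:C%C * mu) *: v) by rewrite e (inN0 J2) mulr0.
apply: hres => //; rewrite addrC addKr rnormM ns ler_pMr // m1 /=.
by rewrite mulrC -ler_pdivlMr // ltW.
Qed.

Lemma Mhat_in v : Mhat v -> U2 v.
Proof. exact: (spectral_sub_in pencil_subspace). Qed.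

Lemma Mhat_S v : Mhat v -> Mhat (S v).
Proof. exact: spectral_sub_stable pencil_stable _ _. Qed.

Lemma Mhat_B v : Mhat v -> Mhat (B v).
Proof.
have sM : Defs.subspace Mhat := @spectral_sub_subspace _ _ _ _ _.
move=> Mv; rewrite hB; apply: (sub_scale sM); apply: (subB sM); first exact: Mhat_S.
exact: (sub_scale sM).
Qed.

Lemma Mhat_iter_B k v : Mhat v -> Mhat (iter k B v).
Proof. by move=> Mv; elim: k => //= k; exact: Mhat_B. Qed.

Lemma Mhat_iter_le k v : Mhat v -> N2 (iter k B v) <= s * Kr * N2 v.
Proof.
rewrite spectral_sub_scale => Mv; rewrite -[s * Kr]invrK -/kap.
exact: (Mh_power J2 pencil_subspace UB kap0 kapP annulus k Mv).
Qed.

Lemma Mhat_dist (y : (H * H)%type) tau : 0 < tau -> U2 y ->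
  exists2 h, Mhat h & N2 (y - h) <= s * Kr * N2 (B (B y)) + tau.
Proof.
move=> tau0 Uy; rewrite spectral_sub_scale -[s * Kr]invrK -/kap.
exact: (Mh_dist J2 pencil_subspace UB fU kap0 kapP rho1 annulus tau0 Uy).
Qed.

Definition spectralC := 2 * (shiftC * (s * Kr)).

Lemma qn2Z b v : qn2 (b *: v) = rnorm b * qn2 v.
Proof.
have [L hL] := prL; rewrite -(inNZ J2) /qn2 -!hL; congr (N2 (_, _)).
  by rewrite (linE L) -scalerBr.
by rewrite (linE L) -scalerBr.
Qed.

Let C1_ge0 : 0 <= shiftC.
Proof.
have a0 : 0 <= a := rnorm_ge0 c; have K0 := bn_K0 BN.
have CS0 : 0 <= pencilC by rewrite /pencilC; have := sqr_ge0 K; lra.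
have x0 := mulr_ge0 a0 (addr_ge0 CS0 a0).
have x1 : 0 <= (a + 1) * C0 by rewrite mulr_ge0 // addr_ge0.
have x2 : 0 <= 2 * K + a + 2 + 2 * a * (pencilC + a) by lra.
by rewrite /shiftC; have := mulr_ge0 x1 x2; lra.
Qed.

Let sKr0 : 0 < s * Kr. Proof. exact: mulr_gt0. Qed.

(** [qn2_shift] at [B^i v] bounds its distance to the kernel by half of that of [B^(i+1) v] plus a
    multiple of [eta]; as the powers of [B] are uniformly bounded on [Mhat], [half_contract]
    applies. *)
Lemma Mhat_qn2 v : Mhat v -> qn2 v <= spectralC * (eta * N2 v).
Proof.
move=> Mv; have C10 := C1_ge0; rewrite /spectralC -[leRHS]mulrA.
have m0 : 0 <= eta * N2 v by rewrite mulr_ge0 ?(inge0 J2).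
apply: (@half_contract _ (fun i => qn2 (iter i B v)) _
  (s * Kr * N2 v)) => i; last first.
  apply: le_trans (qn2_le _) _; exact: (Mhat_iter_le i Mv).
have Mi := Mhat_iter_B i Mv.
have := qn2_shift (Mhat_in Mi).
have -> : S (iter i B v) - c *: iter i B v = s%:C%C *: iter i.+1 B v.
  by rewrite iterS hB scalerA mulfV // scale1r.
rewrite qn2Z ns => h; apply: le_trans h _; rewrite mulrDr; apply: lerD.
  have := ler_wpM2r (qn2_ge0 (iter i.+1 B v)) sC1; lra.
rewrite -mulrA ler_wpM2l //.
have := ler_wpM2l eta0 (Mhat_iter_le i Mv); lra.
Qed.

Lemma quad_defect_shift (y : (H * H)%type) :
  S (S y - c *: y) - c^* *: (S y - c *: y) = (quad_defect (S y), quad_defect y).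
Proof.
have -> : S (S y - c *: y) - c^* *: (S y - c *: y) =
   S (S y) - (c + c^*) *: S y + (c * c^*) *: y.
  rewrite linearB linearZ /= scalerBr scalerA scalerDl [c^* * c]mulrC.
  by rewrite !opprD !opprK !addrA.
by rewrite /quad_defect; congr (_, _) => /=; rewrite ![in (S _).2]hS.
Qed.

Let CS_ge0 : 0 <= pencilC.
Proof. by rewrite /pencilC; have := sqr_ge0 K; have := bn_K0 BN; lra. Qed.
Let Cq_ge0 : 0 <= spectralC.
Proof. by apply: mulr_ge0 => //; exact: mulr_ge0 C1_ge0 (ltW sKr0). Qed.

Let CT := defectC + 2 * a + a ^+ 2 + 1.
Let CX := defectC * (2 * CT + pencilC + 2) + 2 * defectC * (pencilC + a).
Definition nearC := 1 + s * Kr * ((s^-1 ^+ 2) * CX).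

(** By [Mhat_dist] it is enough that [(S - c)^2] is small at the projection [y] of [x]. For real [c]
    it is given by the quadratic defects; otherwise [y.1 = c y.2] makes [(S - c) y] small already.
    The alternative in the hypothesis matches the two forms of [M_space]. *)
Lemma Mhat_near (x : (H * H)%type) tau : 0 < tau -> Fc x.1 -> Fc x.2 ->
  c^* = c \/ x.1 = c *: x.2 ->
  exists2 h, Mhat h & N2 (x - h) <= nearC * (eta * N2 x) + tau.
Proof.
move=> tau0 F1 F2 cx; pose y : (H * H)%type := (P x.1, P x.2).
have a0 : 0 <= a := rnorm_ge0 c; have CS0 := CS_ge0; have CE00 := CE0.
set m := eta * N2 x; have m0 : 0 <= m by rewrite mulr_ge0 ?sqrtr_ge0.
have Uy : U2 y by split; exact: opr_in hP _.
have sqle (p q : (H * H)%type) t : 0 <= t -> rnorm p.1 <= t * rnorm q.1 ->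
    rnorm p.2 <= t * rnorm q.2 -> N2 p <= t * N2 q.
  move=> t0 h1 h2; rewrite -(@ler_pXn2r _ 2) ?nnegrE ?mulr_ge0 ?sqrtr_ge0 //.
  rewrite exprMn !sqr_pair_norm mulrDr -!exprMn.
  by apply: lerD; rewrite ler_pXn2r ?nnegrE ?mulr_ge0 ?rnorm_ge0.
have xy : N2 (x - y) <= m by apply: sqle => //; exact: heta.
have ny : N2 y <= N2 x.
  by rewrite -[leRHS]mul1r; apply: sqle; rewrite ?mul1r ?(opr_le dotE hP).
have qy : qn2 y <= m.
  by apply: sqle => //=; apply: le_trans (qn_proj _) _ => //; exact: heta.
have ey : eta * N2 y <= m by rewrite ler_wpM2l.
have qm : qn2 y + eta * N2 y <= 2 * m by lra.
have nSy : N2 (S y) <= pencilC * N2 x.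
  by apply: le_trans (pencil_bound _) _; rewrite ler_wpM2l.
have BBE : B (B y) = ((s%:C%C)^-1 ^+ 2) *: (S (S y - c *: y) - c *: (S y - c *: y)).
  by rewrite [B y]hB linearZ /= hB scalerA expr2.
have hX : N2 (S (S y - c *: y) - c *: (S y - c *: y)) <= CX * m.
  case: cx => [cr|xc].
    have -> : S (S y - c *: y) - c *: (S y - c *: y) = (quad_defect (S y), quad_defect y).
      by rewrite -quad_defect_shift cr.
    apply: le_trans (pair_le _) _ => /=.
    have h1 := quad_defect_le y; have h2 := quad_defect_le (S y); have h3 := qn2_S y.
    have h4 := ler_wpM2l CE00 qm; have h5 : eta * N2 (S y) <= pencilC * m.
      by rewrite /m mulrCA ler_wpM2l.
    have CT0 : 0 <= CT by rewrite /CT; have := sqr_ge0 a; lra.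
    have h6 : qn2 (S y) + eta * N2 (S y) <= (2 * CT + pencilC) * m.
      by have := ler_wpM2l CT0 qm; rewrite -/CT in h3; lra.
    have := ler_wpM2l CE00 h6.
    have := mulr_ge0 (mulr_ge0 CE00 (addr_ge0 CS0 a0)) m0.
    by rewrite /CX; lra.
  set w := S y - c *: y.
  have ew : w = (quad_defect y, 0).
    have yc : y.1 = c *: y.2 by rewrite /y /= xc (linE P).
    have -> : w = ((S y).1 - c *: y.1, (S y).2 - c *: y.2) by [].
    congr (_, _); last by rewrite hS /= -yc /= subrr.
    rewrite /quad_defect scalerDl opprD addrA -addrA yc.
    by rewrite [c^* *: _]scalerA [c^* * c]mulrC addNr addr0.
  have nw : N2 w <= defectC * (2 * m).
    apply: le_trans (pair_le _) _; rewrite ew /= rnorm0 addr0.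
    apply: le_trans (quad_defect_le y) _; rewrite ler_wpM2l //.
  have h1 : N2 (S w - c *: w) <= (pencilC + a) * N2 w.
    apply: le_trans (inNB_le J2 _ _) _; rewrite mulrDl (inNZ J2) lerD2r.
    exact: pencil_bound.
  have := ler_wpM2l (addr_ge0 CS0 a0) nw.
  have CT0 : 0 <= CT by rewrite /CT; have := sqr_ge0 a; lra.
  have x0 : 0 <= 2 * CT + pencilC + 2 by lra.
  have := mulr_ge0 (mulr_ge0 CE00 x0) m0.
  by rewrite /CX; lra.
have hBB : N2 (B (B y)) <= (s^-1 ^+ 2) * CX * m.
  rewrite BBE (inNZ J2) rnormX rnormV ns -mulrA ler_wpM2l //.
  by rewrite sqr_ge0.
have [h Mh hh] := Mhat_dist tau0 Uy.
exists h => //; have -> : x - h = (x - y) + (y - h) by rewrite addrA subrK.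
apply: le_trans (inND J2 _ _) _; apply: le_trans (lerD xy hh) _.
have := ler_wpM2l (ltW sKr0) hBB; rewrite /nearC; lra.
Qed.

Lemma pencil_eigvec mu u : U u -> P (Gop mu u) = 0 ->
  S (mu *: u, u) = mu *: ((mu *: u, u) : (H * H)%type).
Proof.
move=> Uu Pu; have U2v : U2 (mu *: u, u) by split=> //=; exact: (sub_scale sU).
pose w := S (mu *: u, u) - mu *: ((mu *: u, u) : (H * H)%type).
have e2 : w.2 = 0 by rewrite /w hS /= subrr.
have : P (Gop mu u) = P (T w.2 + Ts w.2) - mu *: w.2 - w.1 := pencil_id mu U2v.
rewrite Pu e2 !linear0 addr0 linear0 addr0 add0r.
move=> /esym/eqP; rewrite oppr_eq0 => /eqP e1.
by apply/eqP; rewrite -subr_eq0 [_ - _]surjective_pairing -/w e1 e2.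
Qed.

Lemma Mhat_eigvec mu u : U u -> P (Gop mu u) = 0 -> rnorm (mu - c) < r ->
  Mhat (mu *: u, u).
Proof.
move=> Uu Pu mr; apply: sub_lspan; exists mu => //; split.
  by split=> //=; exact: (sub_scale sU).
by exists 1%N; rewrite /= (pencil_eigvec Uu Pu) subrr.
Qed.

Lemma Mhat_eig_exists h : Mhat h -> h != 0 ->
  exists mu u, [/\ rnorm (mu - c) < r, U u, u != 0 & P (Gop mu u) = 0].
Proof.
move=> Mh h0; have [mu [v [hmu Uv v0 Sv]]] := spectral_sub_eigenvector pencil_subspace
  pencil_stable Mh h0.
have v12 : v.1 = mu *: v.2 by have := congr1 snd Sv; rewrite hS.
exists mu, v.2; split=> //; first exact: (proj2 Uv).
  apply: contra_neq v0 => v20.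
  by rewrite [v]surjective_pairing v12 v20 scaler0.
by rewrite (pencil_id mu Uv) Sv subrr /= !linear0 addr0 linear0 !addr0.
Qed.

Lemma Mhat_eig_qn mu u : U u -> P (Gop mu u) = 0 -> rnorm (mu - c) < r ->
  qn u <= spectralC * (a + r + 1) * (eta * rnorm u).
Proof.
move=> Uu Pu mr; apply: le_trans (qn2_2 (mu *: u, u)) _.
apply: le_trans (Mhat_qn2 (Mhat_eigvec Uu Pu mr)) _.
rewrite -mulrA ler_wpM2l // mulrCA ler_wpM2l //.
apply: le_trans (pair_le _) _ => /=; rewrite (inNZ J) mulrDl mul1r lerD2r.
rewrite ler_wpM2r ?rnorm_ge0 //.
have := rnormD (mu - c) c; rewrite subrK -/a; lra.
Qed.

Definition eigC := (K + (a + r)) ^+ 2.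

(* Pairing [Gop mu u] with the projection [b] of [u] gives [gsym mu c |b|^2] on the
   one hand, and a product of two errors of size [eta] on the other. *)
Lemma Mhat_eig_real mu u : U u -> P (Gop mu u) = 0 -> rnorm (mu - c) < r -> u != 0 ->
  rnorm u <= 2 * rnorm (pr u) -> rnorm (pr u - P (pr u)) <= rnorm (pr u) / 2 ->
  rnorm (gsym mu c) <= 4 * (eigC * (spectralC * (a + r + 1))) * eta ^+ 2.
Proof.
move=> Uu Pu mr u0 hu hw; set b := pr u; set w := b - P b.
have Fb : Fc b := oproj_in _ _ _.
have nu0 : 0 < rnorm u.
  by rewrite lt_def rnorm_ge0 andbT; apply: contra_neq u0; exact: rnorm_eq0.
have nb0 : 0 < rnorm b by rewrite -/b in hu; lra.
have db : dot u b = dot b b.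
  by apply/eqP; rewrite -subr_eq0 -linearBl /= (oproj_orth _ oe0 Fb).
have Gb : Gop mu b = gsym mu c *: b.
  transitivity (T (Ts b - mu *: b) - mu *: (Ts b - mu *: b)) => //.
  have -> : T (Ts b - mu *: b) - mu *: (Ts b - mu *: b) =
     T (Ts b) - mu *: (T b + Ts b) + (mu * mu) *: b.
    by rewrite !(linE T); apply: dotl_eq => x; rewrite !dotlE; ring.
  rewrite (kernel_sum Fb) (kernel_prod Fb) /gsym.
  by apply: dotl_eq => x; rewrite !dotlE; ring.
have e1 : gsym mu c * dot b b = dot (Gop mu u) w.
  rewrite -db -(kernel_dot _ _ Fb) /w linearBr /=.
  have := opr_orth hP (Gop mu u) (opr_in hP b); rewrite Pu subr0 => ->.
  by rewrite subr0.
have e2 : Gop mu u = Gop mu (u - b) + gsym mu c *: b.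
  rewrite -Gb; have [G hG] := Gop_linear T Ts mu.
  by rewrite -!hG -(linE G) subrK.
have CGm : (K + rnorm mu) ^+ 2 <= eigC.
  have K0 := bn_K0 BN; have a0 : 0 <= a := rnorm_ge0 c.
  rewrite ler_pXn2r ?nnegrE ?addr_ge0 ?rnorm_ge0 ?(ltW (lt_trans s0 sr)) //.
  by rewrite lerD2l; have := rnormD (mu - c) c; rewrite subrK -/a; lra.
have h1 : rnorm (dot (Gop mu (u - b)) w) <= eigC * qn u * (eta * rnorm b).
  apply: le_trans (dot_CS dotE _ _) _; apply: ler_pM; rewrite ?rnorm_ge0 //.
    apply: le_trans (Gop_bound dotE BN _ _) _.
    by rewrite ler_wpM2r ?rnorm_ge0.
  exact: heta.
(* The kernel part of [u] contributes a multiple of [gsym mu c] itself; as [w] is at most half as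
   long as [b], it is absorbed on the left. *)
have h2 : rnorm (gsym mu c) * rnorm b ^+ 2 <=
    eigC * qn u * (eta * rnorm b) + rnorm (gsym mu c) * (rnorm b * (rnorm b / 2)).
  have -> : rnorm (gsym mu c) * rnorm b ^+ 2 = rnorm (gsym mu c * dot b b).
    by rewrite rnormM dotE rnormX rnormE rnormC ger0_norm ?rnorm_ge0.
  rewrite e1 e2 dotDl; apply: le_trans (rnormD _ _) _; apply: lerD => //.
  rewrite dotZl rnormM ler_wpM2l ?rnorm_ge0 //.
  apply: le_trans (dot_CS dotE _ _) _; by rewrite ler_wpM2l ?rnorm_ge0.
have h3 := Mhat_eig_qn Uu Pu mr.
set g := rnorm (gsym mu c) in h2 *; set Q := spectralC * (a + r + 1) in h3 *.
have CG0 : 0 <= eigC := sqr_ge0 _.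
have Q0 : 0 <= Q.
  by rewrite mulr_ge0 // !addr_ge0 ?rnorm_ge0 // ltW // (lt_trans s0 sr).
have h4 : eigC * qn u * (eta * rnorm b) <= eigC * (Q * (eta * (2 * rnorm b))) * (eta * rnorm b).
  rewrite ler_wpM2r ?mulr_ge0 ?rnorm_ge0 //.
  rewrite ler_wpM2l //; apply: le_trans h3 _; rewrite ler_wpM2l // ler_wpM2l //.
rewrite -(@ler_pM2r _ (rnorm b ^+ 2)) ?exprn_gt0 //.
rewrite !expr2 in h2 h4 *; lra.
Qed.

Let gap2 := rnorm (c - c^*).
Hypothesis gap0 : 0 < gap2.
Hypothesis s_gap : 2 * s <= gap2.
Definition nonrealC := 2 * (gap2^-1 * (defectC * (spectralC + 1) * (pencilC + 1) * (s * Kr))).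

Lemma Mhat_quad (u : (H * H)%type) : Mhat u ->
  N2 (quad_defect (S u), quad_defect u) <= defectC * (spectralC + 1) * (pencilC + 1) * (eta * N2 u).
Proof.
move=> Mu; apply: le_trans (pair_le _) _ => /=.
have hq (w : (H * H)%type) : Mhat w -> rnorm (quad_defect w) <= defectC * (spectralC + 1) * (eta * N2 w).
  move=> Mw; apply: le_trans (quad_defect_le _) _; rewrite -mulrA ler_wpM2l //.
  by rewrite mulrDl mul1r lerD2r Mhat_qn2.
have h0 : 0 <= defectC * (spectralC + 1).
  rewrite mulr_ge0 // addr_ge0 // /spectralC mulr_ge0 // mulr_ge0 //; exact: ltW.
apply: le_trans (lerD (hq _ (Mhat_S Mu)) (hq _ Mu)) _.
rewrite -mulrDr -mulrA ler_wpM2l // -mulrDr mulrCA ler_wpM2l //.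
by rewrite mulrDl mul1r lerD2r pencil_bound.
Qed.

(** For [w = B^i (S - c) v], [(c - conj c) w] is the difference of [(S - conj c) w], a pair of
    quadratic defects of size [eta], and [(S - c) w = s B w]. Since [2 s <= |c - conj c|], the norms
    of the [w] satisfy the inequality of [half_contract]. *)
Lemma Mhat_nonreal v : Mhat v -> N2 (S v - c *: v) <= nonrealC * (eta * N2 v).
Proof.
move=> Mv; set f := S v - c *: v; have g0 := gap0.
have fB : f = s%:C%C *: B v by rewrite hB scalerA mulfV // scale1r.
have iterZ k (u : (H * H)%type) : iter k B (s%:C%C *: u) = s%:C%C *: iter k B u.
  by elim: k => //= k ->; rewrite linearZ.
have iterf k : iter k B f = S (iter k B v) - c *: iter k B v.
  by rewrite fB iterZ -iterSr iterS hB scalerA mulfV // scale1r.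
rewrite /nonrealC -[leRHS]mulrA.
apply: (@half_contract _ (fun i => N2 (iter i B f)) _
  (s * Kr * N2 f)) => i; last first.
  apply: Mhat_iter_le; rewrite fB; apply: sub_scale; last exact: Mhat_B.
  exact: spectral_sub_subspace.
set u := iter i B v; set w := iter i B f.
have Mi : Mhat u := Mhat_iter_B i Mv.
have e1 : S w - c^* *: w = (quad_defect (S u), quad_defect u).
  by rewrite /w iterf -/u quad_defect_shift.
have e2 : (c - c^*) *: w = (S w - c^* *: w) - (S w - c *: w).
  by rewrite scalerBl [in RHS]opprB [RHS]addrC addrA subrK.
have e3 : S w - c *: w = s%:C%C *: iter i.+1 B f.
  by rewrite iterS hB scalerA mulfV // scale1r.
have h : gap2 * N2 w <= N2 (S w - c^* *: w) + s * N2 (iter i.+1 B f).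
  rewrite -(inNZ J2) e2; apply: le_trans (inNB_le J2 _ _) _.
  by rewrite e3 (inNZ J2) ns.
have h' := Mhat_quad Mi; rewrite -e1 in h'.
have h0 : 0 <= defectC * (spectralC + 1) * (pencilC + 1).
  have CS0 : 0 <= pencilC by rewrite /pencilC; have := sqr_ge0 K; have := bn_K0 BN; lra.
  have Cq0 : 0 <= spectralC by apply: mulr_ge0 => //; exact: mulr_ge0 C1_ge0 (ltW sKr0).
  exact: mulr_ge0 (mulr_ge0 CE0 (addr_ge0 Cq0 ler01)) (addr_ge0 CS0 ler01).
rewrite -(ler_pM2l g0) mulrDr -[gap2^-1 * _ * _]mulrA mulVKf ?gt_eqF //.
apply: le_trans h _; rewrite addrC; apply: lerD.
  have := ler_wpM2r (inge0 J2 (iter i.+1 B f)) s_gap; lra.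
apply: le_trans h' _; rewrite -[leRHS]mulrA ler_wpM2l //.
rewrite mulrCA ler_wpM2l //; exact: Mhat_iter_le.
Qed.

Lemma Mhat_eig_nonreal mu u : U u -> P (Gop mu u) = 0 -> rnorm (mu - c) < r ->
  u != 0 -> rnorm (mu - c) <= nonrealC * eta.
Proof.
move=> Uu Pu mr u0.
have := Mhat_nonreal (Mhat_eigvec Uu Pu mr).
rewrite (pencil_eigvec Uu Pu) -scalerBl (inNZ J2) mulrA ler_pM2r //.
rewrite lt_def (inge0 J2) andbT; apply: contra_neq u0 => /(ineq0 J2)/(congr1 snd).
by [].
Qed.

End FinitePencil.

(** * Estimates uniform in the trial space *)

Section UniformPencil.
Context {R : realType} {H : completeNormedModType R[i]}.
Variable dot : {dot H for Num.conj}.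
Hypothesis dotE : forall x : H, dot x x = `|x| ^+ 2.
Let J := inner_ip dotE.
Let J2 := inner_ip2 dotE.
Variables (T Ts : {linear H -> H}) (K : R).
Hypothesis BN : bounded_normal dot T Ts K.
Let opT : operator H := Operator setT T.
Local Notation Gop := (Gop T Ts).
Local Notation N2 := (@pair_norm R H).
Variables (c : R[i]) (r : R).
Hypothesis r0 : 0 < r.
Hypothesis separated : forall l, rnorm (l - c) <= r -> exists p d, 0 < d /\
  forall x, essential_spectrum opT x -> d <= complex.Re (p * gsym l x).
Hypothesis disc : forall l x, rnorm (l - c) <= r -> spectrum opT x ->
  gsym l x = 0 -> l = c.
Variables (Un : nat -> set H) (P : nat -> {linear H -> H}).
Hypothesis hP : forall n, is_oproj dot (Un n) (P n).
Hypothesis cP : forall x (eps : R), 0 < eps ->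
  exists N, forall n, (N <= n)%N -> rnorm (x - P n x) < eps.
Implicit Types (l mu : R[i]) (u b : H).

Lemma pencil_stability l : rnorm (l - c) <= r -> exists e0 : seq H,
  [/\ orthonormal dot e0,
  forall x, x \in e0 -> exists2 k, spectrum opT k & T x = k *: x /\ gsym l k = 0,
  forall u, Gop l u = 0 -> lspan [set` e0] u &
  exists (C : R) (N : nat), 0 < C /\ forall n, (N <= n)%N -> forall u, Un n u ->
    rnorm (u - oproj dot e0 u) <=
      C * (rnorm (P n (Gop l u) - oproj dot e0 (P n (Gop l u))) +
           rnorm (oproj dot e0 u - P n (oproj dot e0 u)))].
Proof.
move=> lr; have [p [d [d0 hd]]] := separated lr.
have [e [oe he coe]] := coercive_split dotE BN d0 hd.
have d2 : 0 < d / 2 by rewrite divr_gt0.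
exact: (galerkin_stability dotE BN d2 oe he coe hP cP).
Qed.

(** Off the centre no spectral point is a zero of the symbol, so the exceptional vectors of the
    stability estimate are absent. *)
Lemma stable_at l : rnorm (l - c) <= r -> l != c -> exists (C : R) (N : nat),
  0 < C /\ forall n, (N <= n)%N -> forall u, Un n u ->
    rnorm u <= C * rnorm (P n (Gop l u)).
Proof.
move=> lr lc; have [e0 [_ he0 _ [C [N [C0 hC]]]]] := pencil_stability lr.
have e00 : e0 = [::].
  case: e0 he0 {hC} => // x e he; have [k sk [_ g0]] := he x (mem_head _ _).
  by move/eqP: lc; case; exact: disc lr sk g0.
exists C, N; split=> // n Nn u Uu; have := hC n Nn u Uu.
by rewrite e00 /oproj !big_nil [P n 0]linear0 !subr0 rnorm0 addr0.
Qed.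

Lemma Gop_diff l l' u :
  rnorm (Gop l' u - Gop l u) <= rnorm (l' - l) * (2 * K + rnorm l + rnorm l') * rnorm u.
Proof.
have -> : Gop l' u - Gop l u = (l - l') *: (T u + Ts u - (l + l') *: u).
  have GE w : Gop w u = T (Ts u) - w *: (T u + Ts u) + (w * w) *: u.
    transitivity (T (Ts u - w *: u) - w *: (Ts u - w *: u)) => //.
    by rewrite !(linE T); apply: (dotl_eq dotE) => x; rewrite !(dotDl, dotNl, dotZl); ring.
  by rewrite !GE; apply: (dotl_eq dotE) => x; rewrite !(dotDl, dotNl, dotZl); ring.
rewrite (inNZ J) -mulrA; have -> : rnorm (l - l') = rnorm (l' - l).
  by rewrite /rnorm distrC.
rewrite ler_wpM2l ?rnorm_ge0 //; apply: le_trans (inNB_le J _ _) _.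
apply: le_trans (lerD (sum_bound dotE BN u) (lexx _)) _; rewrite (inNZ J).
have := ler_wpM2r (rnorm_ge0 u) (rnormD l l'); lra.
Qed.

(** The change of [G] is bounded independently of [n] and projections do not increase norms, so
    stability persists nearby with twice the constant. *)
Lemma stable_near l : rnorm (l - c) <= r -> l != c -> exists (C : R) (N : nat) (del : R),
  [/\ 0 < C, 0 < del & forall n, (N <= n)%N -> forall l', rnorm (l' - l) < del ->
    forall u, Un n u -> rnorm u <= C * rnorm (P n (Gop l' u))].
Proof.
move=> lr lc; have [C [N [C0 hC]]] := stable_at lr lc.
have K0 := bn_K0 BN; have nl := rnorm_ge0 l.
set D := 2 * K + rnorm l + (rnorm l + 1).
have D0 : 0 < D by rewrite /D; lra.
exists (2 * C), N, (Num.min 1 (2 * C * D)^-1); split.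
- by rewrite mulr_gt0.
- by rewrite lt_min ltr01 invr_gt0 !mulr_gt0.
move=> n Nn l'; rewrite lt_min => /andP[l1 l2] u Uu.
have nl' : rnorm l' <= rnorm l + 1.
  by have := rnormD (l' - l) l; rewrite subrK; lra.
have h1 : rnorm (Gop l' u - Gop l u) <= (2 * C)^-1 * rnorm u.
  apply: le_trans (Gop_diff _ _ _) _; rewrite ler_wpM2r ?rnorm_ge0 //.
  have h : rnorm (l' - l) * (2 * K + rnorm l + rnorm l') <= (2 * C * D)^-1 * D.
    by apply: ler_pM; rewrite ?rnorm_ge0 ?(ltW l2) // ?lerD2l // !addr_ge0 ?mulr_ge0 ?rnorm_ge0.
  by apply: le_trans h _; rewrite invfM mulfVK // gt_eqF.
have [G hG] := Gop_linear T Ts l; have [G' hG'] := Gop_linear T Ts l'.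
have h2 : rnorm (P n (Gop l u)) <= rnorm (P n (Gop l' u)) + (2 * C)^-1 * rnorm u.
  have -> : P n (Gop l u) = P n (Gop l' u) - P n (Gop l' u - Gop l u).
    by rewrite (linearB (P n) (Gop l' u) (Gop l u)) /= subKr.
  apply: le_trans (inNB_le J _ _) _; rewrite lerD2l.
  exact: le_trans (opr_le dotE (hP n) _) h1.
have := hC n Nn u Uu; have := ler_wpM2l (ltW C0) h2.
have -> : C * (rnorm (P n (Gop l' u)) + (2 * C)^-1 * rnorm u) =
  C * rnorm (P n (Gop l' u)) + rnorm u / 2 by field; rewrite gt_eqF.
lra.
Qed.

(** Compactness: failures with constants [k.+1] at indices [n >= k] accumulate at a point [x] of the
    annulus, against [stable_near] at [x]. *)
Lemma stable_annulus (s : R) : 0 < s -> exists (C : R) (N : nat), 0 < C /\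
  forall n, (N <= n)%N -> forall l, s <= rnorm (l - c) <= r ->
  forall u, Un n u -> rnorm u <= C * rnorm (P n (Gop l u)).
Proof.
move=> s0; apply: contrapT => no.
have ex k : exists l, s <= rnorm (l - c) <= r /\
    exists n u, [/\ (k <= n)%N, Un n u & k.+1%:R * rnorm (P n (Gop l u)) < rnorm u].
  apply: contrapT => nk; apply: no; exists k.+1%:R, k; split; first exact: ltr0n.
  move=> n kn l lr u Uu; rewrite leNgt; apply/negP => h; apply: nk.
  by exists l; split=> //; exists n, u.
have [l hl] := choice ex.
have bl n : rnorm (l n) <= r + rnorm c.
  have [/andP[_ h] _] := hl n.
  by have := rnormD (l n - c) c; rewrite subrK; lra.
have [x hx] := bolzano_weierstrass bl.
have near e : 0 < e -> exists n, rnorm (l n - x) < e /\ rnorm (x - l n) < e.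
  by move=> e0; have [n _ h] := hx e e0 0%N; exists n; rewrite {2}/rnorm distrC.
have xr : rnorm (x - c) <= r.
  apply/ler_addgt0Pr => e /near[n [_ h]]; have [/andP[_ h'] _] := hl n.
  by have := rnormD (x - l n) (l n - c); rewrite addrA subrK; lra.
have xs : s <= rnorm (x - c).
  apply/ler_addgt0Pr => e /near[n [h _]]; have [/andP[h' _] _] := hl n.
  by have := rnormD (l n - x) (x - c); rewrite addrA subrK; lra.
have xc : x != c.
  by apply/negP => /eqP xc; move: xs; rewrite xc subrr rnorm0 leNgt s0.
have [C [N [del [C0 del0 h]]]] := stable_near xr xc.
have [k Ck] : exists k : nat, C <= k%:R.
  by exists (Num.bound C); apply/ltW/archi_boundP/ltW.
have [n nk ln] := hx del del0 (maxn N k).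
have [_ [m [u [nm Uu hu]]]] := hl n.
move: nk; rewrite geq_max => /andP[Nn kn].
have := h m (leq_trans Nn nm) _ ln u Uu; rewrite leNgt; case/negP.
apply: le_lt_trans hu; rewrite ler_wpM2r ?rnorm_ge0 //.
by apply: le_trans Ck _; rewrite ler_nat; exact: leqW.
Qed.

Variable S : nat -> {linear (H * H)%type -> (H * H)%type}.
Hypothesis hS : forall n v, S n v = (P n (T v.1 + Ts v.1) - P n (T (Ts v.2)), v.1).
Hypothesis fU : forall n, finite_dim (Un n).

Lemma finite_dim_pair (U : set H) : finite_dim U ->
  finite_dim ([set v | U v.1 /\ U v.2] : set (H * H)).
Proof.
move=> [t Ut]; have sU : Defs.subspace U by rewrite Ut; exact: lspan_subspace.
pose tt : seq (H * H) := [seq (x, 0) | x <- t] ++ [seq (0, x) | x <- t].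
exists tt; have sT := @lspan_subspace _ _ [set` tt].
apply/seteqP; split; last first.
  apply: lspan_min => [|v /=].
    split; first by split; exact: (proj1 sU).
    by move=> a u v [h1 h2] [h3 h4]; split; apply: (proj2 sU).
  rewrite mem_cat => /orP[] /mapP[x xt ->] /=; split; rewrite ?Ut.
  - exact: sub_lspan.
  - exact: (proj1 (@lspan_subspace _ _ _)).
  - exact: (proj1 (@lspan_subspace _ _ _)).
  - exact: sub_lspan.
move=> [v1 v2] /= [U1 U2].
have -> : (v1, v2) = (v1, 0) + (0, v2) :> H * H.
  by congr (_, _); rewrite ?addr0 ?add0r.
apply: (subD sT).
  move: U1; rewrite Ut; apply: (@lspan_min _ _ _ [set x | lspan [set` tt] (x, 0)]).
    split=> [|a u v h1 h2] /=; first exact: (proj1 sT).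
    have := proj2 sT a _ _ h1 h2; congr (lspan _ _); congr (_, _).
    by rewrite /= scaler0 addr0.
  move=> x xt; apply: sub_lspan => /=; rewrite mem_cat; apply/orP; left.
  by apply/mapP; exists x.
move: U2; rewrite Ut; apply: (@lspan_min _ _ _ [set x | lspan [set` tt] (0, x)]).
  split=> [|a u v h1 h2] /=; first exact: (proj1 sT).
  have := proj2 sT a _ _ h1 h2; congr (lspan _ _); congr (_, _).
  by rewrite /= scaler0 addr0.
move=> x xt; apply: sub_lspan => /=; rewrite mem_cat; apply/orP; right.
by apply/mapP; exists x.
Qed.

(** [e0], [C] and [N] do not depend on [eta], which may be a multiple of [eps_n] or a fixed small
    number valid for large [n]. *)
Theorem uniform_pencil : exists (e0 : seq H) (C : R) (N : nat),
  [/\ orthonormal dot e0, forall b, lspan [set` e0] b <-> Gop c b = 0,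
  forall x, x \in e0 -> exists2 l, T x = l *: x & gsym c l = 0, 0 <= C &
  forall n, (N <= n)%N -> forall eta, 0 <= eta ->
    (forall b, Gop c b = 0 -> rnorm (b - P n b) <= eta * rnorm b) ->
    let Mh := spectral_sub (S n) [set v | Un n v.1 /\ Un n v.2]
                [set mu | rnorm (mu - c) < r] in
  [/\ forall v, Mh v -> qn2 dot e0 v <= C * (eta * N2 v),
      c^* != c -> forall v, Mh v -> N2 (S n v - c *: v) <= C * (eta * N2 v),
      forall (x : (H * H)%type) tau, 0 < tau -> Gop c x.1 = 0 -> Gop c x.2 = 0 ->
        c^* = c \/ x.1 = c *: x.2 ->
        exists2 h, Mh h & N2 (x - h) <= C * (eta * N2 x) + tau &
      forall mu u, rnorm (mu - c) < r -> Un n u -> u != 0 -> P n (Gop mu u) = 0 ->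
        rnorm (mu - c) <= C * eta]].
Proof.
have K0 := bn_K0 BN; have a0 := rnorm_ge0 c.
have cr : rnorm (c - c) <= r by rewrite subrr rnorm0 ltW.
have [e0 [oe0 he0' ke0 [C0 [N0 [C00 hC0]]]]] := pencil_stability cr.
have he0 x : x \in e0 -> exists2 l, T x = l *: x & gsym c l = 0.
  by move=> /he0'[l _ [h1 h2]]; exists l.
have ker b : lspan [set` e0] b <-> Gop c b = 0.
  split; last exact: ke0.
  apply: (@lspan_min _ _ _ [set b | Gop c b = 0]) => [|x /he0[l h1 h2] /=].
    have [G hG] := Gop_linear T Ts c.
    split=> [|z u v] /=; rewrite -!hG ?linear0 // => hu hv.
    by rewrite linearP /= hu hv scaler0 addr0.
  by rewrite (Gop_eig dotE BN _ h1) h2 scale0r.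
set k0 := shiftC K c C0.
have k00 : 0 < k0.
  have CS0 : 0 <= pencilC K by rewrite /pencilC; have := sqr_ge0 K; lra.
  have x0 := mulr_ge0 a0 (addr_ge0 CS0 a0).
  have x1 : 0 <= (rnorm c + 1) * C0 by rewrite mulr_ge0 ?(ltW C00) // addr_ge0.
  have x2 : 0 <= 2 * K + rnorm c + 2 + 2 * rnorm c * (pencilC K + rnorm c) by lra.
  by rewrite /k0 /shiftC; have := mulr_ge0 x1 x2; lra.
(* The condition [2 s <= |c - conj c|] concerns nonreal [c] only; for real [c] the value 1 is
   arbitrary. *)
pose g := if c^* == c then 1 else rnorm (c - c^*) / 2.
have g0 : 0 < g.
  rewrite /g; case: eqP => // /eqP cc; rewrite divr_gt0 // rnorm_gt0 // subr_eq0.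
  by rewrite eq_sym.
pose s := Num.min (r / 2) (Num.min (1 / 2 / k0) g).
have s0 : 0 < s by rewrite !lt_min !divr_gt0.
have sr2 : s <= r / 2 by rewrite ge_min lexx.
have sr : s < r by lra.
have sk : k0 * s <= 1 / 2.
  by rewrite mulrC -ler_pdivlMr // !ge_min lexx !orbT.
have sg : s <= g by rewrite !ge_min lexx !orbT.
have [Ca [N1 [Ca0 hCa]]] := stable_annulus s0.
pose M := rnorm c + r.
pose Kr := 1 + (M + 1) * (Ca * (2 * K + M + 1)).
have Kr0 : 0 < Kr.
  by rewrite ltr_wpDr // mulr_ge0 // ?mulr_ge0 // ?addr_ge0 // ?mulr_ge0 //; exact: ltW.
have hres n : (N1 <= n)%N -> forall l, s <= rnorm (l - c) <= r ->
    forall v, [set v | Un n v.1 /\ Un n v.2] v -> N2 v <= Kr * N2 (S n v - l *: v).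
  move=> Nn l lr v Uv.
  have lM : rnorm l <= M.
    by have := rnormD (l - c) c; rewrite subrK; case/andP: lr => _; rewrite /M; lra.
  exact: (pencil_resolvent dotE BN (hP n) (hS n) (ltW Ca0) lM (hCa n Nn l lr) Uv).
have exB n : exists B : {linear (H * H)%type -> (H * H)%type},
    forall v, B v = (s%:C%C)^-1 *: (S n v - c *: v).
  apply: linear_exists => b u v.
  by rewrite shiftD shiftZ scalerDr !scalerA mulrC.
set k1 := spectralC K c C0 s Kr.
set k2 := nonrealC K c C0 s Kr.
set k3 := nearC K c s Kr.
pose k4 := `|4 * (eigC K c r * (k1 * (rnorm c + r + 1)))|.
pose C := `|k1| + `|k2| + `|k3| + Num.sqrt k4.
have X1 : 0 <= `|k1 * (rnorm c + r + 1)| := normr_ge0 _.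
set X := `|_| in X1.
(* [Mhat_eig_real] needs two qualitative bounds before [eta] enters: [1 / 2] serves the projection
   error of the kernel part of [u], and [1 / 2 / (X + 1)] brings [u] within half its length of the
   kernel. *)
pose del : R := Num.min (1 / 2) (1 / 2 / (X + 1)).
have Xp : 0 < X + 1 by rewrite ltr_wpDl.
have del0 : 0 < del by rewrite lt_min !divr_gt0.
have del2 : del <= 1 / 2 by rewrite ge_min lexx.
have [N2' hN2] := oproj_approx dotE cP oe0 del0.
have C_ge0 : 0 <= C by rewrite !addr_ge0 ?normr_ge0 ?sqrtr_ge0.
have Ck (k m : R) : `|k| <= C -> 0 <= m -> k * m <= C * m.
  by move=> kC m0; rewrite ler_wpM2r //; apply: le_trans kC; exact: ler_norm.
have [kC1 kC2 kC3 kC4'] := summand_le (normr_ge0 k1) (normr_ge0 k2) (normr_ge0 k3) (sqrtr_ge0 k4).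
have kC4 : `|Num.sqrt k4| <= C by rewrite ger0_norm ?sqrtr_ge0.
exists e0, C, (maxn N0 (maxn N1 N2')); split=> // n.
rewrite !geq_max => /and3P[Nn0 Nn1 Nn2] eta eta0 heta' Mh.
have heta b : lspan [set` e0] b -> rnorm (b - P n b) <= eta * rnorm b.
  by move=> /ker; exact: heta'.
have [B hB] := exB n.
have fU2 := finite_dim_pair (fU n).
have em v : 0 <= eta * N2 v by rewrite mulr_ge0 ?sqrtr_ge0.
have C00' := ltW C00.
have nonreal : c^* != c -> 0 < rnorm (c - c^*) /\ 2 * s <= rnorm (c - c^*).
  move=> cc; move: sg; rewrite /g (negbTE cc) ler_pdivlMr // mulrC => sg'; split=> //.
  by rewrite rnorm_gt0 // subr_eq0 eq_sym.
split.
- move=> v Mv; apply: le_trans (Ck k1 _ kC1 (em v)).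
  exact: (Mhat_qn2 dotE BN (hP n) (hS n) oe0 he0 eta0 heta C00' (hC0 n Nn0) s0 sr sk Kr0
    (hres n Nn1) hB Mv).
- move=> /nonreal[gp gs] v Mv; apply: le_trans (Ck k2 _ kC2 (em v)).
  exact: (Mhat_nonreal dotE BN (hP n) (hS n) oe0 he0 eta0 heta C00' (hC0 n Nn0) s0 sr sk Kr0
    (hres n Nn1) hB gp gs Mv).
- move=> x tau tau0 /ker F1 /ker F2 hx.
  have [h Mhh hh] := Mhat_near dotE BN (hP n) (hS n) oe0 he0 eta0 heta s0 sr Kr0
    (hres n Nn1) fU2 hB tau0 F1 F2 hx.
  by exists h => //; apply: le_trans hh _; rewrite lerD2r; exact: Ck.
- move=> mu u mr Uu u0 Pu; have [cc|cc] := eqVneq (c^*) c; last first.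
    have [gp gs] := nonreal cc; apply: le_trans (Ck k2 _ kC2 eta0).
    exact: (Mhat_eig_nonreal dotE BN (hP n) (hS n) oe0 he0 eta0 heta C00' (hC0 n Nn0) s0 sr sk
      Kr0 (hres n Nn1) hB gp gs Uu Pu mr u0).
  apply: le_trans (Ck _ _ kC4 eta0).
  have hd := hN2 n Nn2.
  have q := Mhat_eig_qn dotE BN (hP n) (hS n) oe0 he0 (ltW del0) hd C00' (hC0 n Nn0) s0 sr sk Kr0
      (hres n Nn1) hB Uu Pu mr.
  have nu := rnorm_ge0 u.
  have q2 : rnorm (u - oproj dot e0 u) <= rnorm u / 2.
    apply: le_trans q _; rewrite -/k1 mulrA.
    have h1 : X * del <= 1 / 2.
      have : X * del <= (X + 1) * (1 / 2 / (X + 1)).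
        by apply: ler_pM; rewrite ?(ltW del0) ?ge_min ?lexx ?orbT ?lerDl.
      by have -> : (X + 1) * (1 / 2 / (X + 1)) = 1 / 2 by rewrite [LHS]mulrC divfK // gt_eqF.
    have h2 : k1 * (rnorm c + r + 1) * del <= X * del.
      by rewrite ler_pM2r // /X ler_norm.
    by rewrite [leRHS]mulrC -[2^-1]div1r ler_wpM2r // (le_trans h2 h1).
  have q3 : rnorm u <= 2 * rnorm (oproj dot e0 u).
    by apply: half_le q2; rewrite -{1}[u](subrK (oproj dot e0 u)); exact: rnormD.
  have q4 : rnorm (oproj dot e0 u - P n (oproj dot e0 u)) <= rnorm (oproj dot e0 u) / 2.
    apply: le_trans (hd _ (oproj_in _ _ _)) _; rewrite mulrC ler_wpM2l ?rnorm_ge0 //.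
    by rewrite -[_^-1]mul1r.
  have := Mhat_eig_real dotE BN (hP n) (hS n) oe0 he0 eta0 heta C00' (hC0 n Nn0) s0 sr sk Kr0
      (hres n Nn1) hB Uu Pu mr u0 q3 q4.
  (* For real [c] the symbol is the square of [c - mu], whence the square root of [k4] in [C]. *)
  rewrite /gsym cc -expr2 rnormX {1}/rnorm distrC -/(rnorm _) -/k1 => h.
  rewrite -(@ler_pXn2r _ 2) ?nnegrE ?mulr_ge0 ?sqrtr_ge0 ?rnorm_ge0 //.
  rewrite exprMn sqr_sqrtr ?normr_ge0 //; apply: le_trans h _.
  by rewrite ler_wpM2r ?sqr_ge0 ?ler_norm.
Qed.

End UniformPencil.

(** * Separation in the plane *)

Section Separation.
Context {R : realType}.
Implicit Types (X : set R[i]) (w l : R[i]).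

Lemma closed_complexP (A : set R[i]) (x : R[i]) : closed (A : set R[i]^o) ->
  (forall e : R, 0 < e -> exists2 a, A a & rnorm (a - x) < e) -> A x.
Proof.
move=> cA h; rewrite ((closure_id (A : set R[i]^o)).1 cA) => B /nbhs_ballP[e /= e0 eB].
have eR : e = (complex.Re e)%:C%C by rewrite RRe_real // gtr0_real.
have [|a Aa ax] := h (complex.Re e); first by rewrite -ltcR -eR.
exists a; split=> //; apply: eB; rewrite -ball_normE /= distrC rnormE eR ltcR.
exact: ax.
Qed.

(* [p] is the conjugate of the point of least modulus of [A]. *)
Lemma convex_separation (A : set R[i]) : convex_set (A : set R[i]^o) ->
  closed (A : set R[i]^o) -> ~ A 0 ->
  exists p d, 0 < d /\ forall l, A l -> d <= complex.Re (p * l).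
Proof.
move=> cvA clA A0; have [[a Aa]|ne] := pselect (exists a, A a); last first.
  by exists 0, 1; split=> // l Al; case: ne; exists l.
pose E := [set rnorm x | x in A].
have hE : has_inf E by split; [exists (rnorm a), a|exists 0 => _ [x _ <-]; exact: rnorm_ge0].
have lbE x : A x -> inf E <= rnorm x by move=> Ax; apply: ge_inf; [exact: (proj2 hE)|exists x].
have ex n : exists x, A x /\ rnorm x < inf E + n.+1%:R^-1.
  have n0 : 0 < n.+1%:R^-1 :> R by rewrite invr_gt0.
  by have [_ [x Ax <-] h] := inf_adherent n0 hE; exists x.
have [u hu] := choice ex.
have bu n : rnorm (u n) <= inf E + 1.
  have [_ h] := hu n; apply: le_trans (ltW h) _; rewrite lerD2l invf_le1 ?ltr0n //.
  by rewrite ler1n.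
have [x hx] := bolzano_weierstrass bu.
have Ax : A x.
  apply: (closed_complexP clA) => e e0; have [n _ h] := hx e e0 0%N.
  by exists (u n) => //; case: (hu n).
have nx y : A y -> rnorm x <= rnorm y.
  move=> /lbE; apply: le_trans; apply/ler_addgt0Pr => e e0.
  have [k hk] := invn_small (divr_gt0 e0 (ltr0n R 2)).
  have [n kn h] := hx _ (divr_gt0 e0 (ltr0n R 2)) k.
  have h1 := hk n kn; have [_ h2] := hu n.
  have := rnormD (x - u n) (u n); rewrite subrK {2}/rnorm distrC -/(rnorm _).
  move: h1 h2 h; clear; set p := _.+1%:R^-1; lra.
have x0 : 0 < rnorm x.
  by apply: rnorm_gt0; apply/eqP => x0; apply: A0; rewrite -x0.
exists (x^*), (rnorm x ^+ 2); split; first by rewrite exprn_gt0.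
move=> y Ay; rewrite -subr_ge0.
have reE (v : R[i]) : rnorm v ^+ 2 = complex.Re (v^* * v).
  by rewrite mulJr.
have -> : complex.Re (x^* * y) - rnorm x ^+ 2 = complex.Re (x^* * (y - x)).
  by rewrite mulrBr raddfB /= -reE.
set q := y - x; rewrite -oppr_le0.
apply: (@le0_of_small _ _ (rnorm q ^+ 2 / 2)) => e e0.
pose t := Num.min 1 e; have t0 : 0 < t by rewrite lt_min ltr01.
have t1 : t <= 1 by rewrite ge_min lexx.
have te : t <= e by rewrite ge_min lexx orbT.
have At : A (x + t%:C%C * q).
  have p0 : (0 : R[i]) <= t%:C%C by rewrite lecR ltW.
  have p1 : (t%:C%C : R[i]) <= 1 by rewrite lecR.
  have := cvA y x (Itv01 p0 p1) (mem_set Ay) (mem_set Ax).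
  have -> : x + t%:C%C * q = t%:C%C * y + (1 - t%:C%C) * x by rewrite /q; ring.
  by move=> /set_mem.
have := nx _ At; rewrite -(@ler_pXn2r _ 2) ?nnegrE ?rnorm_ge0 //.
have -> : rnorm (x + t%:C%C * q) ^+ 2 =
    rnorm x ^+ 2 + 2 * t * complex.Re (x^* * q) + t ^+ 2 * rnorm q ^+ 2.
  rewrite !sqr_rnorm; case: (x) (q) => [a1 b1] [a2 b2] /=; ring.
have := sqr_ge0 (rnorm q); set m := complex.Re _; set Q := _ ^+ 2; move: t0 te => t0 te Q0 h.
have : - m <= t * (Q / 2) by rewrite -(ler_pM2l t0); lra.
by move/le_trans; apply; rewrite mulrC ler_wpM2l // divr_ge0.
Qed.

(** The closed convex hull is an intersection, so 0 outside it is missed by a single closed convex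
    set containing the symbol values. *)
Lemma quad_separation X w : ~ quad_set X w ->
  exists p d, 0 < d /\ forall l, X l -> d <= complex.Re (p * gsym w l).
Proof.
move=> nq; have [A [cA clA XA A0]] : exists A : set R[i],
    [/\ convex_set (A : set R[i]^o), closed (A : set R[i]^o),
    [set (l - w) * ((l^*)%R - w) | l in X] `<=` A & ~ A 0].
  apply: contrapT => no; apply: nq => A [[cA clA] XA]; apply: contrapT => A0.
  by apply: no; exists A; split.
have [p [d [d0 h]]] := convex_separation cA clA A0.
by exists p, d; split=> // l Xl; apply: h; apply: XA; exists l.
Qed.

Lemma quad_set_sym X w l : X l -> gsym w l = 0 -> quad_set X w.
Proof. by move=> Xl h A [_ XA]; apply: XA; exists l. Qed.

Lemma distC_far w X (r : R) l : (r%:E < distC w X)%E -> X l -> r < rnorm (w - l).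
Proof.
move=> h Xl; rewrite -lte_fin; apply: lt_le_trans h _.
by apply: ereal_inf_lbound; exists l.
Qed.

Lemma distC_le w X (k : R) l : X l -> rnorm (w - l) <= k -> (distC w X <= k%:E)%E.
Proof.
move=> Xl h; apply: le_trans (_ : (rnorm (w - l))%:E <= _)%E; last by rewrite lee_fin.
by apply: ereal_inf_lbound; exists l.
Qed.

End Separation.

(** * From the bounded to the unbounded operator *)

Section ColumnEigenvectors.
Context {F : fieldType} {n : nat}.

Lemma unitmx_col_ker (A : 'M[F]_n) :
  (forall x : 'cV_n, A *m x = 0 -> x = 0) -> A \in unitmx.
Proof.
move=> h; rewrite -unitmx_tr -row_free_unit -kermx_eq0; apply/rowV0P => v /sub_kermxP hv.
apply: trmx_inj; rewrite trmx0; apply: h.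
by rewrite -[A]trmxK -trmx_mul hv trmx0.
Qed.

(** [eigenvalue] refers to row vectors, whereas [S_mx] acts on coordinate columns; transposition
    preserves the eigenvalues. *)
Lemma eigenvalue_colP (A : 'M[F]_n) a :
  eigenvalue A a <-> exists2 x : 'cV_n, A *m x = a *: x & x != 0.
Proof.
have -> : eigenvalue A a = eigenvalue A^T a.
  rewrite /eigenvalue /eigenspace !kermx_eq0 !row_free_unit -[in LHS]unitmx_tr.
  by rewrite linearB /= tr_scalar_mx.
split=> [/eigenvalueP[v hv v0]|[x hx x0]].
  exists v^T; first by rewrite -[A]trmxK -trmx_mul hv linearZ.
  by apply: contra_neq v0 => /(congr1 trmx); rewrite trmxK trmx0.
apply/eigenvalueP; exists x^T; first by rewrite -trmx_mul hx linearZ.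
by apply: contra_neq x0 => /(congr1 trmx); rewrite trmxK trmx0.
Qed.

End ColumnEigenvectors.

Section OrthProj.
Context {R : realType} {H : completeNormedModType R[i]}.
Variable dot : {dot H for Num.conj}.
Hypothesis dotE : forall x : H, dot x x = `|x| ^+ 2.

(** [orth_proj] picks some vector with the defining property; as there is only one, it is the linear
    map [oproj]. *)
Lemma orth_projE (U : set H) : finite_dim U -> exists P : {linear H -> H},
  is_oproj dot U P /\ forall x, orth_proj dot U x = P x.
Proof.
move=> /(finite_dim_orthonormal dotE)[e [oe Ue]].
have [P hP] : exists P : {linear H -> H}, forall x, P x = oproj dot e x.
  by apply: linear_exists => a u v; exact: oproj_linear.
have hU : is_oproj dot U P.
  split=> [|x|x q]; rewrite Ue ?hP.
  - exact: lspan_subspace.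
  - exact: oproj_in.
  - exact: oproj_orth.
exists P; split=> // x; rewrite /orth_proj; set E := (X in xget _ X).
have Ex : E (P x) by split; [exact: opr_in hU x|move=> q; exact: opr_orth hU x q].
have [Uy hy] : E (xget 0 E) by exact: xgetPex (ex_intro _ _ Ex).
set y := xget 0 E in Uy hy *.
have Uyx : U (y - P x) by exact: (subspaceB (opr_sub hU) Uy (opr_in hU x)).
apply/eqP; rewrite -subr_eq0; apply/eqP; apply: rnorm_eq0; apply/eqP.
rewrite -sqrf_eq0 -(inN (inner_ip dotE)) /ip.
have ed : y - P x = (x - P x) - (x - y) by rewrite [in RHS]opprB [RHS]addrC addrA subrK.
rewrite [X in dot X _]ed linearBl /= (opr_orth hU) // hy // subrr.
by [].
Qed.

End OrthProj.

Section Transfer.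
Context {R : realType} {H : completeNormedModType R[i]}.
Variable dot : {dot H for Num.conj}.
Hypothesis dotE : forall x : H, dot x x = `|x| ^+ 2.
Variable A : operator H.
Hypothesis normalA : normal_op dot A.
Variable alpha : R.
Local Notation al := (alpha%:C%C : R[i]).
Variables (T Ts : {linear H -> H}) (K : R).
Hypothesis BN : bounded_normal dot T Ts K.
Hypothesis TA : forall y, dom A (T y) /\ A (T y) = y + al *: T y.
Hypothesis TK : forall x, dom A x -> T (A x - al *: x) = x.
Local Notation Gop := (Gop T Ts).
Let J := inner_ip dotE.
Let opT : operator H := Operator setT T.
Let d0 : dom A 0. Proof. by have [[[]]] := normalA. Qed.

Lemma eigspace_resolvent w : w != al -> eigspace A w = [set x | T x = (w - al)^-1 *: x].
Proof.
move=> wal; have w0 : w - al != 0 by rewrite subr_eq0.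
apply/seteqP; split=> x /=.
  move=> [dx hx]; rewrite -[in RHS](TK dx) hx -scalerBl (linZ T) scalerA mulVf //.
  by rewrite scale1r.
move=> hx; have ex : x = (w - al) *: T x by rewrite hx scalerA mulfV // scale1r.
have [dx hA] := TA x; split; first by rewrite ex; exact: (domZ normalA).
rewrite {1}ex (opAZ normalA) // hA scalerDr scalerA mulrC -scalerA -ex -scalerDl.
by rewrite subrK.
Qed.

Lemma spectrum_resolvent w : w != al -> spectrum A w -> spectrum opT (w - al)^-1.
Proof.
move=> wal; have w0 : w - al != 0 by rewrite subr_eq0.
set mu := (w - al)^-1; apply: contra_not => rT.
have [k k0 hk] := (resolvent_setP dotE BN mu).1 rT.
have [[_ _ onto] _] := rT.
(* The factorisation [A - w = - (w - al) (T - mu) (A - al)] on [dom A] carries the lower bound and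
   the surjectivity of [T - mu] over to [A - w]. *)
have hB u : dom A u -> A u - w *: u = - (w - al) *: (T (A u - al *: u) - mu *: (A u - al *: u)).
  move=> du; rewrite scaleNr scalerBr scalerA mulfV // scale1r opprB (TK du).
  by rewrite scalerBl opprB addrA subrK.
have low u : dom A u -> k * rnorm (w - al) * rnorm (A u - al *: u) <= rnorm (A u - w *: u).
  move=> du; rewrite (hB u du) (inNZ J) [rnorm (- _)](_ : _ = rnorm (w - al)); last first.
    by rewrite /rnorm normrN.
  by rewrite -mulrA mulrCA ler_wpM2l ?rnorm_ge0.
have kw : 0 < k * rnorm (w - al) by rewrite mulr_gt0 // rnorm_gt0.
have low0 u : dom A u -> A u - w *: u = 0 -> u = 0.
  move=> du hu; have := low u du; rewrite hu rnorm0 pmulr_rle0 // => h.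
  rewrite -(TK du) [A u - _](_ : _ = 0) ?linear0 //; apply: rnorm_eq0; apply/eqP.
  by rewrite eq_le h rnorm_ge0.
have ontoA y : exists x, dom A x /\ A x - w *: x = y.
  have [u _ /= hu] := onto (- mu *: y) Logic.I.
  have [dTu hTu] := TA u; exists (T u); split=> //.
  have e : A (T u) - al *: T u = u by rewrite hTu addrK.
  rewrite (hB _ dTu) e [T u - _]hu scalerA mulrNN mulfV // scale1r //.
split; first split.
- by [].
- move=> u v; rewrite !inE => du dv /= /eqP; rewrite -subr_eq0 => /eqP huv.
  apply/eqP; rewrite -subr_eq0; apply/eqP; apply: low0; first exact: (domB normalA).
  rewrite (opAB normalA) // scalerBr -huv.
  by rewrite !opprB addrACA [RHS]addrACA; congr (_ + _); rewrite addrC.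
- by move=> y _; have [x [dx hx]] := ontoA y; exists x.
exists (K / (k * rnorm (w - al))) => y _.
have [x [dx hx]] := ontoA y.
have [dz ez] := @xgetPex _ 0 [set x | dom (Defs.shift A w) x /\
  Defs.shift A w x = y] (ex_intro _ x (conj dx hx)).
set z := xget _ _ in dz ez; rewrite [resolvent A w y](_ : _ = z) //.
rewrite -ez -(TK dz); apply: le_trans (bn_T BN _) _.
rewrite -mulrA ler_wpM2l ?(bn_K0 BN) // ler_pdivlMl //.
rewrite (TK dz); exact: low.
Qed.

Lemma eigspace_spectrum w x : eigspace A w x -> x != 0 -> spectrum A w.
Proof.
move=> [dx hx] x0 [[_ hi _] _]; move/eqP: x0; apply; apply: hi; rewrite ?inE //=.
by rewrite hx subrr (opA0 normalA) scaler0 subrr.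
Qed.

Lemma conj_al : al^* = al.
Proof. by apply/eqP; rewrite eq_complex /= oppr0 !eqxx. Qed.

(* A kernel vector of [T - conj c] would make [conj c] a spectral point, which is
   not essential since [c] is a zero of its symbol. *)
Lemma disc_eigspace_conj z : z != al ->
  ~ quad_set (essential_spectrum opT) (z - al)^-1 ->
  disc_eigspace A z^* = [set x | T x = ((z - al)^-1)^* *: x].
Proof.
move=> zal nQ; set c := (z - al)^-1.
have zal' : z^* != al by rewrite -conj_al (inj_eq (inv_inj conjCK)).
have cE : (z^* - al)^-1 = c^* by rewrite /c fmorphV rmorphB /= conj_al.
rewrite /disc_eigspace; case: asboolP => [_|nd]; first by rewrite eigspace_resolvent // cE.
apply/esym/seteqP; split=> [x hx|x /= ->]; last by rewrite linear0 scaler0.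
apply: contrapT => /eqP x0; apply: nd.
have Ex : eigspace A z^* x by rewrite eigspace_resolvent // cE.
have sx : spectrum opT c^* := eigen_spectrum dotE BN x0 hx.
have dT : discrete_spectrum opT c^*.
  apply: contrapT => nd; apply: nQ; apply: (@quad_set_sym _ _ _ c^*) => //.
  by rewrite /gsym conjCK subrr mulr0.
have ET : eigspace opT c^* = eigspace A z^*.
  rewrite eigspace_resolvent // cE; apply/seteqP; split=> y /= => [[]|] //.
have [/isolatedP[_ [rho rho0 hrho]] _ fd] := dT.
split; last by rewrite -ET.
  apply/isolatedP; split; first exact: eigspace_spectrum Ex x0.
  have zs : z^* - al != 0 by rewrite subr_eq0.
  have n0 : 0 < rnorm (z^* - al) by exact: rnorm_gt0.
  (* This radius keeps [w - al] at least half as long as [conj z - al], and then its inverse within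
     [rho] of [conj c]. *)
  exists (Num.min (rnorm (z^* - al) / 2) (rho * rnorm (z^* - al) ^+ 2 / 2)).
    by rewrite lt_min !divr_gt0 ?mulr_gt0 ?exprn_gt0.
  move=> w sw; rewrite lt_min => /andP[h1 h2].
  have nw : rnorm (z^* - al) / 2 < rnorm (w - al).
    have := rnormD (z^* - w) (w - al); rewrite addrA subrK {2}/rnorm distrC -/(rnorm _); lra.
  have wal : w != al.
    by apply/eqP => e; move: nw; rewrite e subrr rnorm0; lra.
  have ws : w - al != 0 by rewrite subr_eq0.
  have : (w - al)^-1 = c^*.
    apply: hrho; first exact: spectrum_resolvent.
    rewrite -cE -[(w - al)^-1 - _](_ : (z^* - w) / ((w - al) * (z^* - al)) = _); last first.
      by rewrite -[z^* - w](_ : (z^* - al) - (w - al) = _) ?opprB ?addrA ?subrK //; field; rewrite ws zs.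
    rewrite rnormM rnormV rnormM {1}/rnorm distrC -/(rnorm _) ltr_pdivrMr; last first.
      by rewrite mulr_gt0 // rnorm_gt0.
    apply: lt_le_trans h2 _; rewrite -mulrA ler_pM2l // expr2.
    have := ler_wpM2r (ltW n0) (ltW nw); lra.
  rewrite -cE => /invr_inj /eqP; rewrite subr_eq subrK => /eqP.
  by [].
by move=> E0; move: Ex; rewrite E0 => /eqP; rewrite (negbTE x0).
Qed.

End Transfer.

Section Compression.
Context {R : realType} {H : completeNormedModType R[i]}.
Variable dot : {dot H for Num.conj}.
Hypothesis dotE : forall x : H, dot x x = `|x| ^+ 2.
Variable A : operator H.
Hypothesis normalA : normal_op dot A.
Variable alpha : R.
Local Notation al := (alpha%:C%C : R[i]).
Variables (T Ts : {linear H -> H}) (K : R).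
Hypothesis BN : bounded_normal dot T Ts K.
Hypothesis TA : forall y, dom A (T y) /\ A (T y) = y + al *: T y.
Hypothesis TK : forall x, dom A x -> T (A x - al *: x) = x.
Local Notation Gop := (Gop T Ts).
Let J := inner_ip dotE.
Local Notation As := (adjoint dot A).
Let linA := proj2 (let: And4 h _ _ _ := normalA in h).
Let sdA : Defs.subspace (dom A) := proj1 (let: And4 h _ _ _ := normalA in h).

Lemma Lhat_subspace L : Defs.subspace L -> L `<=` dom A -> Defs.subspace (Lhat A al L).
Proof.
move=> sL LA; split; first by exists 0; [exact: (proj1 sL)|rewrite /= (opA0 normalA) scaler0 subr0].
move=> a _ _ [u Lu <-] [v Lv <-]; exists (a *: u + v); first exact: (proj2 sL).
rewrite /= linA; [|exact: LA|exact: LA].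
by rewrite scalerDr scalerBr opprD addrACA !scalerA (mulrC al).
Qed.

Lemma Lhat_finite_dim L : finite_dim L -> L `<=` dom A -> finite_dim (Lhat A al L).
Proof.
move=> [s Ls] LA; have sL : Defs.subspace L by rewrite Ls; exact: lspan_subspace.
exists [seq A x - al *: x | x <- s]; apply/seteqP; split.
  move=> _ [x Lx <-]; have := Lx; rewrite {1}Ls.
  pose W := [set x | L x /\ lspan [set` [seq A x - al *: x | x <- s]] (A x - al *: x)].
  suff : lspan [set` s] `<=` W by move=> h /h[].
  apply: lspan_min => [|y ys].
    have sM := @lspan_subspace _ _ [set` [seq A x - al *: x | x <- s]].
    split; first by split; [exact: (proj1 sL)|rewrite (opA0 normalA) scaler0 subr0; exact: (proj1 sM)].
    move=> a u v [Lu hu] [Lv hv]; split; first exact: (proj2 sL).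
    have -> : A (a *: u + v) - al *: (a *: u + v) = a *: (A u - al *: u) + (A v - al *: v).
      rewrite linA; [|exact: LA|exact: LA].
      by rewrite scalerDr scalerBr opprD addrACA !scalerA (mulrC al).
    exact: (proj2 sM).
  split; first by rewrite Ls; exact: sub_lspan.
  by apply: sub_lspan => /=; apply: map_f.
apply: lspan_min; first exact: Lhat_subspace.
move=> _ /= /mapP[x xs ->]; exists x => //; rewrite Ls; exact: sub_lspan.
Qed.

(** For [phi = T u] and [y = T q] the left side is [<(A - w) phi, (A - conj w) y>], so the equation
    defining the spectrum of [S_n] becomes one for [G] on [(A - al) L]. *)
Lemma dot_Gop w u q : w != al ->
  dot (u - (w - al) *: T u) (q - (w^* - al) *: T q) =
  (w - al) ^+ 2 * dot (Gop (w - al)^-1 u) q.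
Proof.
move=> wal; have w0 : w - al != 0 by rewrite subr_eq0.
set k := w - al.
have kE : w^* - al = k^* by rewrite /k rmorphB /= conj_al.
rewrite kE; set mu := k^-1.
have -> : Gop mu u = T (Ts u) - mu *: (T u + Ts u) + (mu * mu) *: u.
  transitivity (T (Ts u - mu *: u) - mu *: (Ts u - mu *: u)) => //.
  by rewrite !(linE T); apply: (dotl_eq dotE) => x; rewrite !(dotDl, dotNl, dotZl); ring.
have -> : dot (u - k *: T u) (q - k^* *: T q) =
    dot u q - k * dot u (T q) - k * dot (T u) q + k * k * dot (T u) (T q).
  by rewrite linearBr /= dotZr conjCK !(dotDl, dotNl, dotZl); ring.
rewrite !(dotDl, dotNl, dotZl).
have a1 x y : dot (Ts x) y = dot x (T y) := bn_adj (bounded_normal_adj dotE BN) x y.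
have -> : dot (T u) (T q) = dot (T (Ts u)) q by rewrite (bn_com BN) a1.
rewrite -a1 /mu; field; exact: w0.
Qed.

(* Eliminating the first block of a column eigenvector of [S_mx] leaves
   [<(A - w) phi, (A - w^* ) y> = 0] on [L], and [phi = T u] turns it into the
   equation for [u]. *)
Lemma sigma_S_pencil L m (psi : 'I_m -> H) (P : {linear H -> H}) w :
  is_basis L psi -> L `<=` dom A -> is_oproj dot (Lhat A al L) P ->
  sigma_S dot A psi w <->
  w != al /\ exists u, [/\ Lhat A al L u, u != 0 & P (Gop (w - al)^-1 u) = 0].
Proof.
move=> [free Ls] LA hP.
have sL : Defs.subspace L by rewrite Ls; exact: lspan_subspace.
have Lpsi i : L (psi i) by rewrite Ls; apply: sub_lspan; exists i.
pose B : 'M[R[i]]_m := \matrix_(i, j) dot (A (psi j)) (A (psi i)).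
pose Lm : 'M[R[i]]_m := \matrix_(i, j) dot (A (psi j) + As (psi j)) (psi i).
pose M : 'M[R[i]]_m := \matrix_(i, j) dot (psi j) (psi i).
pose comb (v : 'cV[R[i]]_m) := \sum_j v j 0 *: psi j.
have Lcomb v : L (comb v) by apply: subspace_sum.
have combP x : L x -> exists v, x = comb v.
  move=> Lx; apply: (@lspan_min _ _ (range psi) [set x | exists v, x = comb v]).
  - split; first by exists 0; rewrite /comb big1 // => j _; rewrite mxE scale0r.
    move=> a _ _ [u ->] [v ->]; exists (a *: u + v); rewrite /comb scaler_sumr -big_split.
    by apply: eq_bigr => j _; rewrite !mxE scalerDl scalerA.
  - move=> _ [j _ <-]; exists (delta_mx j 0); rewrite /comb (bigD1 j) //= mxE !eqxx scale1r.
    by rewrite big1 ?addr0 // => i ij; rewrite mxE (negbTE ij) scale0r.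
  - by rewrite -Ls.
have comb0 v : comb v = 0 -> v = 0.
  by move=> h; apply/colP => i; rewrite mxE; exact: (free (fun j => v j 0)).
have Acomb v : A (comb v) = \sum_j v j 0 *: A (psi j).
  suff [] : dom A (comb v) /\ A (comb v) = \sum_j v j 0 *: A (psi j) by [].
  rewrite /comb; elim/big_rec2: _ => [|j y x _ [dx hx]].
    by split; [exact: (proj1 sdA)|exact: opA0 normalA].
  split; first by apply: (proj2 sdA) => //; exact: LA.
  by rewrite linA ?hx //; exact: LA.
have sumdot (f : 'I_m -> H) (v : 'cV[R[i]]_m) y : \sum_j v j 0 * dot (f j) y = dot (\sum_j v j 0 *: f j) y.
  by rewrite linear_sumlz; apply: eq_bigr => j _; rewrite -dotZl.
have mulE (f : 'I_m -> H) (g : 'I_m -> H) (v : 'cV_m) i :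
    ((\matrix_(i, j) dot (f j) (g i)) *m v) i 0 = dot (\sum_j v j 0 *: f j) (g i).
  by rewrite mxE -sumdot; apply: eq_bigr => j _; rewrite mxE mulrC.
have dL x : L x -> dom A x := LA x.
have orthL x : (forall i, dot x (psi i) = 0) -> forall y, L y -> dot x y = 0.
  move=> h y; rewrite Ls; apply: dot_lspan0 => _ [i _ <-]; exact: h.
(* The Gram matrix of a basis: a combination orthogonal to all basis vectors is orthogonal to
   itself. *)
have Mu : M \in unitmx.
  apply: unitmx_col_ker => v Mv; apply: comb0.
  have h i : dot (comb v) (psi i) = 0 by rewrite -(mulE psi psi v i) -/M Mv mxE.
  have := orthL _ h _ (Lcomb v); rewrite dotE => /eqP; rewrite expf_eq0 /= => /eqP.
  exact: normr0_eq0.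
have entry v i : ((w *: Lm - B - (w * w) *: M) *m v) i 0 =
    - dot (A (comb v) - w *: comb v) (A (psi i) - w^* *: psi i).
  have -> : ((w *: Lm - B - (w * w) *: M) *m v) i 0 =
      w * (Lm *m v) i 0 - (B *m v) i 0 - w * w * (M *m v) i 0.
    rewrite !mulmxBl -!scalemxAl; move: (Lm *m v) (B *m v) (M *m v) => a b c.
    by rewrite !mxE.
  rewrite (mulE _ _ v i) (mulE (A \o psi) (A \o psi) v i) (mulE _ _ v i) /=.
  have -> : \sum_j v j 0 *: (A (psi j) + As (psi j)) =
      A (comb v) + \sum_j v j 0 *: As (psi j).
    by rewrite Acomb -big_split; apply: eq_bigr => j _; rewrite scalerDr.
  have -> : dot (A (comb v) + \sum_j v j 0 *: As (psi j)) (psi i) =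
      dot (A (comb v)) (psi i) + dot (comb v) (A (psi i)).
    rewrite linearDl /=; congr (_ + _).
    rewrite -!sumdot; apply: eq_bigr => j _; congr (_ * _).
    have := adjointP (dL _ (Lpsi i)) (dom_adj dotE normalA (dL _ (Lpsi j))).
    by move=> e; rewrite [LHS]dotC [RHS]dotC e.
  rewrite -Acomb -/(comb v).
  rewrite linearBr /= dotZr conjCK !(dotDl, dotNl, dotZl); ring.
have Sx (x : 'cV_(m + m)) : S_mx dot A psi *m x = w *: x <->
    (w *: Lm - B - (w * w) *: M) *m dsubmx x = 0 /\ usubmx x = w *: dsubmx x.
  rewrite -[x]vsubmxK col_mxKu col_mxKd; set u := usubmx x; set v := dsubmx x.
  rewrite /S_mx -/B -/Lm -/M mulmx_block !mul0mx !mulmx0 !addr0 !add0r mul_block_col.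
  rewrite mulVmx // mul0mx addr0 mul1mx scale_col_mx; split.
    move=> /eq_col_mx[h1 h2]; split=> //; move: h1; rewrite h2.
    move=> /(congr1 (mulmx M)); rewrite mulmxDr !mulmxA mulmxV // !mul1mx => h1.
    rewrite !mulmxBl -!scalemxAl mulNmx in h1 *.
    rewrite -!scalemxAr scalerA in h1.
    by rewrite h1 subrr.
  move=> [h1 h2]; congr col_mx; last by rewrite h2.
  rewrite h2; move: h1; rewrite !mulmxBl -!scalemxAl => /eqP; rewrite subr_eq0 => /eqP h1.
  rewrite -[RHS](mulKmx Mu) -!mulmxA -mulmxDr mulNmx -[Lm *m _]scalemxAr h1.
  by rewrite -(scalemxAr w M (w *: v)) -(scalemxAr w M v) scalerA.
have sig : sigma_S dot A psi w <-> exists phi, [/\ L phi, phi != 0 &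
    forall y, L y -> dot (A phi - w *: phi) (A y - w^* *: y) = 0].
  rewrite /sigma_S /=; split.
    move=> /eigenvalue_colP[x /Sx[h1 h2] x0]; exists (comb (dsubmx x)); split=> //.
      apply: contra_neq x0 => /comb0 d0; rewrite -[x]vsubmxK h2 d0 scaler0.
      exact: col_mx0.
    move=> y /combP[v' ->].
    have hi i : dot (A (comb (dsubmx x)) - w *: comb (dsubmx x)) (A (psi i) - w^* *: psi i) = 0.
      by apply/eqP; rewrite -oppr_eq0 -entry h1 mxE.
    move: (A (comb (dsubmx x)) - _) hi => D hi.
    rewrite Acomb /comb scaler_sumr -sumrB linear_sumr /= big1 // => j _.
    by rewrite scalerA mulrC -scalerA -scalerBr dotZr hi mulr0.
  move=> [phi [/combP[v ->] v0 hv]]; apply/eigenvalue_colP.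
  exists (col_mx (w *: v) v).
    apply/Sx; rewrite col_mxKu col_mxKd; split=> //; apply/colP => i.
    by rewrite entry mxE hv ?oppr0.
  apply: contra_neq v0 => h; have -> : v = 0 by rewrite -[v](col_mxKd (w *: v)) h linear0.
  by rewrite /comb big1 // => j _; rewrite mxE scale0r.
rewrite sig; split.
  move=> [phi [Lphi phi0 h]].
  set u := A phi - al *: phi.
  have Tu : T u = phi by apply: TK; exact: dL.
  have u0 : u != 0 by apply: contra_neq phi0 => e; rewrite -Tu e linear0.
  have Uu : Lhat A al L u by exists phi.
  (* At [w = al] the equation tested with [phi] itself would say [|u| = 0], as [al] is real. *)
  have wal : w != al.
    apply/eqP => e; have := h _ Lphi; rewrite e conj_al -/u dotE => /eqP.
    by rewrite expf_eq0 /= normr_eq0 (negbTE u0).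
  split=> //; exists u; split=> //.
  (* The equation is tested with [y = T (P g)], which lies in [L], so that [<g, P g> = |P g|^2]
     vanishes. *)
  apply/eqP; rewrite -normr_eq0 -sqrf_eq0 -dotE; apply/eqP.
  set g := Gop _ u; have [y Ly ey] := opr_in hP g.
  have Ty : T (P g) = y by rewrite -ey; apply: TK; exact: dL.
  have -> : dot (P g) (P g) = dot g (P g).
    by have := opr_orth hP g (opr_in hP g); rewrite linearBl /= => /eqP; rewrite subr_eq0 => /eqP ->.
  have k0 : (w - al) ^+ 2 != 0 by rewrite expf_neq0 // subr_eq0.
  apply: (mulfI k0); rewrite mulr0 -dot_Gop // Tu Ty.
  have -> : u - (w - al) *: phi = A phi - w *: phi.
    by rewrite /u scalerBl opprB addrA subrK.
  have -> : P g - (w^* - al) *: y = A y - w^* *: y.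
    by rewrite -ey /= scalerBl opprB addrA subrK.
  exact: h.
move=> [wal [u [[phi Lphi eu] u0 Pu]]]; exists phi.
have Tu : T u = phi by rewrite -eu; apply: TK; exact: dL.
split=> //; first by apply: contra_neq u0 => e; rewrite -eu /= e (opA0 normalA) scaler0 subr0.
move=> y Ly; pose q := A y - al *: y.
have Uq : Lhat A al L q by exists y.
have Tq : T q = y by apply: TK; exact: dL.
have -> : A phi - w *: phi = u - (w - al) *: T u.
  by rewrite Tu -eu /= scalerBl opprB addrA subrK.
have -> : A y - w^* *: y = q - (w^* - al) *: T q.
  by rewrite Tq scalerBl opprB addrA subrK.
rewrite dot_Gop //; have := opr_orth hP (Gop (w - al)^-1 u) Uq.
by rewrite Pu subr0 => ->; rewrite mulr0.
Qed.

End Compression.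

(** * Distances, gaps and approximation errors *)

Section DistDelta.
Context {R : realType} {V : zmodType}.
Variable N : V -> R.
Hypothesis N0 : forall v, 0 <= N v.
Implicit Types (L M : set V) (v u : V).

Let lb0 M v : lbound [set N (v - u) | u in M] 0.
Proof. by move=> _ [u _ <-]. Qed.

Lemma dist_le M v u : M u -> dist N v M <= N (v - u).
Proof. by move=> Mu; apply: ge_inf; [exists 0; exact: lb0|exists u]. Qed.

Lemma dist_ge0 M v : M 0 -> 0 <= dist N v M.
Proof. by move=> M0; apply: lb_le_inf; [exists (N (v - 0)), 0|exact: lb0]. Qed.

Lemma dist_near M v (tau : R) : M 0 -> 0 < tau ->
  exists2 u, M u & N (v - u) < dist N v M + tau.
Proof.
move=> M0 tau0.
have [|_ [u Mu <-] h] := @inf_adherent _ [set N (v - u) | u in M] _ tau0; last by exists u.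
by split; [exists (N (v - 0)), 0|exists 0; exact: lb0].
Qed.

Let ubD L M : M 0 -> ubound [set dist N v M | v in [set v | L v /\ N v = 1]] 1.
Proof.
by move=> M0 _ [v [_ v1] <-]; rewrite -v1 -[v in leRHS]subr0; exact: dist_le.
Qed.

Lemma dist_le_delta L M v : M 0 -> L v -> N v = 1 -> dist N v M <= delta N L M.
Proof. by move=> M0 Lv v1; apply: ub_le_sup; [exists 1; exact: ubD|exists v]. Qed.

Lemma delta_ge0 L M : M 0 -> 0 <= delta N L M.
Proof.
move=> M0; have [[v [Lv v1]]|ne] := pselect (exists v, L v /\ N v = 1).
  exact: le_trans (dist_ge0 v M0) (dist_le_delta M0 Lv v1).
rewrite /delta (_ : [set _ | _ in _] = set0) ?sup0 //.
by apply/seteqP; split=> // y [v hv _]; case: ne; exists v.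
Qed.

Lemma delta_le L M (C : R) : 0 <= C -> (forall v, L v -> N v = 1 ->
  forall tau : R, 0 < tau -> exists2 u, M u & N (v - u) <= C + tau) ->
  delta N L M <= C.
Proof.
move=> C0 h; have [[v0 hv0]|ne] := pselect (exists v, L v /\ N v = 1).
  apply: ge_sup; first by exists (dist N v0 M), v0.
  move=> _ [v [Lv v1] <-]; apply/ler_addgt0Pr => tau tau0.
  by have [u Mu hu] := h v Lv v1 tau tau0; apply: le_trans (dist_le _ Mu) hu.
rewrite /delta (_ : [set _ | _ in _] = set0) ?sup0 //.
by apply/seteqP; split=> // y [v hv _]; case: ne; exists v.
Qed.

End DistDelta.

Lemma inv_close {R : realType} (a : R[i]) (e : R) : a != 0 -> 0 < e ->
  exists2 d : R, 0 < d & forall b, rnorm (b - a) < d ->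
    [/\ b != 0, rnorm a / 2 <= rnorm b & rnorm (b^-1 - a^-1) < e].
Proof.
move=> a0 e0; have na := rnorm_gt0 a0.
exists (Num.min (rnorm a / 2) (e * rnorm a ^+ 2 / 2)).
  by rewrite lt_min !divr_gt0 ?mulr_gt0 ?exprn_gt0.
move=> b; rewrite lt_min => /andP[h1 h2].
have nb : rnorm a / 2 < rnorm b.
  have := rnormD (a - b) b; rewrite subrK {2}/rnorm distrC -/(rnorm _); lra.
have b0 : b != 0 by apply/eqP => b0; move: nb; rewrite b0 rnorm0; lra.
split=> //; first exact: ltW.
have -> : b^-1 - a^-1 = - (b - a) / (b * a) by field; rewrite a0 b0.
rewrite rnormM rnormV rnormM {1}/rnorm normrN -/(rnorm _) ltr_pdivrMr; last first.
  by rewrite mulr_gt0 // rnorm_gt0.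
apply: lt_le_trans h2 _; rewrite -mulrA ler_pM2l // expr2.
have := ler_wpM2r (ltW na) (ltW nb); lra.
Qed.

Lemma cvg_complexP {R : realType} (u : nat -> R[i]^o) (x : R[i]^o) :
  u @ \oo --> x <-> forall e : R, 0 < e ->
    exists N, forall n, (N <= n)%N -> rnorm (x - u n : R[i]) < e.
Proof.
split=> [/cvgrPdist_lt h e e0|h].
  have [|N _ hN] := h (e%:C%C); first by rewrite ltcR.
  by exists N => n /hN /=; rewrite rnormE ltcR.
apply/cvgrPdist_lt => e e0.
have eR : e = (complex.Re e)%:C%C by rewrite RRe_real // gtr0_real.
have [|N hN] := h (complex.Re e); first by rewrite -ltcR -eR.
by exists N => // n /= /hN; rewrite rnormE {2}eR ltcR.
Qed.

Section Approximation.
Context {R : realType} {H : completeNormedModType R[i]}.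
Variable dot : {dot H for Num.conj}.
Hypothesis dotE : forall x : H, dot x x = `|x| ^+ 2.
Variable A : operator H.
Hypothesis normalA : normal_op dot A.
Variable alpha : R.
Local Notation al := (alpha%:C%C : R[i]).
Variables (T Ts : {linear H -> H}) (K : R).
Hypothesis BN : bounded_normal dot T Ts K.
Hypothesis TA : forall y, dom A (T y) /\ A (T y) = y + al *: T y.
Local Notation gn := (graph_norm A).
Let J := inner_ip dotE.

Lemma gn_ge0 x : 0 <= gn x. Proof. exact: sqrtr_ge0. Qed.

Lemma gn_le x : gn x <= rnorm (A x) + rnorm x.
Proof. exact: (pair_le (A x, x)). Qed.

Lemma gn_act x : rnorm (A x) <= gn x.
Proof. exact: (le_pair1 (A x, x)). Qed.

Lemma gn_norm x : rnorm x <= gn x.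
Proof. exact: (le_pair2 (A x, x)). Qed.

Lemma gnZ a x : dom A x -> gn (a *: x) = rnorm a * gn x.
Proof.
move=> dx; rewrite /graph_norm (opAZ normalA) // !(inNZ J) !exprMn -mulrDr.
by rewrite sqrtrM ?sqr_ge0 // sqrtr_sqr ger0_norm ?rnorm_ge0.
Qed.

Lemma shift_gn x : rnorm (A x - al *: x) <= (1 + `|alpha|) * gn x.
Proof.
apply: le_trans (inNB_le J _ _) _; rewrite (inNZ J) rnormC mulrDl mul1r.
by apply: lerD; [exact: gn_act|rewrite ler_wpM2l ?gn_norm].
Qed.

Variables (L : set H) (P : {linear H -> H}).
Hypothesis sL : Defs.subspace L.
Hypothesis LA : L `<=` dom A.
Hypothesis hP : is_oproj dot (Lhat A al L) P.

Lemma proj_error x y p : dom A y -> A y - al *: y = x -> L p ->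
  rnorm (x - P x) <= (1 + `|alpha|) * gn (y - p).
Proof.
move=> dy <- Lp; apply: le_trans (opr_best dotE hP _ (_ : Lhat A al L (A p - al *: p))) _.
  by exists p.
have -> : A y - al *: y - (A p - al *: p) = A (y - p) - al *: (y - p).
  rewrite (opAB normalA) //; last exact: LA.
  by rewrite scalerBr !opprB addrACA [RHS]addrACA; congr (_ + _); rewrite addrC.
exact: shift_gn.
Qed.

Lemma proj_error_dist x (tau : R) : 0 < tau ->
  rnorm (x - P x) <= (1 + `|alpha|) * (dist gn (T x) L + tau).
Proof.
move=> tau0; have [dT hT] := TA x.
have [p Lp hp] := dist_near gn_ge0 (T x) (proj1 sL) tau0.
have eT : A (T x) - al *: T x = x by rewrite hT addrK.
apply: le_trans (proj_error dT eT Lp) _.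
by rewrite ler_wpM2l ?addr_ge0 // ltW.
Qed.

(** Write [b = (A - al) (T b)] and normalise [T b] in the graph norm. The constant is the product of
    bounds for [A - al] from the graph norm to [H] and for [T] from [H] to the graph norm. *)
Lemma proj_error_delta (F : set H) b : Defs.subspace F -> F `<=` dom A -> F (T b) ->
  rnorm (b - P b) <= (1 + `|alpha|) * (1 + (`|alpha| + 1) * K) * delta gn F L * rnorm b.
Proof.
move=> sF FA Fb; have [dT hT] := TA b.
have K0 := bn_K0 BN; have a0 := normr_ge0 alpha.
have eT : A (T b) - al *: T b = b by rewrite hT addrK.
have [g0|g0] := eqVneq (gn (T b)) 0.
  have b0 : b = 0.
    have Tb0 : T b = 0.
      by apply: rnorm_eq0; apply/eqP; rewrite eq_le rnorm_ge0 andbT -g0 gn_norm.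
    by rewrite -eT Tb0 (opA0 normalA) scaler0 subr0.
  by rewrite b0 linear0 subr0 rnorm0 mulr0.
have gp : 0 < gn (T b) by rewrite lt_def g0 gn_ge0.
have gT : gn (T b) <= (1 + (`|alpha| + 1) * K) * rnorm b.
  apply: le_trans (gn_le _) _; rewrite hT.
  apply: le_trans (lerD (inND J _ _) (lexx _)) _; rewrite (inNZ J) rnormC.
  have h := bn_T BN b; have := ler_wpM2l a0 h; lra.
pose t : R[i] := (gn (T b))%:C%C; pose v := t^-1 *: T b.
have nt : rnorm t = gn (T b) by rewrite rnormC ger0_norm ?gn_ge0.
have t0 : t != 0 by apply/eqP => e; move: gp; rewrite -nt e rnorm0 ltxx.
have v1 : gn v = 1 by rewrite gnZ // rnormV nt mulVf.
have Fv : F v by exact: (sub_scale sF).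
have hv : forall tau : R, 0 < tau ->
    rnorm (b - P b) <= (1 + `|alpha|) * (gn (T b) * (delta gn F L + tau)).
  move=> tau tau0; have [p Lp hp] := dist_near gn_ge0 v (proj1 sL) tau0.
  apply: le_trans (proj_error dT eT (sub_scale sL t Lp)) _.
  rewrite ler_wpM2l ?addr_ge0 //.
  have -> : T b - t *: p = t *: (v - p).
    by rewrite scalerBr /v scalerA mulfV // scale1r.
  rewrite gnZ ?nt; last by apply: (domB normalA); [exact: FA|exact: LA].
  rewrite ler_wpM2l ?gn_ge0 //; apply: le_trans (ltW hp) _; rewrite lerD2r.
  exact: (dist_le_delta gn_ge0 (proj1 sL) Fv v1).
have D0 : 0 <= delta gn F L := delta_ge0 gn_ge0 F (proj1 sL).
apply: le_trans (_ : (1 + `|alpha|) * (gn (T b) * delta gn F L) <= _); last first.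
  rewrite -!mulrA ler_wpM2l ?addr_ge0 // [leRHS]mulrCA mulrC ler_wpM2l //.
rewrite -subr_le0; apply: (@le0_of_small _ _ ((1 + `|alpha|) * gn (T b))) => e e0.
have := hv e e0; lra.
Qed.

End Approximation.

Section SpectrumAdjoint.
Context {R : realType} {H : completeNormedModType R[i]}.
Variable dot : {dot H for Num.conj}.
Hypothesis dotE : forall x : H, dot x x = `|x| ^+ 2.
Variables (T Ts : {linear H -> H}) (K : R).
Hypothesis BN : bounded_normal dot T Ts K.

Lemma spectrum_adjoint l : spectrum (Operator setT T) l -> spectrum (Operator setT Ts) l^*.
Proof.
apply: contra_not => /(resolvent_setP dotE (bounded_normal_adj dotE BN))[k k0 hk].
apply/(resolvent_setP dotE BN); exists k => // v.
by rewrite -(norm_shift_adj dotE BN).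
Qed.

Lemma operator_eq (B : operator H) (f : H -> H) : B = f :> (H -> H) -> dom B = setT ->
  B = Operator setT f.
Proof. by case: B => d a /= -> ->. Qed.

Lemma M_spaceP (al z : R[i]) (s : seq H) v : M_space al z s v ->
  if z \is Num.real then lspan [set` s] v.1 /\ lspan [set` s] v.2
  else lspan [set` s] v.2 /\ v.1 = (z - al)^-1 *: v.2.
Proof.
have sS := @lspan_subspace _ _ [set` s].
rewrite /M_space; case: ifP => _.
  apply: (@lspan_min _ _ _ [set v | lspan [set` s] v.1 /\ lspan [set` s] v.2]).
    split; first by split; exact: (proj1 sS).
    by move=> a u w [h1 h2] [h3 h4]; split; apply: (proj2 sS).
  by move=> _ [] [x xs <-]; split=> //=; [exact: (proj1 sS)|exact: sub_lspan|
    exact: sub_lspan|exact: (proj1 sS)].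
apply: (@lspan_min _ _ _ [set v | lspan [set` s] v.2 /\ v.1 = (z - al)^-1 *: v.2]).
  split; first by split; [exact: (proj1 sS)|rewrite /= scaler0].
  move=> a u w [h1 h2] [h3 h4]; split; first exact: (proj2 sS).
  by rewrite /= h2 h4 scalerDr !scalerA mulrC.
by move=> _ [x xs <-]; split=> //=; exact: sub_lspan.
Qed.

Lemma M_space_real (al z : R[i]) (s : seq H) x y : z \is Num.real ->
  lspan [set` s] x -> lspan [set` s] y -> M_space al z s (x, y).
Proof.
rewrite /M_space => -> hx hy; set X := (_ `|` _).
have sX := @lspan_subspace _ _ X.
have -> : (x, y) = (x, 0) + (0, y) :> H * H by congr (_, _); rewrite ?addr0 ?add0r.
apply: (subD sX).
  apply: (@lspan_min _ _ [set` s] [set x | lspan X (x, 0)] _ _ x hx) => [|u us].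
    split=> [|a u v h1 h2] /=; first exact: (proj1 sX).
    have := proj2 sX a _ _ h1 h2; congr (lspan _ _); congr (_, _).
    by rewrite /= scaler0 addr0.
  by apply: sub_lspan; right; exists u.
apply: (@lspan_min _ _ [set` s] [set x | lspan X (0, x)] _ _ y hy) => [|u us].
  split=> [|a u v h1 h2] /=; first exact: (proj1 sX).
  have := proj2 sX a _ _ h1 h2; congr (lspan _ _); congr (_, _).
  by rewrite /= scaler0 addr0.
by apply: sub_lspan; left; exists u.
Qed.

Lemma M_space_nonreal (al z : R[i]) (s : seq H) y : z \isn't Num.real ->
  lspan [set` s] y -> M_space al z s ((z - al)^-1 *: y, y).
Proof.
rewrite /M_space => /negbTE-> hy; set X := [set _ | _ in _].
have sX := @lspan_subspace _ _ X.
apply: (@lspan_min _ _ [set` s] [set y | lspan X ((z - al)^-1 *: y, y)] _ _ y hy) => [|u us].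
  split=> [|a u v h1 h2] /=; first by rewrite scaler0; exact: (proj1 sX).
  have := proj2 sX a _ _ h1 h2; congr (lspan _ _); congr (_, _).
  by rewrite /= scalerDr !scalerA mulrC.
by apply: sub_lspan; exists u.
Qed.

End SpectrumAdjoint.

(** * Assembly of the estimates and return from the resolvent to [A] *)

Theorem theorem6p1 (R : realType) (H : completeNormedModType R[i])
    (dot : {dot H for Num.conj})
    (dotE : forall x : H, dot x x = `|x| ^+ 2)
    (infinite_dim : ~ finite_dim [set: H])
    (A : operator H) (normalA : normal_op dot A)
    (unboundedA : ~ bounded_op A)
    (alpha : R) (alphaP : resolvent_set A alpha%:C%C)
    (Ln : nat -> set H) (LnP : Lambda A Ln)
    (m : nat -> nat) (psi : forall n, 'I_(m n) -> H)
    (psiP : forall n, is_basis (Ln n) (psi n))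
    (z : R[i]) (zP : discrete_spectrum A z)
    (zQ : ~ quad_set (essential_spectrum (resolvent A alpha%:C%C))
              (z - alpha%:C%C)^-1)
    (r : R) (rP : admissible dot A alpha%:C%C z r)
    (phi phi' : seq H)
    (phi_on : orthonormal dot phi) (phi'_on : orthonormal dot phi')
    (phiP : disc_eigspace A z = lspan [set` phi])
    (phi'P : disc_eigspace A (Num.conj z) = lspan [set` phi']) :
  let eps n := delta (graph_norm A) (disc_eigspace2 A z) (Ln n) in
  [/\ exists K : R, \forall n \near \oo,
        gap pair_norm
          (M_hat dot A alpha%:C%C (Ln n)
             (z - alpha%:C%C)^-1 r)
          (M_space alpha%:C%C z (phi ++ phi')) <= K * eps n,
      exists K : R, \forall n \near \oo,
        (distC z (sigma_S dot A (psi n)) <= (K * eps n)%:E)%E &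
      isolated (lim_set (fun n => sigma_S dot A (psi n)) : set R[i]^o) z].
Proof.
pose al : R[i] := alpha%:C%C; pose c : R[i] := (z - al)^-1.
have [T [Ts [K [BN [rA dA] [rAs dAs] TA TK]]]] := resolvent_bounded_normal dotE normalA alphaP.
have opE : resolvent A al = Operator setT T := operator_eq rA dA.
have opEs : resolvent (adjoint dot A) al = Operator setT Ts := operator_eq rAs dAs.
have [r0 rfar _ _] := rP; rewrite -/al opE opEs -/c in rfar zQ.
have J := inner_ip dotE; have J2 := inner_ip2 dotE.
have zal : z != al.
  by apply/eqP => e; have [[/set_mem + _] _ _] := zP; rewrite e; apply.
have zal0 : z - al != 0 by rewrite subr_eq0.
have c0 : c != 0 by rewrite invr_eq0.
have nc := rnorm_gt0 c0.
(* The radius is strictly smaller than the distance from [c] to the rest of these sets, so even the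
   closed disc meets them at most in [c]. *)
have far l : quad_set (essential_spectrum (Operator setT T)) l \/
    spectrum (Operator setT T) l \/ spectrum (Operator setT Ts) l ->
    rnorm (l - c) <= r -> l = c.
  move=> hl lr; apply: contrapT => lc.
  have : r < rnorm (c - l).
    by apply: (distC_far rfar); split=> //; case: hl => [|[]] h; [left; left|left; right|right].
  by rewrite ltNge {1}/rnorm distrC lr.
have separated l : rnorm (l - c) <= r -> exists p d, 0 < d /\
    forall x, essential_spectrum (Operator setT T) x -> d <= complex.Re (p * gsym l x).
  move=> lr; apply: quad_separation => Ql; apply: zQ.
  by have <- : l = c by apply: far => //; left.
(* A zero of the symbol means [l = x] or [l = conj x]; the second point belongs to the spectrum of
   [Ts], which is why that set enters the choice of [r]. *)
have disc l x : rnorm (l - c) <= r -> spectrum (Operator setT T) x -> gsym l x = 0 -> l = c.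
  move=> lr sx /eqP; rewrite mulf_eq0 !subr_eq0 => /orP[]/eqP e; apply: far => //; right.
    by left; rewrite -e.
  by right; rewrite -e; exact: (spectrum_adjoint dotE BN sx).
have LnA n : Ln n `<=` dom A := proj2 (LnP.1 n).
have sLn n : Defs.subspace (Ln n) by rewrite (proj2 (psiP n)); exact: lspan_subspace.
pose Un n := Lhat A al (Ln n).
have fUn n : finite_dim (Un n) := Lhat_finite_dim normalA alpha (proj1 (LnP.1 n)) (LnA n).
have exP n := orth_projE dotE (fUn n).
have [P hP'] := choice exP.
have hP n : is_oproj dot (Un n) (P n) := proj1 (hP' n).
have PE n x : orth_proj dot (Un n) x = P n x := proj2 (hP' n) x.
(* Approximation of [T x] by the [Ln n] in the graph norm gives convergence of the projections at
   [x = (A - al) (T x)]. *)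
have cP x (e : R) : 0 < e -> exists N, forall n, (N <= n)%N -> rnorm (x - P n x) < e.
  move=> e0; have a1 : 0 < 1 + `|alpha| by rewrite ltr_pwDl.
  have e2 : 0 < e / (1 + `|alpha|) / 2 by rewrite !divr_gt0.
  have /cvgrPdist_lt/(_ _ e2)[N _ hN] := LnP.2 _ (proj1 (TA x)).
  exists N => n /hN /=; rewrite sub0r normrN => h.
  apply: le_lt_trans (proj_error_dist dotE normalA TA (sLn n) (LnA n) (hP n) x e2) _.
  rewrite mulrC -ltr_pdivlMr //; have := le_lt_trans (ler_norm _) h; lra.
have exS n : exists S : {linear (H * H)%type -> (H * H)%type},
    forall v, S v = (P n (T v.1 + Ts v.1) - P n (T (Ts v.2)), v.1).
  apply: linear_exists => a u v; congr (_, _) => /=.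
  by rewrite !(linE T) !(linE Ts) !(linE T) !(linE (P n)); apply: (dotl_eq dotE) => x;
    rewrite !(dotDl, dotNl, dotZl); ring.
have [S hS] := choice exS.
pose Mh n := spectral_sub (S n) [set v | Un n v.1 /\ Un n v.2] [set mu | rnorm (mu - c) < r].
have MhE n : M_hat dot A al (Ln n) c r = Mh n.
  have SE v : S_hat dot A al (Ln n) v = S n v by rewrite hS /S_hat rA rAs !PE.
  rewrite /M_hat /Mh; congr lspan; apply/seteqP.
  split=> v [mu hmu]; [case=> h1 h2 [k hk]|case=> -[h1 h2] [k hk]];
    exists mu => //; split=> //; exists k; move: hk; rewrite fact_nseq.
    by under eq_fun do rewrite SE.
  by under [X in _ -> iter _ X _ = _]eq_fun do rewrite SE.
have [e0 [C [N0 [oe0 ker he0 C0 uni]]]] := uniform_pencil dotE BN r0 separated disc hP cP hS fUn.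
pose F := disc_eigspace2 A z.
have Ez : disc_eigspace A z = [set x | T x = c *: x].
  by rewrite /disc_eigspace asboolT // (eigspace_resolvent normalA TA TK).
have Ezc : disc_eigspace A z^* = [set x | T x = c^* *: x].
  exact: (disc_eigspace_conj dotE normalA BN TA TK zal zQ).
have sF : Defs.subspace F := @lspan_subspace _ _ _.
have sK : Defs.subspace [set b | Gop T Ts c b = 0].
  have [G hG] := Gop_linear T Ts c.
  split=> [|a u v] /=; rewrite -!hG ?linear0 // => hu hv.
  by rewrite linearP /= hu hv scaler0 addr0.
have Fker b : F b <-> Gop T Ts c b = 0.
  split.
    apply: (lspan_min sK) => x []; rewrite ?Ez ?Ezc /= => hx; rewrite (Gop_eig dotE BN _ hx).
      by rewrite /gsym subrr mul0r scale0r.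
    by rewrite /gsym conjCK subrr mulr0 scale0r.
  move=> /ker; apply: (lspan_min sF) => x /he0[l hx /eqP].
  rewrite mulf_eq0 !subr_eq0 => /orP[]/eqP e; apply: sub_lspan.
    by left; rewrite Ez /= -e.
  by right; rewrite Ezc /= -e conjCK.
have phiF : lspan [set` phi ++ phi'] = F.
  apply/seteqP; split; apply: lspan_min; [exact: sF| |exact: lspan_subspace|].
    move=> x /=; rewrite mem_cat => /orP[] xp; apply: sub_lspan.
      by left; rewrite phiP; exact: sub_lspan.
    by right; rewrite phi'P; exact: sub_lspan.
  move=> x [].
    by rewrite phiP; apply: lspan_mono => y /= yp; rewrite mem_cat yp.
  by rewrite phi'P; apply: lspan_mono => y /= yp; rewrite mem_cat yp orbT.
have FA : F `<=` dom A.
  apply: lspan_min; first by have [[]] := normalA.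
  move=> x []; rewrite /disc_eigspace; case: asboolP => _; try by case.
    by move=> ->; have [[[]]] := normalA.
  by move=> ->; have [[[]]] := normalA.
have FT b : F b -> F (T b).
  apply: (@lspan_min _ _ _ [set b | F (T b)]) => [|x hx].
    split=> [|a u v hu hv] /=; first by rewrite linear0; exact: (proj1 sF).
    by rewrite linearP; exact: (proj2 sF).
  have Fx : F x by exact: sub_lspan.
  by case: hx; rewrite ?Ez ?Ezc /= => ->; exact: (sub_scale sF).
pose eps n := delta (graph_norm A) F (Ln n).
pose Ce := (1 + `|alpha|) * (1 + (`|alpha| + 1) * K).
have Ce0 : 0 <= Ce.
  have := bn_K0 BN; have a0 := normr_ge0 alpha => K0.
  by rewrite /Ce mulr_ge0 // ?addr_ge0 ?mulr_ge0 ?addr_ge0.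
have eps0 n : 0 <= eps n := delta_ge0 (@gn_ge0 _ _ A) F (proj1 (sLn n)).
have eta0 n : 0 <= Ce * eps n by exact: mulr_ge0.
have heta n b : Gop T Ts c b = 0 -> rnorm (b - P n b) <= Ce * eps n * rnorm b.
  move=> /Fker Fb.
  exact: (proj_error_delta dotE normalA BN TA (sLn n) (LnA n) (hP n) sF FA (FT b Fb)).
have small (d : R) : 0 < d -> exists N, forall n, (N <= n)%N ->
    forall b, Gop T Ts c b = 0 -> rnorm (b - P n b) <= d * rnorm b.
  move=> d0; have [N hN] := oproj_approx dotE cP oe0 d0.
  by exists N => n Nn b /ker; exact: hN.
have realE : (z \is Num.real) = (c^* == c).
  rewrite /c fmorphV rmorphB /= (conj_al alpha) (inj_eq invr_inj) (inj_eq (addIr _)).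
  by apply/CrealP/eqP.
(* An eigenvalue of the compression inside the circle, via a nonzero vector of
   the spectral subspace near [(c b, b)]. *)
have eig_exists : exists N, forall n, (N <= n)%N -> exists mu u,
    [/\ rnorm (mu - c) < r, Un n u, u != 0 & P n (Gop T Ts mu u) = 0].
  have [b Fb b0] : exists2 b, Gop T Ts c b = 0 & b != 0.
    have [_ En0 _] := zP; apply: contrapT => no; apply: En0.
    apply/seteqP; split=> [x Ex|x ->]; last first.
      by split; [have [[[]]] := normalA|rewrite (opA0 normalA) scaler0].
    apply: contrapT => /eqP x0; apply: no; exists x => //; apply/Fker.
    by apply: sub_lspan; left; rewrite /disc_eigspace asboolT.
  (* With this tolerance, and a quarter of [|x|] for [tau], the vector [h] is within [|x| / 2] of
     [x] and so cannot be 0. *)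
  have d0 : 0 < 1 / 4 / (C + 1) :> R by rewrite !divr_gt0 // ltr_wpDl.
  have [N1 hN1] := small _ d0.
  exists (maxn N0 N1) => n; rewrite geq_max => /andP[n0 n1].
  have [_ _ near _] := uni n n0 _ (ltW d0) (hN1 n n1).
  pose x : (H * H)%type := (c *: b, b).
  have nx : 0 < pair_norm x.
    apply: lt_le_trans (le_pair2 x); rewrite lt_def rnorm_ge0 andbT.
    by apply: contra_neq b0; exact: rnorm_eq0.
  have F1 : Gop T Ts c (c *: b) = 0.
    by have := sK; rewrite /Defs.subspace => -[h0 h]; have := h c b 0 Fb h0; rewrite addr0.
  have [h Mhh hh] := near x _ (divr_gt0 nx (ltr0n R 4)) F1 Fb (or_intror erefl).
  apply: (Mhat_eig_exists dotE (hP n) (hS n) Mhh); apply/eqP => h0.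
  move: hh; rewrite h0 subr0.
  have : C * (1 / 4 / (C + 1) * pair_norm x) <= 1 / 4 * pair_norm x.
    rewrite mulrA ler_pM2r // mulrCA -[leRHS]mulr1 ler_wpM2l //.
    by rewrite ler_pdivrMr ?ltr_wpDl // mul1r lerDl.
  by clear - nx; lra.
have sigP n w : sigma_S dot A (psi n) w <-> w != al /\
    exists u, [/\ Un n u, u != 0 & P n (Gop T Ts (w - al)^-1 u) = 0].
  exact: (sigma_S_pencil dotE normalA BN TK w (psiP n) (LnA n) (hP n)).
have [N1 hN1] := eig_exists.
have loc n mu u : (N0 <= n)%N -> rnorm (mu - c) < r -> Un n u -> u != 0 ->
    P n (Gop T Ts mu u) = 0 -> rnorm (mu - c) <= C * (Ce * eps n).
  by move=> n0; have [_ _ _] := uni n n0 _ (eta0 n) (heta n); apply.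
have loc_small (d : R) : 0 < d -> exists N, forall n, (N <= n)%N -> forall mu u,
    rnorm (mu - c) < r -> Un n u -> u != 0 -> P n (Gop T Ts mu u) = 0 ->
    rnorm (mu - c) < d.
  move=> d0; have d1 : 0 < d / (C + 1) by rewrite divr_gt0 // ltr_wpDl.
  have [N2 hN2] := small _ d1; exists (maxn N0 N2) => n.
  rewrite geq_max => /andP[n0 n2] mu u mr Uu u0 Pu.
  have [_ _ _ h] := uni n n0 _ (ltW d1) (hN2 n n2).
  apply: le_lt_trans (h mu u mr Uu u0 Pu) _.
  by rewrite mulrCA gtr_pMr // ltr_pdivrMr ?ltr_wpDl // mul1r ltrDl.
have ex_eig n : exists mu, (N1 <= n)%N -> exists u,
    [/\ rnorm (mu - c) < r, Un n u, u != 0 & P n (Gop T Ts mu u) = 0].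
  have [n1|n1] := leqP N1 n; last by exists 0.
  by have [mu [u hu]] := hN1 n n1; exists mu => _; exists u.
have [mu hmu] := choice ex_eig.
pose w n := al + (mu n)^-1.
have muE n : (w n - al)^-1 = mu n by rewrite /w addrC addKr invrK.
have zE : z = al + c^-1 by rewrite /c invrK addrC subrK.
have sw n : (N1 <= n)%N -> mu n != 0 -> sigma_S dot A (psi n) (w n).
  move=> n1 m0; have [u [h1 h2 h3 h4]] := hmu n n1.
  apply/sigP; split; first by rewrite -subr_eq0 /w addrC addKr invr_eq0.
  by exists u; rewrite muE.
(* Only [mu n != 0] and the lower bound on [|mu n|] are wanted here; the tolerance 1 is
   arbitrary. *)
have [d d0 hd] := inv_close c0 ltr01.
have [N2 hN2] := loc_small d d0.
have mu_near n : (N1 <= n)%N -> (N2 <= n)%N -> rnorm (mu n - c) < d.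
  by move=> n1 n2; have [u [h1 h2 h3 h4]] := hmu n n1; exact: hN2 h1 h2 h3 h4.
move=> eps'; have epsE n : eps' n = eps n by [].
split.
(* The nonreal case decides the factor [rnorm c + 2]: the two components contribute [rnorm c + 1]
   and [1]. *)
- pose Cg := C * (rnorm c + 2) * Ce.
  exists Cg; exists N0 => // n /= n0; rewrite epsE -/al -/c MhE.
  have [u1 u2 u3 _] := uni n n0 _ (eta0 n) (heta n); rewrite -/(Mh n) in u1 u2 u3.
  have e0n := eta0 n; have Ceps := mulr_ge0 C0 (eta0 n).
  have g0 := mulr_ge0 (ltW nc) Ceps.
  have CgE : Cg * eps n = (rnorm c + 2) * (C * (Ce * eps n)) by rewrite /Cg; ring.
  rewrite /gap ge_max; apply/andP; split; rewrite CgE.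
    apply: (delta_le (inge0 J2)); first by clear - Ceps g0; lra.
    move=> v Mv v1 tau tau0.
    have hq := u1 v Mv; rewrite v1 mulr1 in hq.
    have Fpr x : lspan [set` phi ++ phi'] (oproj dot e0 x).
      by rewrite phiF; apply/Fker/ker; exact: oproj_in.
    have [zr|zr] := boolP (z \is Num.real).
      exists (oproj dot e0 v.1, oproj dot e0 v.2); first exact: M_space_real.
      have -> : v - (oproj dot e0 v.1, oproj dot e0 v.2) =
          (v.1 - oproj dot e0 v.1, v.2 - oproj dot e0 v.2) by [].
      by rewrite -/(qn2 dot e0 v); clear - hq g0 Ceps tau0; lra.
    exists (c *: oproj dot e0 v.2, oproj dot e0 v.2); first exact: M_space_nonreal.
    have cc : c^* != c by rewrite -realE.
    have hf := u2 cc v Mv; rewrite v1 mulr1 in hf.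
    have hf2 := le_trans (le_pair2 _) hf.
    rewrite (_ : (S n v - c *: v).2 = v.1 - c *: v.2) in hf2; last by rewrite hS.
    have h2 := le_trans (qn2_2 dot e0 v) hq.
    apply: le_trans (pair_le _) _ => /=.
    have -> : v.1 - c *: oproj dot e0 v.2 =
        (v.1 - c *: v.2) + c *: (v.2 - oproj dot e0 v.2).
      by rewrite scalerBr addrA subrK.
    have h3 := inND J (v.1 - c *: v.2) (c *: (v.2 - oproj dot e0 v.2)).
    rewrite (inNZ J) in h3.
    by have h4 := ler_wpM2l (ltW nc) h2; clear - h2 h3 h4 hf2 tau0; lra.
  apply: (delta_le (inge0 J2)); first by clear - Ceps g0; lra.
  move=> x /M_spaceP hx x1 tau tau0.
  have [F1 F2 xc] : [/\ F x.1, F x.2 & c^* = c \/ x.1 = c *: x.2].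
    move: hx; rewrite phiF realE; case: eqP => cc [h1 h2]; split=> //; first by left.
      by rewrite h2; exact: (sub_scale sF).
    by right.
  have [h Mhh hh] := u3 x tau tau0 ((Fker _).1 F1) ((Fker _).1 F2) xc.
  by exists h => //; rewrite x1 mulr1 in hh; clear - hh g0 Ceps; lra.
(* [|z - w n| = |mu n - c| / (|c| |mu n|)], and [|mu n| >= |c| / 2]. *)
- exists (2 / rnorm c ^+ 2 * (C * Ce)); exists (maxn N0 (maxn N1 N2)) => // n /=.
  rewrite !geq_max => /and3P[n0 n1 n2].
  have [m0 mc _] := hd _ (mu_near n n1 n2).
  apply: (distC_le (sw n n1 m0)).
  have [u [h1 h2 h3 h4]] := hmu n n1; have h := loc n (mu n) u n0 h1 h2 h3 h4.
  have -> : z - w n = (mu n - c) / (c * mu n).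
    by rewrite zE /w opprD addrACA subrr add0r; field; rewrite c0 m0.
  rewrite rnormM rnormV rnormM epsE.
  have mp : 0 < rnorm (mu n) := rnorm_gt0 m0.
  rewrite ler_pdivrMr ?mulr_gt0 //.
  have -> : 2 / rnorm c ^+ 2 * (C * Ce) * eps n * (rnorm c * rnorm (mu n)) =
      C * (Ce * eps n) * (rnorm (mu n) / (rnorm c / 2)) by field; rewrite gt_eqF.
  have h5 : 1 <= rnorm (mu n) / (rnorm c / 2) by rewrite ler_pdivlMr ?divr_gt0 // mul1r.
  apply: le_trans h _; rewrite -[leLHS]mulr1; apply: ler_wpM2l h5.
  exact: mulr_ge0 C0 (eta0 n).
apply/isolatedP; split.
  exists w; split.
    exists (maxn N1 N2) => // n /=; rewrite geq_max => /andP[n1 n2].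
    by have [m0 _ _] := hd _ (mu_near n n1 n2); exact: sw.
  apply/cvg_complexP => e e1; have [d' d'0 hd'] := inv_close c0 e1.
  have [N3 hN3] := loc_small d' d'0.
  exists (maxn N1 N3) => n; rewrite geq_max => /andP[n1 n3].
  have [u [h1 h2 h3 h4]] := hmu n n1.
  have [_ _] := hd' _ (hN3 n n3 _ _ h1 h2 h3 h4).
  by rewrite zE /w opprD addrACA subrr add0r {2}/rnorm distrC.
(* The map sending [w] to [(w - al)^-1] takes the [rho]-neighbourhood of [z] into the disc of radius
   [r] about [c]. A limit point there other than [z] would yield eigenvalues in an annulus around
   [c], from which [stable_annulus] bars them for large [n]. *)
have [rho rho0 hrho] := inv_close zal0 r0.
exists rho => // w' [w_ [[N3 _ hN3] /cvg_complexP cw]] wz.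
apply: contrapT => wne.
have sub_al (x y : R[i]) : (x - al) - (y - al) = x - y by rewrite opprB addrA subrK.
have [w'0 _ mr] : [/\ w' - al != 0, rnorm (z - al) / 2 <= rnorm (w' - al) &
    rnorm ((w' - al)^-1 - c) < r] by apply: hrho; rewrite sub_al.
set mu' := (w' - al)^-1 in mr.
have mc : mu' != c.
  by apply/eqP => /invr_inj/addIr.
have s0 : 0 < rnorm (mu' - c) by apply: rnorm_gt0; rewrite subr_eq0.
(* Within [t] of [mu'] the distance to [c] stays between [rnorm (mu' - c) / 2] and [r]. *)
pose t := Num.min (rnorm (mu' - c) / 2) (r - rnorm (mu' - c)).
have t0 : 0 < t by rewrite lt_min divr_gt0 // subr_gt0.
have [d2 d20 hd2] := inv_close w'0 t0.
have [N4 hN4] := cw _ d20.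
have s2 : 0 < rnorm (mu' - c) / 2 by rewrite divr_gt0.
have [Ca [N5 [_ stab]]] := stable_annulus dotE BN separated disc hP cP s2.
pose n := maxn N3 (maxn N4 N5).
have n3 : (N3 <= n)%N by rewrite leq_maxl.
have n4 : (N4 <= n)%N by rewrite /n !leq_max leqnn !orbT.
have n5 : (N5 <= n)%N by rewrite /n !leq_max leqnn !orbT.
have /sigP[wal [u [Uu u0 Pu]]] := hN3 n n3.
have [_ _] : [/\ w_ n - al != 0, rnorm (w' - al) / 2 <= rnorm (w_ n - al) &
    rnorm ((w_ n - al)^-1 - mu') < t].
  by apply: hd2; rewrite sub_al; have := hN4 n n4; rewrite {1}/rnorm distrC.
set mn := (w_ n - al)^-1 in Pu *; rewrite lt_min => /andP[t1 t2].
have near1 := rnormD (mn - mu') (mu' - c).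
have near2 := rnormD (mu' - mn) (mn - c).
rewrite !addrA !subrK in near1 near2.
rewrite [rnorm (mu' - mn)](_ : _ = rnorm (mn - mu')) in near2; last first.
  by rewrite /rnorm distrC.
have := stab n n5 mn _ u Uu; rewrite Pu rnorm0 mulr0 => h.
have bnd : rnorm (mu' - c) / 2 <= rnorm (mn - c) <= r.
  by clear - near1 near2 t1 t2; apply/andP; split; lra.
have u_le : rnorm u <= 0 by exact: h.
move/eqP: u0; apply; apply: rnorm_eq0; apply/eqP.
by rewrite eq_le u_le rnorm_ge0.
Qed.
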